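(* Let $p\ge1$ and let $K$ be the Sierpiński gasket equipped with its geodesic metric $d$ and normalized Hausdorff measure $\mu$. Then the property $\mathcal P(p,\alpha_p)$ holds on $(K,d,\mu)$. Therefore, if $p>1$, there exist constants $C_1,C_2>0$ such that for every $f\in KS^{\alpha_p,p}(K)$, $$C_1\,\mathrm{Var}_p(f)^p\le\mathcal E_p(f)\le C_2\,\mathrm{Var}_p(f)^p.$$
   Context: Sierpiński gasket: let $V_0=\{q_1,q_2,q_3\}$ be the vertices of an equilateral triangle of side $1$ in $\mathbb C$, $\psi_i(z)=\frac{z-q_i}2+q_i$, $i=1,2,3$; $K$ is the unique non-empty compact subset of $\mathbb C$ with $K=\bigcup_{i=1}^3\psi_i(K)$. $d$ is the geodesic metric on $K$ and $\mu$ is the unique Borel measure on $K$ with $\mu(\psi_{i_1}\circ\cdots\circ\psi_{i_n}(K))=3^{-n}$ for all $i_1,\dots,i_n\in\{1,2,3\}$. Put $V_{m+1}=\bigcup_{i=1}^3\psi_i(V_m)$, $W_n=\{1,2,3\}^n$ and $\Psi_w=\psi_{i_1}\circ\cdots\circ\psi_{i_n}$ for $w=(i_1,\dots,i_n)\in W_n$. For $x,y\in V_m$, $x\sim y$ means that $x\ne y$ are neighbors, i.e. both belong to $\Psi_w(V_0)$ for some $w\in W_m$. Let $B(x,r)=\{y\in K:d(x,y)<r\}$. For $p\ge1$, $\alpha\ge0$, $r>0$, $f\in L^p(K,\mu)$ put $$E_{p,\alpha}(f,r)=\int_K\frac{1}{\mu(B(x,r))}\int_{B(x,r)}\frac{|f(y)-f(x)|^p}{r^{p\alpha}}\,d\mu(y)\,d\mu(x).$$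 $\mathcal B^{\alpha,p}(K)=\{f\in L^p(K,\mu):\sup_{r>0}E_{p,\alpha}(f,r)<+\infty\}$, $KS^{\alpha,p}(K)=\{f\in L^p(K,\mu):\limsup_{r\to0}E_{p,\alpha}(f,r)<+\infty\}$. ''Constant'' means constant $\mu$-a.e. $\alpha_p=\sup\{\alpha\ge0:\mathcal B^{\alpha,p}(K)\text{ contains non-constant functions}\}$. Property $\mathcal P(p,\alpha)$: $KS^{\alpha,p}(K)$ contains non-constant functions and there is a constant $C\ge1$ such that for every $f\in KS^{\alpha,p}(K)$, $\sup_{r>0}E_{p,\alpha}(f,r)\le C\liminf_{r\to0}E_{p,\alpha}(f,r)$. $\mathrm{Var}_p(f)=\liminf_{r\to0}E_{p,\alpha_p}(f,r)^{1/p}$. Renormalization number: for $p>1$ let $F_p(a)=|a_1-a_2|^p+|a_2-a_3|^p+|a_3-a_1|^p$, $a\in\mathbb R^3$. It is known (Herman–Peirone–Strichartz) that there exist a non-negative continuous convex function $A_p$ on $\mathbb R^3$ and a number $0<r_p<1$ such that $A_p\simeq F_p$ (two-sided bounds up to positive multiplicative constants) and, for all $a\in\mathbb R^3$, $\min_{b\in\mathbb R^3}\big(A_p(a_1,b_2,b_3)+A_p(b_1,a_2,b_3)+A_p(b_1,b_2,a_3)\big)=r_pA_p(a)$; the number $r_p$ is unique. It is known that $\alpha_1=d_h$ and, for $p>1$, $\alpha_p=\frac1p\left(\frac{\log3}{\log2}-\frac{\log r_p}{\log2}\right)>\frac{d_h}{p}$, where $d_h=\frac{\log3}{\log2}$.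 For $p>1$ every $f\in KS^{\alpha_p,p}(K)$ has a continuous version, and $KS^{\alpha_p,p}(K)$ is regarded as a subset of $C(K)$. For $p>1$ and $f\in C(K)$: $\mathcal E_p^m(f)=\frac12 r_p^{-m}\sum_{x,y\in V_m,\,x\sim y}|f(x)-f(y)|^p$ and $\mathcal E_p(f)=\sup_{m\ge0}\mathcal E_p^m(f)\in[0,+\infty]$. *)

(* Defs.v *)
From HB Require Import structures.
From mathcomp Require Import all_boot all_order all_algebra.
From mathcomp Require Import all_classical all_reals all_analysis.

Set Implicit Arguments.
Unset Strict Implicit.
Unset Printing Implicit Defensive.

Import Order.TTheory GRing.Theory Num.Theory.
Import numFieldNormedType.Exports.

Local Open Scope classical_set_scope.
Local Open Scope ring_scope.

(* The complex plane is represented as R * R. The library norm on R * R is the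
   sup norm: it induces the right topology, but lengths are measured with
   [edist]. *)
Notation plane R := (R * R)%type.
Notation borel_plane R := (g_sigma_algebraType (@open (R * R)%type)).

Definition edist (R : realType) (z w : plane R) : R :=
  Num.sqrt ((z.1 - w.1) ^+ 2 + (z.2 - w.2) ^+ 2).

Definition unit_equilateral (R : realType) (q : 'I_3 -> plane R) : Prop :=
  forall i j, i != j -> edist (q i) (q j) = 1.

Section gasket.
Variables (R : realType) (q : 'I_3 -> plane R).

Definition psi (i : 'I_3) (z : plane R) : plane R := 2^-1 *: (z - q i) + q i.

(* Psi [:: i1; ...; in] = psi i1 \o ... \o psi in *)
Definition Psi (w : seq 'I_3) : plane R -> plane R :=
  foldr (fun i g => psi i \o g) id w.

Definition is_gasket (K : set (plane R)) : Prop :=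
  [/\ compact K, K !=set0 & K = \bigcup_i (psi i @` K)].

Fixpoint Vert (m : nat) : set (plane R) :=
  if m is m'.+1 then \bigcup_i (psi i @` Vert m') else range q.

Definition neighbors (m : nat) (x y : plane R) : Prop :=
  x <> y /\ exists w : m.-tuple 'I_3,
    (Psi w @` Vert 0) x /\ (Psi w @` Vert 0) y.

(* A Borel measure on K is represented as a Borel measure on the plane which
   vanishes outside K. *)
Definition is_gasket_measure (K : set (plane R))
    (mu : {measure set (borel_plane R) -> \bar R}) : Prop :=
  mu (~` K) = 0%E /\
  forall (n : nat) (w : n.-tuple 'I_3), mu (Psi w @` K) = (3 ^- n)%:E.

(* Ordered pairs of neighbors, whence the factor 1/2. *)
Definition energy_level (p rp : R) (m : nat) (f : plane R -> R) : R :=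
  2^-1 * rp ^- m *
  \sum_(xy \in [set xy : plane R * plane R |
                 [/\ Vert m xy.1, Vert m xy.2 & neighbors m xy.1 xy.2]])
    `|f xy.1 - f xy.2| `^ p.

Definition energy (p rp : R) (f : plane R -> R) : \bar R :=
  ereal_sup [set (energy_level p rp m f)%:E | m in [set: nat]].

End gasket.

Section geodesic_distance.
Variables (R : realType) (K : set (plane R)).

Definition polygonal_length (g : R -> plane R) (s : seq R) : R :=
  \sum_(0 <= n < size s) edist (g (nth 0 (0 :: s) n)) (g (nth 0 s n)).

Definition curve_length (g : R -> plane R) : \bar R :=
  ereal_sup [set (polygonal_length g s)%:E | s in itv_partition 0 1].

Definition curve_in (x y : plane R) (g : R -> plane R) : Prop :=
  [/\ {within `[0, 1], continuous g}, g 0 = x, g 1 = y &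
      forall t, 0 <= t <= 1 -> K (g t)].

Definition geodist (x y : plane R) : \bar R :=
  ereal_inf [set curve_length g | g in curve_in x y].

Definition geoball (x : plane R) (r : R) : set (plane R) :=
  [set y | K y /\ (geodist x y < r%:E)%E].

End geodesic_distance.

Section korevaar_schoen.
Variables (R : realType) (K : set (plane R)).
Variable mu : {measure set (borel_plane R) -> \bar R}.
Implicit Types (p alpha r : R) (f : plane R -> R).

(* The values of f outside K are irrelevant throughout. *)
Definition Lp p f : Prop :=
  measurable_fun (K : set (borel_plane R)) (f : borel_plane R -> R) /\
  (\int[mu]_(x in K) (`|f x| `^ p)%:E < +oo)%E.

Definition KSenergy p alpha f r : \bar R :=
  (\int[mu]_(x in K)
     ((mu (geoball K x r))^-1 *
      \int[mu]_(y in geoball K x r)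
         (`|f y - f x| `^ p / r `^ (p * alpha))%:E))%E.

Definition supKSenergy p alpha f : \bar R :=
  ereal_sup [set KSenergy p alpha f r | r in [set r | 0 < r]].

Definition Besov p alpha f : Prop :=
  Lp p f /\ (supKSenergy p alpha f < +oo)%E.

Definition KS p alpha f : Prop :=
  Lp p f /\ (limf_esup (KSenergy p alpha f) 0^'+ < +oo)%E.

Definition ae_constant f : Prop :=
  exists c : R, {ae mu, forall x, K x -> f x = c}.

Definition critical_exponent p : R :=
  sup [set alpha | 0 <= alpha /\
                   exists f, Besov p alpha f /\ ~ ae_constant f].

Definition propertyP p alpha : Prop :=
  (exists f, KS p alpha f /\ ~ ae_constant f) /\
  exists C : R, 1 <= C /\
    forall f, KS p alpha f ->
      (supKSenergy p alpha f <=
         C%:E * limf_einf (KSenergy p alpha f) 0^'+)%E.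

Definition Var p f : \bar R :=
  limf_einf (fun r => KSenergy p (critical_exponent p) f r `^ p^-1)%E 0^'+.

End korevaar_schoen.

Section renormalization.
Variable R : realType.

Definition Fp (p : R) (a : 'rV[R]_3) : R :=
  `|a 0 0 - a 0 1| `^ p + `|a 0 1 - a 0 2| `^ p + `|a 0 2 - a 0 0| `^ p.

(* For i = 0, 1, 2 the argument of A is (a1, b2, b3), (b1, a2, b3),
   (b1, b2, a3) respectively. *)
Definition renorm_sum (A : 'rV[R]_3 -> R) (a b : 'rV[R]_3) : R :=
  \sum_(i < 3) A (\row_j (if j == i then a 0 j else b 0 j)).

Definition is_renormalization_number (p rp : R) : Prop :=
  0 < rp < 1 /\
  exists A : 'rV[R]_3 -> R,
    [/\ forall a, 0 <= A a,
        continuous A,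
        convex_function setT A,
        exists c1 c2 : R, [/\ 0 < c1, 0 < c2 &
          forall a, c1 * Fp p a <= A a <= c2 * Fp p a] &
        forall a, (exists b, renorm_sum A a b = rp * A a) /\
                  forall b, rp * A a <= renorm_sum A a b].

End renormalization.

(* Main.v *)
Require Import Defs.
From HB Require Import structures.
From mathcomp Require Import all_boot all_order all_fingroup all_algebra.
From mathcomp Require Import ring lra zify.
From mathcomp Require Import all_classical all_reals all_analysis.
From mathcomp Require Import measurable_realfun.

Set Implicit Arguments.
Unset Strict Implicit.
Unset Printing Implicit Defensive.

Import Order.TTheory GRing.Theory Num.Theory.
Import numFieldNormedType.Exports.

Local Open Scope classical_set_scope.
Local Open Scope ring_scope.

(** Everything is reduced to finite energies on the cells [Psi w @` K] with [w] a
   word. Let [F] be the energy [Fp p] of three values and [T] the operator that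
   optimizes the values at the three inner vertices of the triangle after one
   subdivision ([renorm]). All iterates [T^n F] are symmetric, homogeneous and
   invariant under constants, which makes each of them comparable to a multiple of
   [F] ([regular_le_Fp], [Fp_le_regular]). These factors are multiplicative up to
   constants, so that [c * r ^+ n * F <= T^n F <= C * r ^+ n * F] for some [r]
   ([scaling_exists]). A renormalization number is such an [r]
   ([renormalization_number_scaling]), [r < 1] when [p > 1], and [r = 1] when
   [p = 1].

   For a function [f] and a real number [g w] for each cell of level [n],
   [oscillation f n g] adds the [L^p] distances between [f] and [g w] on the cells
   and the differences of [g] on touching cells, weighted by the measure of a cell.
   A ball of radius about [2 ^- n] contains a cell and the cells that touch it at a
   slightly finer level, and is covered by a cell and the cells that touch it at a
   slightly coarser one. Hence [rho `^ (p * alpha)] times the Korevaar-Schoen energy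
   is up to constants at most the oscillation at a slightly coarser level for every
   [g] ([KSenergy_le]), and at least the oscillation at a slightly finer level for
   some [g], made of values of [f] at points where the integrand is almost minimal
   ([oscillation_le]).

   The heart of the proof is weak monotonicity ([oscillation_weak_mono]): coarsening
   by [j] levels increases the oscillation by at most a constant times
   [(3 / r) ^+ j]. The values [g] on fine cells are moved to their vertices, and the
   coarse values are those of the vertex function at one corner of each coarse cell.
   The gradient term is controlled since the optimal energy decays at the rate [r]
   ([senergy_mono]), and the [L^p] term by a Poincare inequality on the graph of
   vertices ([poincare]).

   At the exponent with [2 `^ (p * alpha) = 3 / r] the loss [(3 / r) ^+ j] is exactly
   compensated by the powers of the radii, so that the energy at any radius is
   bounded by a constant times the energy at every small radius
   ([KSenergy_weak_mono]); this is the inequality of the property [P(p, alpha)]. At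
   larger exponents the same estimate forces [f] to be constant
   ([Besov_supercritical]). The exponent is therefore critical as soon as its Besov
   space contains a function that is not constant. For [p = 1] the indicator of a
   cell is one, because its boundary consists of boundedly many cells at each level.
   For [p > 1] almost optimal extensions of the boundary values 1, 0, 0 have a limit
   along an ultrafilter; as [r < 1], differences along edges decay geometrically and
   the limit is continuous ([energy_minimizing_limit]).

   The bounds for the energy on vertices follow along the same lines. A continuous
   function with [senergy m f <= S * r ^+ m] has oscillations of order
   [S * (r / 3) ^+ n] ([oscillation_continuous]), which bounds the variation.
   Conversely the values of [f] chosen on fine cells for small radii give functions
   on fine vertices that are uniformly close to [f] at level [m] and, by the decay of
   the optimal energy, have energy of order [r ^+ m] times the Korevaar-Schoen energy
   ([senergy_le_KSenergy]). *)

(** * Powers and growth rates *)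

Section powers.
Variables (R : realType) (p : R).
Hypothesis hp : 1 <= p.

Let p_gt0 : 0 < p. Proof. exact: lt_le_trans hp. Qed.
Let p_neq0 : p != 0. Proof. exact: lt0r_neq0. Qed.

Definition pw (x : R) : R := `|x| `^ p.

Lemma pw_ge0 x : 0 <= pw x. Proof. exact: powR_ge0. Qed.

Lemma pw0 : pw 0 = 0. Proof. by rewrite /pw normr0 powR0. Qed.

Lemma pw1 : pw 1 = 1. Proof. by rewrite /pw normr1 powR1. Qed.

Lemma pwM x y : pw (x * y) = pw x * pw y.
Proof. by rewrite /pw normrM powRM. Qed.

Lemma pwN x : pw (- x) = pw x. Proof. by rewrite /pw normrN. Qed.

Lemma pwC x y : pw (x - y) = pw (y - x).
Proof. by rewrite /pw distrC. Qed.

Lemma pw_gt0 x : x != 0 -> 0 < pw x.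
Proof. by move=> x0; rewrite powR_gt0// normr_gt0. Qed.

Lemma pw_eq0 x : pw x = 0 -> x = 0.
Proof. by move=> /powR_eq0_eq0/normr0_eq0. Qed.

Lemma ler_pw x y : `|x| <= `|y| -> pw x <= pw y.
Proof. by move=> xy; apply: ge0_ler_powR => //; rewrite ?nnegrE ?ltW. Qed.

Lemma pw_le x y : pw x <= pw y -> `|x| <= `|y|.
Proof.
apply: contraTT; rewrite -!ltNge => yx.
by apply: gt0_ltr_powR => //; rewrite ?nnegrE.
Qed.

Lemma pw_root x (y : R) : 0 <= y -> pw x <= y -> `|x| <= y `^ p^-1.
Proof.
move=> y0 xy; rewrite -[leRHS]ger0_norm ?powR_ge0//; apply: pw_le.
rewrite (le_trans xy)// /pw ger0_norm ?powR_ge0// -powRrM mulVf// powRr1//.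
Qed.

(** The constant of the quasi-triangle inequality for the p-th power. *)
Definition kap : R := 2 `^ p.

Lemma kap_ge1 : 1 <= kap.
Proof. by rewrite /kap -[leLHS](powRr0 2) ler_powR ?ler1n// ltW. Qed.

Lemma kap_gt0 : 0 < kap. Proof. exact: lt_le_trans kap_ge1. Qed.

Lemma pwD x y : pw (x + y) <= kap * (pw x + pw y).
Proof.
wlog xy : x y / `|x| <= `|y|.
  move=> H; case: (leP `|x| `|y|) => [/H//|/ltW/H].
  by rewrite addrC [in leRHS]addrC.
have : pw (x + y) <= pw (2 * y).
  apply: ler_pw; rewrite normrM (@ger0_norm _ 2)//.
  by rewrite (le_trans (ler_normD _ _))//; lra.
move/le_trans; apply; rewrite pwM {1}/pw ger0_norm// -/kap.
by rewrite ler_pM2l ?kap_gt0// lerDr pw_ge0.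
Qed.

Lemma pwB x y z : pw (x - z) <= kap * (pw (x - y) + pw (y - z)).
Proof. by rewrite (_ : x - z = (x - y) + (y - z)) ?pwD//; ring. Qed.

Lemma pwD3 x y z : pw (x + y + z) <= kap ^+ 2 * (pw x + pw y + pw z).
Proof.
rewrite (le_trans (pwD _ _))// expr2 -mulrA ler_pM2l ?kap_gt0//.
rewrite mulrDr lerD ?pwD// ler_peMl ?pw_ge0 ?kap_ge1//.
Qed.

(** Weighting the quasi-triangle inequality to have constant 2 on one side: the
   recursion that proves the Poincare inequality gains a factor 3, so that it
   absorbs a factor 2 but not [kap]. *)
Lemma pwD_weighted : exists2 C, 0 < C &
  forall x y, pw (x + y) <= 2 * pw x + C * pw y.
Proof.
(* If [`|y| <= eta * `|x|], then [`|x + y|] is at most [2 `^ p^-1 * `|x|]. *)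
pose eta : R := 2 `^ p^-1 - 1.
have eta_gt0 : 0 < eta.
  by rewrite subr_gt0 -[ltLHS](powRr0 2) /powR !ifF ?gt_eqF// ltr_expR
    ltr_pM2r ?invr_gt0// ln_gt0// ltr1n.
exists (pw (1 + eta^-1)).
  by rewrite pw_gt0// gt_eqF// addr_gt0// invr_gt0.
move=> x y; have [yx|xy] := leP `|y| (eta * `|x|).
  rewrite -[leLHS]addr0 lerD ?mulr_ge0 ?pw_ge0//.
  have -> : 2 * pw x = pw (2 `^ p^-1 * x).
    by rewrite pwM {2}/pw ger0_norm ?powR_ge0// -powRrM mulVf// powRr1.
  apply: ler_pw; rewrite normrM (@ger0_norm _ (2 `^ _)) ?powR_ge0//.
  rewrite (le_trans (ler_normD _ _))// (_ : 2 `^ p^-1 = 1 + eta); last first.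
    by rewrite /eta; ring.
  by rewrite mulrDl mul1r lerD2l.
rewrite -[leLHS]add0r lerD ?mulr_ge0 ?pw_ge0// -pwM; apply: ler_pw.
rewrite normrM (@ger0_norm _ (1 + _)); last first.
  by rewrite addr_ge0 ?invr_ge0// ltW.
rewrite (le_trans (ler_normD _ _))// mulrDl mul1r addrC lerD2l.
by rewrite ler_pdivlMl// ltW.
Qed.

End powers.

Lemma powR_exprn (R : realType) (a b : R) n : 0 <= a ->
  (a ^+ n) `^ b = (a `^ b) ^+ n.
Proof.
move=> a0; have <- : a `^ n%:R = a ^+ n by rewrite powR_mulrn.
by rewrite -powRrM mulrC powRrM powR_mulrn ?powR_ge0.
Qed.

(** Evaluating both sides at the n-th power and letting n grow. *)
Lemma ler_expr_bounded (R : realType) (c x y D : R) :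
  0 < c -> 0 <= x -> 0 < y -> (forall n, c * x ^+ n.+1 <= D * y ^+ n.+1) ->
  x <= y.
Proof.
move=> c0 x0 y0 H; rewrite leNgt; apply/negP => yx.
pose z := x / y - 1.
have z0 : 0 < z by rewrite subr_gt0 ltr_pdivlMr// mul1r.
have bern n : 1 + n%:R * z <= (x / y) ^+ n.
  elim: n => [|n IH]; first by rewrite mul0r addr0 expr0.
  rewrite exprS (_ : x / y = 1 + z) in IH *; last by rewrite /z; ring.
  have : (1 + z) * (1 + n%:R * z) <= (1 + z) * (1 + z) ^+ n.
    by rewrite ler_pM2l// addr_gt0.
  apply: le_trans; rewrite -natr1.
  have : 0 <= n%:R * z * z by rewrite !mulr_ge0// ltW.
  by nra.
have bd n : (x / y) ^+ n.+1 <= D / c.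
  by rewrite expr_div_n ler_pdivrMr ?exprn_gt0// mulrAC ler_pdivlMr// mulrC H.
have [n nD] : exists n : nat, D / c < n%:R * z.
  exists (Num.truncn (D / c / z)).+1.
  by rewrite -ltr_pdivrMr// truncnS_gt.
have := le_trans (bern n.+1) (bd n); rewrite leNgt => /negP; apply.
rewrite (lt_le_trans nD)// -natr1 mulrDl mul1r.
by rewrite [leRHS]addrC -addrA lerDl addr_ge0// ltW.
Qed.

(** Fekete's lemma with constants on both sides: the growth rate is the infimum
   of the n-th roots, and each side of the hypothesis bounds the sequence by its
   powers from one side. *)
Lemma quasi_multiplicative_rate (R : realType) (t : nat -> R) (C D : R) :
  (forall n, 0 < t n) -> 1 <= C -> 1 <= D ->
  (forall n m, t (n + m)%N <= C * (t n * t m)) ->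
  (forall n m, t n * t m <= D * t (n + m)%N) ->
  exists2 r : R, 0 < r & forall n, r ^+ n.+1 <= C * t n.+1 /\ t n.+1 <= D * r ^+ n.+1.
Proof.
move=> t0 C1 D1 sub sup.
have C0 : 0 < C by exact: lt_le_trans C1.
have D0 : 0 < D by exact: lt_le_trans D1.
have t0' n : 0 <= t n by exact: ltW.
have C0' : 0 <= C by exact: ltW.
have D0' : 0 <= D by exact: ltW.
have Ct n : 0 <= C * t n by exact: mulr_ge0.
have tD n : 0 <= t n / D by exact: divr_ge0.
have subX m n : t (n.+1 * m)%N <= (C * t m) ^+ n.+1.
  elim: n => [|n IH]; first by rewrite mul1n expr1 ler_peMl.
  rewrite mulSn (le_trans (sub _ _))// mulrA exprS ler_pM2l ?mulr_gt0//.
have supX m n : (t m / D) ^+ n.+1 <= t (n.+1 * m)%N / D.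
  elim: n => [|n IH]; first by rewrite mul1n expr1.
  rewrite mulSn exprS.
  have : (t m / D) * (t m / D) ^+ n.+1 <= (t m / D) * (t (n.+1 * m)%N / D).
    by rewrite ler_pM2l// divr_gt0.
  move/le_trans; apply; rewrite mulrACA mulrA ler_pM2r ?invr_gt0//.
  by rewrite ler_pdivrMr// [leRHS]mulrC.
have cross n m : (t n.+1 / D) ^+ m.+1 <= (C * t m.+1) ^+ n.+1.
  rewrite (le_trans (supX _ _))// ler_pdivrMr//.
  by rewrite mulnC (le_trans (subX _ _))// ler_peMr// exprn_ge0.
pose x n : R := (C * t n.+1) `^ (n.+1%:R)^-1.
pose S := [set x n | n in [set: nat]].
have rootX (a : R) n : 0 <= a -> (a `^ (n.+1%:R)^-1) ^+ n.+1 = a.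
  move=> a0; rewrite -powR_mulrn ?powR_ge0// -powRrM mulVf ?powRr1//.
have lbS n : lbound S ((t n.+1 / D) `^ (n.+1%:R)^-1).
  move=> _ [m _ <-].
  rewrite -(@ler_pXn2r _ (n.+1 * m.+1)) ?nnegrE ?powR_ge0//.
  by rewrite {1}exprM rootX// mulnC exprM rootX.
have hlb : has_lbound S by exists ((t 1%N / D) `^ (1%:R)^-1); exact: (lbS 0%N).
have S0 : S !=set0 by exists (x 0%N); exists 0%N.
exists (inf S).
  apply: lt_le_trans (lb_le_inf S0 (lbS 0%N)).
  by rewrite powR_gt0// divr_gt0.
have infS0 : 0 <= inf S.
  by apply: lb_le_inf => // _ [m _ <-]; rewrite powR_ge0.
move=> n; split.
  rewrite -[leRHS](rootX _ n)// lerXn2r ?nnegrE ?powR_ge0//.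
  by apply: ge_inf => //; exists n.
rewrite mulrC -ler_pdivrMr// -[leLHS](rootX _ n)//.
by rewrite lerXn2r ?nnegrE ?powR_ge0//; apply: lb_le_inf.
Qed.

(** * Renormalization of energies on three points *)

Lemma I3_ind (P : 'I_3 -> Prop) : P 0 -> P 1 -> P 2 -> forall i, P i.
Proof.
move=> P0 P1 P2 [[|[|[|//]]] i3].
- by rewrite (_ : Ordinal i3 = 0)//; exact: val_inj.
- by rewrite (_ : Ordinal i3 = 1)//; exact: val_inj.
- by rewrite (_ : Ordinal i3 = 2)//; exact: val_inj.
Qed.

Lemma sum_I3 (V : nmodType) (G : 'I_3 -> V) : \sum_i G i = G 0 + G 1 + G 2.
Proof.
rewrite !big_ord_recr big_ord0 /= add0r.
by congr (G _ + G _ + G _); exact: val_inj.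
Qed.

Lemma third_neq (i j : 'I_3) : i != j -> - (i + j) != i /\ - (i + j) != j.
Proof. by move: i j; elim/I3_ind; elim/I3_ind. Qed.

Section renormalization_operator.
Variables (R : realType) (p : R).
Hypothesis hp : 1 <= p.
Local Notation vec := 'rV[R]_3.
Local Notation pw := (pw p).
Local Notation kap := (kap p).
Local Notation F := (Fp p).
Implicit Types (A : vec -> R) (a b : vec).

(** The energy that remains after the values at the inner vertices have been
   optimized. *)
Definition renorm A a : R := inf (range (renorm_sum A a)).

Definition permute (s : {perm 'I_3}) a : vec := \row_j a 0 (s j).

(** The properties of [Fp] that survive renormalization with the same constant.
   They pin down an energy on three points up to a factor, because the
   permutations act irreducibly on the vectors modulo constants. *)
Record regular A : Prop := Regular {
  regular_ge0 : forall a, 0 <= A a;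
  regularD : forall a b, A (a + b) <= kap * (A a + A b);
  regularZ : forall l a, A (l *: a) = pw l * A a;
  regular_perm : forall s a, A (permute s a) = A a;
  regular_const : forall a c, A (a + const_mx c) = A a }.

Lemma FpE a : F a = pw (a 0 0 - a 0 1) + pw (a 0 1 - a 0 2) + pw (a 0 2 - a 0 0).
Proof. by []. Qed.

Lemma Fp_ge0 a : 0 <= F a.
Proof. by rewrite FpE !addr_ge0 ?pw_ge0. Qed.

Lemma edge_le_Fp a i j : pw (a 0 i - a 0 j) <= F a.
Proof.
rewrite FpE; move: (pw_ge0 p (a 0 0 - a 0 1)) (pw_ge0 p (a 0 1 - a 0 2))
  (pw_ge0 p (a 0 2 - a 0 0)).
elim/I3_ind: i; elim/I3_ind: j; rewrite ?subrr ?pw0//;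
  rewrite ?(pwC p (a 0 1) (a 0 0)) ?(pwC p (a 0 2) (a 0 1))
   ?(pwC p (a 0 0) (a 0 2)); lra.
Qed.

Lemma Fp_perm s a : F (permute s a) = F a.
Proof.
have FE b : F b + F b = \sum_i \sum_j pw (b 0 i - b 0 j).
  rewrite !sum_I3 !subrr !pw0// FpE (pwC p (b 0 1) (b 0 0))
    (pwC p (b 0 2) (b 0 1)) (pwC p (b 0 0) (b 0 2)); ring.
suff : F (permute s a) + F (permute s a) = F a + F a by lra.
rewrite !FE [RHS](reindex_inj (@perm_inj _ s)); apply: eq_bigr => i _.
rewrite [RHS](reindex_inj (@perm_inj _ s)); apply: eq_bigr => j _.
by rewrite !mxE.
Qed.

Lemma Fp_regular : regular F.
Proof.
split.
- exact: Fp_ge0.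
- move=> a b; rewrite !FpE !mxE.
  have H (x y z t : R) : pw (x + y - (z + t)) <= kap * (pw (x - z) + pw (y - t)).
    by rewrite (_ : x + y - (z + t) = (x - z) + (y - t)) ?pwD//; ring.
  have := H (a 0 0) (b 0 0) (a 0 1) (b 0 1).
  have := H (a 0 1) (b 0 1) (a 0 2) (b 0 2).
  have := H (a 0 2) (b 0 2) (a 0 0) (b 0 0).
  lra.
- by move=> l a; rewrite !FpE !mxE -!mulrBr !pwM !mulrDr.
- exact: Fp_perm.
- move=> a c; rewrite !FpE !mxE.
  by congr (pw _ + pw _ + pw _); ring.
Qed.

Lemma has_inf_renorm A a : (forall a, 0 <= A a) ->
  has_inf (range (renorm_sum A a)).
Proof.
move=> A0; split; first by exists (renorm_sum A a 0); exists 0.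
by exists 0 => _ [b _ <-]; rewrite /renorm_sum sumr_ge0.
Qed.

Lemma renorm_le A a b : (forall a, 0 <= A a) -> renorm A a <= renorm_sum A a b.
Proof.
by move=> A0; apply: ge_inf; [case: (has_inf_renorm a A0) | exists b].
Qed.

Lemma renorm_ge A a x : (forall b, x <= renorm_sum A a b) -> x <= renorm A a.
Proof.
move=> H; apply: lb_le_inf; first by exists (renorm_sum A a 0); exists 0.
by move=> _ [b _ <-].
Qed.

Lemma renorm_ge0 A a : (forall a, 0 <= A a) -> 0 <= renorm A a.
Proof. by move=> A0; apply: renorm_ge => b; rewrite /renorm_sum sumr_ge0. Qed.

Lemma renorm_near A a e : (forall a, 0 <= A a) -> 0 < e ->
  exists b, renorm_sum A a b <= renorm A a + e.
Proof.
move=> A0 e0; have [_ [b _ <-] /ltW H] := inf_adherent e0 (has_inf_renorm a A0).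
by exists b.
Qed.

Lemma renorm_compare A B a a' c : 0 < c -> (forall a, 0 <= A a) ->
  (forall b, exists b', renorm_sum A a' b' <= c * renorm_sum B a b) ->
  renorm A a' <= c * renorm B a.
Proof.
move=> c0 A0 H; rewrite -ler_pdivrMl//; apply: renorm_ge => b.
rewrite ler_pdivrMl//; have [b' Hb] := H b.
exact: le_trans (renorm_le _ _ A0) Hb.
Qed.

Lemma renorm_mono A B c : 0 < c -> (forall a, 0 <= A a) ->
  (forall a, A a <= c * B a) -> forall a, renorm A a <= c * renorm B a.
Proof.
move=> c0 A0 AB a; apply: renorm_compare => // b; exists b.
by rewrite /renorm_sum mulr_sumr; apply: ler_sum.
Qed.

Lemma renorm_regular A : regular A -> regular (renorm A).
Proof.
case=> A0 AD AZ Ap Ac.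
have k0 := kap_gt0 hp.
have Z1 l a : l != 0 -> renorm A (l *: a) <= pw l * renorm A a.
  move=> l0; apply: renorm_compare => //; first exact: pw_gt0.
  move=> b; exists (l *: b); rewrite /renorm_sum mulr_sumr; apply: ler_sum => i _.
  rewrite -AZ le_eqVlt; apply/orP; left; apply/eqP; congr A.
  by apply/rowP => j; rewrite !mxE; case: ifP.
have p1 s a : renorm A (permute s a) <= 1 * renorm A a.
  apply: renorm_compare => // b; exists (permute s b); rewrite mul1r.
  rewrite /renorm_sum [leRHS](reindex_inj (@perm_inj _ s)); apply: ler_sum => i _.
  rewrite -[leRHS](Ap s) le_eqVlt; apply/orP; left; apply/eqP; congr A.
  by apply/rowP => j; rewrite !mxE (inj_eq perm_inj).
have c1 a c : renorm A (a + const_mx c) <= 1 * renorm A a.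
  apply: renorm_compare => // b; exists (b + const_mx c); rewrite mul1r.
  apply: ler_sum => i _.
  rewrite -[leRHS](Ac _ c) le_eqVlt; apply/orP; left; apply/eqP; congr A.
  by apply/rowP => j; rewrite !mxE; case: ifP.
split.
- by move=> a; exact: renorm_ge0.
- move=> a b; apply/ler_addgt0Pr => e e0.
  have e'0 : 0 < e / (2 * kap) by rewrite divr_gt0// mulr_gt0.
  have [x Hx] := renorm_near a A0 e'0.
  have [y Hy] := renorm_near b A0 e'0.
  rewrite (le_trans (renorm_le (a + b) (x + y) A0))//.
  apply: (@le_trans _ _ (kap * (renorm_sum A a x + renorm_sum A b y))).
    rewrite /renorm_sum -big_split mulr_sumr; apply: ler_sum => i _ /=.
    apply: le_trans (AD _ _); rewrite le_eqVlt; apply/orP; left; apply/eqP.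
    by congr A; apply/rowP => j; rewrite !mxE; case: ifP.
  rewrite (_ : e = kap * (e / (2 * kap) + e / (2 * kap))); last by field; lra.
  by rewrite -mulrDr ler_pM2l//; lra.
- move=> l a; have [->|l0] := eqVneq l 0.
    rewrite pw0// mul0r scale0r; apply/eqP; rewrite eq_le renorm_ge0// andbT.
    rewrite (le_trans (renorm_le 0 0 A0))// /renorm_sum big1// => i _.
    rewrite (_ : \row_j _ = 0 *: (0 : vec)) ?AZ ?pw0 ?mul0r// scaler0.
    by apply/rowP => j; rewrite !mxE if_same.
  apply/eqP; rewrite eq_le Z1//=.
  have := Z1 l^-1 (l *: a); rewrite scalerA mulVf// scale1r invr_eq0 => /(_ l0).
  rewrite -(ler_pM2l (pw_gt0 p l0)) mulrA -pwM divff// pw1 mul1r//.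
- move=> s a; apply/eqP; rewrite eq_le -[leRHS]mul1r p1/=.
  have := p1 s^-1%g (permute s a); rewrite mul1r; congr (renorm A _ <= _).
  by apply/rowP => j; rewrite !mxE permKV.
- move=> a c; apply/eqP; rewrite eq_le -[leRHS]mul1r c1/=.
  have := c1 (a + const_mx c) (- c); rewrite mul1r; congr (renorm A _ <= _).
  by apply/rowP => j; rewrite !mxE addrK.
Qed.

Definition unit_vec (i : 'I_3) : vec := \row_j (j == i)%:R.

Lemma regular_unit_vec A i : regular A -> A (unit_vec i) = A (unit_vec 0).
Proof.
move=> hA; rewrite -(regular_perm hA (tperm 0 i) (unit_vec 0)); congr A.
apply/rowP => j; rewrite !mxE; congr (_%:R).
by rewrite -(inj_eq (@perm_inj _ (tperm 0 i))) tpermR.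
Qed.

(** The vector is a combination of two unit vectors up to a constant. *)
Lemma regular_le_Fp A a : regular A ->
  A a <= kap * A (unit_vec 0) * F a.
Proof.
move=> hA; have e : a = (a 0 0 - a 0 2) *: unit_vec 0 +
    (a 0 1 - a 0 2) *: unit_vec 1 + const_mx (a 0 2).
  by apply/rowP; elim/I3_ind; rewrite !mxE /=; ring.
rewrite [in leLHS]e (regular_const hA) (le_trans (regularD hA _ _))//.
rewrite !(regularZ hA) (regular_unit_vec 1 hA) -mulrDl.
rewrite [X in kap * X]mulrC mulrA ler_wpM2l//.
  by rewrite mulr_ge0 ?(regular_ge0 hA)// ltW ?kap_gt0.
rewrite FpE (pwC p (a 0 2)); have := pw_ge0 p (a 0 0 - a 0 1); lra.
Qed.

Lemma unit_vec_third i j : i != j -> 3 *: unit_vec i + const_mx (-1) =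
  (unit_vec i - unit_vec j) + (unit_vec i - unit_vec (- (i + j))).
Proof.
by move: i j; elim/I3_ind; elim/I3_ind => // _; apply/rowP; elim/I3_ind;
  rewrite !mxE /=; ring.
Qed.

(** Antisymmetrizing [a] under a transposition isolates one edge difference. *)
Lemma regular_edge A a i j : regular A -> i != j ->
  A (unit_vec 0) * pw (a 0 i - a 0 j) <= 4 * kap ^+ 2 * A a.
Proof.
move=> hA ij; have k0 := kap_gt0 hp; have A0 := regular_ge0 hA.
pose k : 'I_3 := - (i + j).
have [ki kj] : k != i /\ k != j by exact: third_neq.
have AN b : A (- b) = A b by rewrite -scaleN1r (regularZ hA) pwN pw1 mul1r.
pose d : vec := unit_vec i - unit_vec j.
have dik : A (unit_vec i - unit_vec k) = A d.
  rewrite -(regular_perm hA (tperm j k) d); congr A; apply/rowP => l; rewrite !mxE.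
  congr (_%:R - _%:R).
    rewrite -[in LHS](inj_eq (@perm_inj _ (tperm j k))) (@tpermD _ j k i)// eq_sym//.
  by rewrite -[in LHS](inj_eq (@perm_inj _ (tperm j k))) tpermR.
have tle : A (unit_vec 0) <= 2 * kap * A d.
  apply: (@le_trans _ _ (A (3 *: unit_vec i + const_mx (-1)))).
    rewrite (regular_const hA) (regularZ hA) (regular_unit_vec i hA).
    rewrite ler_peMl// -[leLHS](pw1 p) ler_pw// normr1 ger0_norm//; lra.
  have -> : 3 *: unit_vec i + const_mx (-1) = d + (unit_vec i - unit_vec k).
    exact: unit_vec_third.
  rewrite (le_trans (regularD hA _ _))// dik; lra.
have Ad : pw (a 0 i - a 0 j) * A d <= 2 * kap * A a.
  rewrite -(regularZ hA).
  have -> : (a 0 i - a 0 j) *: d = a + - permute (tperm i j) a.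
    apply/rowP => l; rewrite !mxE.
    have [->|li] := eqVneq l i; first by rewrite tpermL (negbTE ij)/=; ring.
    have [->|lj] := eqVneq l j; first by rewrite tpermR/=; ring.
    by rewrite tpermD 1?eq_sym//=; ring.
  rewrite (le_trans (regularD hA _ _))// AN (regular_perm hA); lra.
have := ler_wpM2r (pw_ge0 p (a 0 i - a 0 j)) tle.
move/le_trans; apply.
have -> : 2 * kap * A d * pw (a 0 i - a 0 j) =
  2 * kap * (pw (a 0 i - a 0 j) * A d) by ring.
have -> : 4 * kap ^+ 2 * A a = 2 * kap * (2 * kap * A a) by ring.
by rewrite ler_pM2l// mulr_gt0.
Qed.

Lemma Fp_le_regular A a : regular A ->
  A (unit_vec 0) * F a <= 12 * kap ^+ 2 * A a.
Proof.
move=> hA; rewrite FpE !mulrDr.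
have := @regular_edge A a 0 1 hA erefl.
have := @regular_edge A a 1 2 hA erefl.
have := @regular_edge A a 2 0 hA erefl.
lra.
Qed.

Definition renorm_iter n : vec -> R := iter n renorm F.

Lemma renorm_iter_regular n : regular (renorm_iter n).
Proof.
by elim: n => [|n IH]; [exact: Fp_regular | exact: renorm_regular].
Qed.

Lemma renorm_iter_ge0 n a : 0 <= renorm_iter n a.
Proof. exact: regular_ge0 (renorm_iter_regular n) a. Qed.

Lemma iter_renorm_mono A B c n : 0 < c -> (forall a, 0 <= A a) ->
  (forall a, A a <= c * B a) ->
  forall a, iter n renorm A a <= c * iter n renorm B a.
Proof.
move=> c0 A0 AB; have iA0 m a : 0 <= iter m renorm A a.
  by elim: m a => [//|m IH] a; exact: renorm_ge0.
elim: n => [//|n IH] a /=; exact: renorm_mono.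
Qed.

Definition rate_seq n := renorm_iter n (unit_vec 0).

Lemma renorm_iterD n m : renorm_iter (n + m) = iter n renorm (renorm_iter m).
Proof. by rewrite /renorm_iter iterD. Qed.

Lemma Fp_unit_vec : F (unit_vec 0) = 2.
Proof. rewrite FpE !mxE /= ?subrr ?subr0 ?sub0r ?pwN ?pw1 ?pw0//; ring. Qed.

(** A triangle inequality through an inner vertex. *)
Lemma Fp_le_renorm_sum k a b :
  (forall x y z, pw (x - z) <= k * (pw (x - y) + pw (y - z))) ->
  0 <= k -> F a <= k * renorm_sum F a b.
Proof.
move=> H k0; rewrite /renorm_sum sum_I3 !FpE !mxE /=.
have := H (a 0 0) (b 0 2) (a 0 1); have := H (a 0 1) (b 0 0) (a 0 2).
have := H (a 0 2) (b 0 1) (a 0 0).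
rewrite (pwC p (a 0 0) (b 0 2)) (pwC p (b 0 2) (a 0 1)) (pwC p (a 0 1) (b 0 0)).
rewrite (pwC p (b 0 0) (a 0 2)) (pwC p (a 0 2) (b 0 1)) (pwC p (b 0 1) (a 0 0)).
have P x y : 0 <= k * pw (x - y) by rewrite mulr_ge0 ?pw_ge0.
have := P (b 0 1) (b 0 2); have := P (b 0 2) (b 0 0); have := P (b 0 0) (b 0 1).
lra.
Qed.

Lemma Fp_le_renorm a : F a <= kap * renorm F a.
Proof.
rewrite -ler_pdivrMl ?kap_gt0//; apply: renorm_ge => b.
rewrite ler_pdivrMl ?kap_gt0//; apply: Fp_le_renorm_sum; last exact/ltW/kap_gt0.
by move=> x y z; exact: pwB.
Qed.

(** Iterating a lower bound for one renormalization, with a constant that is 1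
   when [p = 1] and [kap] otherwise. *)
Lemma Fp_le_renorm_iter k n a : 0 < k -> (forall a, F a <= k * renorm F a) ->
  F a <= k ^+ n * renorm_iter n a.
Proof.
move=> k0 H; elim: n a => [|n IH] a; first by rewrite mul1r.
apply: (le_trans (IH a)); rewrite exprSr -mulrA ler_pM2l ?exprn_gt0//.
rewrite /renorm_iter iterSr; apply: iter_renorm_mono => //.
exact: Fp_ge0.
Qed.

Lemma rate_seq_gt0 n : 0 < rate_seq n.
Proof.
have := Fp_le_renorm_iter n (unit_vec 0) (kap_gt0 hp) Fp_le_renorm.
rewrite Fp_unit_vec => /(lt_le_trans (ltr0n R 2)).
by rewrite pmulr_rgt0 // exprn_gt0// kap_gt0.
Qed.

(** The inner vertices get the value [t], except the one opposite to the jump,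
   which gets 0. *)
Lemma rate_seqS_le n (t : R) : 0 <= t <= 1 ->
  rate_seq n.+1 <= (pw (1 - t) + 2 * pw t) * rate_seq n.
Proof.
move=> t01; have hA := renorm_iter_regular n.
pose b : vec := \row_j (if j == 0 then 0 else t).
rewrite (le_trans (renorm_le _ b (regular_ge0 hA)))// /renorm_sum sum_I3.
rewrite -/(renorm_iter n).
rewrite le_eqVlt; apply/orP; left; apply/eqP.
rewrite (_ : \row_j _ = (1 - t) *: unit_vec 0 + const_mx t); last first.
  by apply/rowP; elim/I3_ind; rewrite !mxE /=; ring.
rewrite (_ : \row_j _ = t *: unit_vec 2); last first.
  by apply/rowP; elim/I3_ind; rewrite !mxE /=; ring.
rewrite (_ : \row_j _ = t *: unit_vec 1); last first.
  by apply/rowP; elim/I3_ind; rewrite !mxE /=; ring.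
rewrite (regular_const hA) !(regularZ hA) (regular_unit_vec 1 hA).
rewrite (regular_unit_vec 2 hA) /rate_seq; ring.
Qed.

Lemma rate_seq_le2 n : rate_seq n <= 2.
Proof.
elim: n => [|n IH]; first by rewrite /rate_seq /= Fp_unit_vec.
have := @rate_seqS_le n 0; rewrite subr0 pw1 pw0// mulr0 addr0 mul1r lexx ler01.
by move=> /(_ isT)/le_trans; apply.
Qed.

Lemma rate_seq_submul n m : rate_seq (n + m) <= kap * (rate_seq n * rate_seq m).
Proof.
rewrite {1}/rate_seq renorm_iterD (mulrC (rate_seq n)) mulrA.
apply: iter_renorm_mono => [|a|a].
- by rewrite mulr_gt0 ?kap_gt0 ?rate_seq_gt0.
- exact: renorm_iter_ge0.
- exact/regular_le_Fp/renorm_iter_regular.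
Qed.

Lemma rate_seq_supmul n m :
  rate_seq n * rate_seq m <= 12 * kap ^+ 2 * rate_seq (n + m).
Proof.
have t0 := rate_seq_gt0 m; have k0 := kap_gt0 hp.
rewrite -ler_pdivlMr// {2}/rate_seq renorm_iterD mulrAC.
apply: iter_renorm_mono => [|a|a].
- by rewrite divr_gt0// mulr_gt0 ?exprn_gt0.
- exact: Fp_ge0.
- rewrite mulrAC ler_pdivlMr// mulrC.
  exact/Fp_le_regular/renorm_iter_regular.
Qed.

(** The rate at which the optimal energies decay with the level. It makes sense
   for [p = 1], where no renormalization number below 1 exists. *)
Definition scaling (r : R) := 0 < r /\ exists c C, [/\ 0 < c, 0 < C &
  forall n a, c * r ^+ n * F a <= renorm_iter n a <= C * r ^+ n * F a].

(** The renormalized energies decay geometrically: all of them are comparable to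
   a multiple of [Fp], and the multiples are quasi-multiplicative. *)
Lemma scaling_exists : exists r, scaling r.
Proof.
have k0 := kap_gt0 hp; have k1 := kap_ge1 hp.
have k12 : 1 <= 12 * kap ^+ 2 by have := exprn_ege1 2 k1; lra.
have [r r0 Hr] := quasi_multiplicative_rate rate_seq_gt0 k1 k12
  rate_seq_submul rate_seq_supmul.
exists r; split=> //.
exists (kap ^-1 * (12 * kap ^+ 2)^-1), (kap * (12 * kap ^+ 2)).
have K0 : 0 < 12 * kap ^+ 2 by exact: lt_le_trans k12.
split; [by rewrite mulr_gt0 ?invr_gt0|by rewrite mulr_gt0|].
case=> [|n] a.
  rewrite !expr0 !mulr1 /=; apply/andP; split.
    by rewrite ler_piMl ?Fp_ge0// mulr_ile1 ?invr_ge0 ?invf_le1// ltW.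
  by rewrite ler_peMl ?Fp_ge0// mulr_ege1.
have [H1 H2] := Hr n; have F0 := Fp_ge0 a.
have hA := renorm_iter_regular n.+1.
apply/andP; split.
  rewrite (mulrC kap^-1) -mulrA -mulrA ler_pdivrMl//.
  apply: le_trans (Fp_le_regular a hA).
  rewrite mulrA ler_wpM2r// ler_pdivrMl//.
by rewrite (le_trans (regular_le_Fp a hA))// ler_wpM2r// -mulrA ler_pM2l.
Qed.

Lemma scaling_le r : scaling r -> forall th : R, 0 < th ->
  (forall n, rate_seq n <= 2 * th ^+ n) -> r <= th.
Proof.
move=> [r0 [c [C [c0 C0 H]]]] th th0 Hth.
apply: (@ler_expr_bounded _ (c * 2) _ _ 2) => //.
- by rewrite mulr_gt0.
- exact: ltW.
move=> n; have /andP[] := H n.+1 (unit_vec 0); rewrite Fp_unit_vec => h _.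
by rewrite mulrAC; apply: (le_trans h); have := Hth n.+1; rewrite /rate_seq.
Qed.

Lemma scaling_le1 r : scaling r -> r <= 1.
Proof.
move=> /scaling_le; apply=> // n; rewrite expr1n mulr1; exact: rate_seq_le2.
Qed.

(** Moving a small part [t] of a unit jump off its vertex saves about [t] in the
   cell at that vertex and costs only [t `^ p] in the two other cells. *)
Lemma scaling_lt1 r : 1 < p -> scaling r -> r < 1.
Proof.
move=> p1 /scaling_le H; have p10 : 0 < p - 1 by rewrite subr_gt0.
(* Then [t `^ p = t / 4], and the rate is at most [1 - t + 2 * (t / 4)]. *)
pose t : R := 4^-1 `^ (p - 1)^-1.
have t0 : 0 < t by rewrite powR_gt0// invr_gt0.
have t1 : t < 1.
  have : 4^-1 `^ (p - 1)^-1 < 1 `^ (p - 1)^-1.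
    by rewrite gt0_ltr_powR ?invr_gt0 ?nnegrE// ?invr_ge0//; lra.
  by rewrite powR1.
have tp : pw t = t / 4.
  rewrite /pw ger0_norm ?(ltW t0)// -{1}(subrK 1 p) powRD; last first.
    by rewrite (gt_eqF t0) implybT.
  rewrite powRr1 ?ltW// mulrC /t -powRrM mulVf ?gt_eqF// powRr1 ?invr_ge0//.
have t1p : pw (1 - t) <= 1 - t.
  rewrite /pw ger0_norm; last by lra.
  rewrite -[leRHS]powRr1; last by lra.
  by apply: ger_powR => //; lra.
pose th := pw (1 - t) + 2 * pw t.
have th1 : th < 1 by rewrite /th tp; lra.
have th0 : 0 < th.
  by rewrite ltr_wpDl ?pw_ge0// mulr_gt0// pw_gt0// gt_eqF.
apply: le_lt_trans th1; apply: H => // n.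
elim: n => [|n IH]; first by rewrite /rate_seq /= Fp_unit_vec mulr1.
rewrite (le_trans (@rate_seqS_le n t _))//; first by lra.
by rewrite exprS mulrCA ler_pM2l.
Qed.

(** For [p = 1] the triangle inequality holds with constant 1, so that
   optimizing inner values does not decrease the energy. *)
Lemma scaling_ge1 r : p = 1 -> scaling r -> 1 <= r.
Proof.
move=> p1 [r0 [c [C [c0 C0 H]]]].
have FT a : F a <= 1 * renorm F a.
  rewrite mul1r; apply: renorm_ge => b; rewrite -[leRHS]mul1r.
  apply: Fp_le_renorm_sum => // x y z; rewrite mul1r /pw p1 !powRr1//.
  by rewrite (_ : x - z = (x - y) + (y - z)) ?ler_normD//; ring.
apply: (@ler_expr_bounded _ 2 _ _ (C * 2)) => // n.
have /andP[_] := H n.+1 (unit_vec 0).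
have := @Fp_le_renorm_iter 1 n.+1 (unit_vec 0) ltr01 FT.
rewrite !expr1n !Fp_unit_vec; lra.
Qed.

(** The renormalization equation determines the rate, since iterating it
   compares the renormalizations of [Fp] with powers of [rp]. *)
Lemma renormalization_number_scaling rp :
  is_renormalization_number p rp -> scaling rp.
Proof.
move=> [/andP[rp0 _] [A [A0 _ _ [c1 [c2 [c10 c20 AF]]] Aeq]]].
have iA n a : iter n renorm A a = rp ^+ n * A a.
  elim: n a => [|n IH] a; first by rewrite mul1r.
  have [[b Hb] Hle] := Aeq a.
  have sumE b' : renorm_sum (iter n renorm A) a b' = rp ^+ n * renorm_sum A a b'.
    by rewrite /renorm_sum mulr_sumr; apply: eq_bigr => i _; rewrite IH.
  have iA0 a' : 0 <= iter n renorm A a' by rewrite IH mulr_ge0 ?exprn_ge0// ltW.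
  apply/eqP; rewrite eq_le; apply/andP; split.
    by rewrite (le_trans (renorm_le a b iA0))// sumE Hb mulrA -exprSr.
  apply: renorm_ge => b'; rewrite sumE exprSr -mulrA ler_pM2l ?exprn_gt0//.
split=> //; exists (c1 / c2), (c2 / c1).
have FA a : F a <= c1^-1 * A a.
  by rewrite ler_pdivlMl//; case/andP: (AF a).
have AF' a : A a <= c2 * F a by case/andP: (AF a).
split; [by rewrite divr_gt0|by rewrite divr_gt0|move=> n a; apply/andP; split].
  have := iter_renorm_mono n c20 A0 AF' a; rewrite iA => H.
  have /andP[Fa _] := AF a.
  rewrite -(ler_pM2l c20); apply: le_trans H.
  rewrite (_ : c2 * _ = rp ^+ n * (c1 * F a)); first by rewrite ler_pM2l ?exprn_gt0.
  by field; rewrite gt_eqF.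
have c1V : 0 < c1^-1 by rewrite invr_gt0.
have := iter_renorm_mono n c1V Fp_ge0 FA a; rewrite iA => /le_trans; apply.
have /andP[_ Fa] := AF a.
rewrite (_ : c2 / c1 * rp ^+ n * F a = c1^-1 * (rp ^+ n * (c2 * F a))); last by ring.
by rewrite ler_pM2l// ler_pM2l ?exprn_gt0.
Qed.

End renormalization_operator.

(** * Words and barycentric coordinates *)

Lemma geometric_le0 (R : realType) (a M th : R) : 0 <= th < 1 ->
  (forall n, a <= M * th ^+ n) -> a <= 0.
Proof.
move=> /andP[th0 th1] H.
have : M * th ^+ n @[n --> \oo] --> M * 0.
  by apply: cvgZr => /=; apply: cvg_expr; rewrite ger0_norm.
rewrite mulr0 => cv; rewrite -(cvg_lim _ cv)//.
apply: limr_ge; first by apply/cvg_ex; exists 0.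
by apply: nearW => n; exact: H.
Qed.

Section words.

Fixpoint words (n : nat) : seq (seq 'I_3) :=
  if n is n'.+1 then [seq i :: w | i <- enum 'I_3, w <- words n'] else [:: [::]].

Lemma mem_words n w : (w \in words n) = (size w == n).
Proof.
elim: n w => [|n IH] w; first by case: w.
apply/allpairsP/idP => [[[i v] /= [_ vn ->]]|]; first by rewrite /= eqSS -IH.
case: w => [//|i w]; rewrite /= eqSS -IH => wn.
by exists (i, w); rewrite mem_enum.
Qed.

Lemma words_uniq n : uniq (words n).
Proof.
elim: n => [//|n IH]; apply: allpairs_uniq => //; first exact: enum_uniq.
by move=> [i v] [j w] _ _ /= [-> ->].
Qed.

Lemma sum_words0 (V : nmodType) (G : seq 'I_3 -> V) :
  \sum_(w <- words 0) G w = G [::].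
Proof. by rewrite big_seq1. Qed.

Lemma sum_wordsS (V : nmodType) n (G : seq 'I_3 -> V) :
  \sum_(w <- words n.+1) G w = \sum_i \sum_(w <- words n) G (i :: w).
Proof.
rewrite /= big_flatten big_map big_enum /=.
by apply: eq_bigr => i _; rewrite big_map.
Qed.

Lemma sum_words_cat (V : nmodType) n j (G : seq 'I_3 -> V) :
  \sum_(w <- words (n + j)) G w =
  \sum_(w <- words n) \sum_(v <- words j) G (w ++ v).
Proof.
elim: n G => [|n IH] G; first by rewrite sum_words0.
by rewrite addSn !sum_wordsS; apply: eq_bigr => i _; rewrite IH.
Qed.

Lemma size_words n : size (words n) = (3 ^ n)%N.
Proof.
elim: n => [//|n IH]; rewrite size_allpairs IH size_enum_ord expnS//.
Qed.

Lemma sum_words_const (R : pzRingType) n (c : R) :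
  \sum_(w <- words n) c = 3 ^+ n * c.
Proof.
by rewrite big_const_seq count_predT size_words iter_addr_0 -[LHS]mulr_natl natrX.
Qed.

End words.

Section barycentric.
Variables (R : realType) (q : 'I_3 -> plane R).
Hypothesis hq : unit_equilateral q.
Local Notation edist := Defs.edist.
Local Notation Psi := (Psi q).
Local Notation psi := (psi q).
Implicit Types (z : plane R) (w v : seq 'I_3).

Lemma sqr_edist (z z' : plane R) :
  edist z z' ^+ 2 = (z.1 - z'.1) ^+ 2 + (z.2 - z'.2) ^+ 2.
Proof. by rewrite sqr_sqrtr// addr_ge0 ?sqr_ge0. Qed.

Lemma euclid_ge0 (z z' : plane R) : 0 <= edist z z'.
Proof. exact: sqrtr_ge0. Qed.

Lemma coord1_le_edist (z z' : plane R) : `|z.1 - z'.1| <= edist z z'.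
Proof.
rewrite -sqrtr_sqr; apply: ler_wsqrtr; by rewrite lerDl sqr_ge0.
Qed.

Lemma coord2_le_edist (z z' : plane R) : `|z.2 - z'.2| <= edist z z'.
Proof.
rewrite -sqrtr_sqr; apply: ler_wsqrtr; by rewrite lerDr sqr_ge0.
Qed.

Lemma norm_le_edist (z z' : plane R) : `|z - z'| <= edist z z'.
Proof.
by rewrite prod_normE ge_max coord1_le_edist coord2_le_edist.
Qed.

Lemma edist_le_norm (z z' : plane R) : edist z z' <= 2 * `|z - z'|.
Proof.
have h1 : `|z.1 - z'.1| <= `|z - z'| by rewrite prod_normE le_max lexx.
have h2 : `|z.2 - z'.2| <= `|z - z'| by rewrite prod_normE le_max lexx orbT.
rewrite -(@ler_pXn2r _ 2) ?nnegrE ?euclid_ge0 ?mulr_ge0// sqr_edist.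
rewrite -(real_normK (num_real (z.1 - z'.1))) -(real_normK (num_real (z.2 - z'.2))).
have := normr_ge0 (z.1 - z'.1); have := normr_ge0 (z.2 - z'.2).
have := normr_ge0 (z - z'); nra.
Qed.

Lemma equilateral_sqr i j : i != j ->
  ((q i).1 - (q j).1) ^+ 2 + ((q i).2 - (q j).2) ^+ 2 = 1.
Proof. by move=> ij; rewrite -sqr_edist hq// expr1n. Qed.

Let e01 := @equilateral_sqr 0 1 erefl.
Let e12 := @equilateral_sqr 1 2 erefl.
Let e20 := @equilateral_sqr 2 0 erefl.

(** Barycentric coordinates: [2 * <z - c, q i - c> + 1/3], with c the centroid. *)
Definition bary (i : 'I_3) z : R := 3^-1 +
  2 * ((z.1 - 3^-1 * ((q 0).1 + (q 1).1 + (q 2).1)) *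
       ((q i).1 - 3^-1 * ((q 0).1 + (q 1).1 + (q 2).1)) +
       (z.2 - 3^-1 * ((q 0).2 + (q 1).2 + (q 2).2)) *
       ((q i).2 - 3^-1 * ((q 0).2 + (q 1).2 + (q 2).2))).

Lemma bary_q i j : bary i (q j) = (i == j)%:R.
Proof.
move: e01 e12 e20; rewrite /bary.
by elim/I3_ind: i; elim/I3_ind: j => /= h1 h2 h3; lra.
Qed.

Lemma bary_sum z : bary 0 z + bary 1 z + bary 2 z = 1.
Proof. rewrite /bary; lra. Qed.

Lemma psi1 i z : (psi i z).1 = 2^-1 * (z.1 - (q i).1) + (q i).1.
Proof. by []. Qed.

Lemma psi2 i z : (psi i z).2 = 2^-1 * (z.2 - (q i).2) + (q i).2.
Proof. by []. Qed.

Lemma bary_psi i j z : bary i (psi j z) = (bary i z + (i == j)%:R) / 2.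
Proof. rewrite -bary_q /bary psi1 psi2; lra. Qed.

Lemma bary_inj z z' : (forall i, bary i z = bary i z') -> z = z'.
Proof.
move=> H.
pose v1 := z.1 - z'.1; pose v2 := z.2 - z'.2.
pose a1 := (q 0).1 - (q 1).1; pose a2 := (q 0).2 - (q 1).2.
pose b1 := (q 2).1 - (q 0).1; pose b2 := (q 2).2 - (q 0).2.
have va : v1 * a1 + v2 * a2 = 0.
  have := H 0; have := H 1; rewrite /bary /v1 /v2 /a1 /a2; lra.
have vb : v1 * b1 + v2 * b2 = 0.
  have := H 0; have := H 2; rewrite /bary /v1 /v2 /b1 /b2; lra.
(* Two sides of the triangle are linearly independent. *)
have det : (a1 * b2 - a2 * b1) ^+ 2 = 3 / 4.
  have na : a1 ^+ 2 + a2 ^+ 2 = 1 by [].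
  have nb : b1 ^+ 2 + b2 ^+ 2 = 1 by [].
  have nab : a1 * b1 + a2 * b2 = - 2^-1.
    by move: e01 e12 e20; rewrite /a1 /a2 /b1 /b2; lra.
  have -> : (a1 * b2 - a2 * b1) ^+ 2 = (a1 ^+ 2 + a2 ^+ 2) * (b1 ^+ 2 + b2 ^+ 2)
    - (a1 * b1 + a2 * b2) ^+ 2 by ring.
  by rewrite na nb nab; field.
have d0 : a1 * b2 - a2 * b1 != 0.
  apply/eqP => d; move: det; rewrite d expr0n /=; lra.
have v10 : v1 = 0.
  apply: (mulIf d0); rewrite mul0r.
  have -> : v1 * (a1 * b2 - a2 * b1) =
    b2 * (v1 * a1 + v2 * a2) - a2 * (v1 * b1 + v2 * b2) by ring.
  by rewrite va vb !mulr0 subrr.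
have v20 : v2 = 0.
  apply: (mulIf d0); rewrite mul0r.
  have -> : v2 * (a1 * b2 - a2 * b1) =
    a1 * (v1 * b1 + v2 * b2) - b1 * (v1 * a1 + v2 * a2) by ring.
  by rewrite va vb !mulr0 subrr.
by apply/eqP; rewrite -pair_eqE /pair_eq /= -(subr_eq0 z.1) -/v1 -(subr_eq0 z.2)
  -/v2 v10 v20 eqxx.
Qed.

Lemma bary_lipschitz i z z' : `|bary i z - bary i z'| <= 4 * edist z z'.
Proof.
have hc k : `|(q k).1 - (q i).1| <= 1 /\ `|(q k).2 - (q i).2| <= 1.
  have [->|ki] := eqVneq k i; first by rewrite !subrr normr0.
  by rewrite -(hq ki) coord1_le_edist coord2_le_edist.
set d1 := (q i).1 - 3^-1 * ((q 0).1 + (q 1).1 + (q 2).1).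
set d2 := (q i).2 - 3^-1 * ((q 0).2 + (q 1).2 + (q 2).2).
have hd : `|d1| <= 1 /\ `|d2| <= 1.
  have [+ +] := hc 0; have [+ +] := hc 1; have [+ +] := hc 2.
  by rewrite /d1 /d2 !ler_norml; move=> ? ? ? ? ? ?; split; lra.
have -> : bary i z - bary i z' = 2 * ((z.1 - z'.1) * d1 + (z.2 - z'.2) * d2).
  by rewrite /bary -/d1 -/d2; ring.
rewrite normrM ger0_norm// (_ : 4 * _ = 2 * (edist z z' + edist z z')); last by ring.
rewrite ler_pM2l// (le_trans (ler_normD _ _))// !normrM.
case: hd => hd1 hd2; apply: lerD.
  by rewrite -[leRHS]mulr1 ler_pM ?coord1_le_edist.
by rewrite -[leRHS]mulr1 ler_pM ?coord2_le_edist.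
Qed.

Lemma Psi_cons i w z : Psi (i :: w) z = psi i (Psi w z).
Proof. by []. Qed.

Lemma Psi_cat w v z : Psi (w ++ v) z = Psi w (Psi v z).
Proof. by elim: w => [//|i w IH] /=; rewrite IH. Qed.

Lemma psi_sub i z z' : psi i z - psi i z' = 2^-1 *: (z - z').
Proof. by rewrite /psi opprD addrACA subrr addr0 -scalerBr opprB addrA subrK. Qed.

Lemma norm_psi i z z' : `|psi i z - psi i z'| = 2^-1 * `|z - z'|.
Proof. by rewrite psi_sub normrZ ger0_norm. Qed.

Lemma norm_Psi w z z' : `|Psi w z - Psi w z'| = 2^-1 ^+ size w * `|z - z'|.
Proof.
elim: w => [|i w IH]; first by rewrite mul1r.
by rewrite !Psi_cons norm_psi IH mulrA -exprS.
Qed.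

Lemma psi_fix i : psi i (q i) = q i.
Proof. by rewrite /psi subrr scaler0 add0r. Qed.

Lemma psi_mid i j : psi i (q j) = psi j (q i).
Proof.
apply/eqP; rewrite -pair_eqE /pair_eq !psi1 !psi2.
by apply/andP; split; apply/eqP; lra.
Qed.

(** The coordinates of a cell: an integer triple of sum [2 ^ size w - 1]. *)
Fixpoint wt (i : 'I_3) w : nat :=
  if w is j :: w' then ((i == j) * 2 ^ size w' + wt i w')%N else 0%N.

Lemma bary_Psi i w z : bary i (Psi w z) = (bary i z + (wt i w)%:R) / 2 ^+ size w.
Proof.
elim: w => [|j w IH]; first by rewrite /= addr0 expr0 divr1.
rewrite Psi_cons bary_psi IH /= natrD natrM natrX exprS.
by field; rewrite expf_neq0.
Qed.

Lemma wt_sum w : (wt 0 w + wt 1 w + wt 2 w).+1 = (2 ^ size w)%N.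
Proof.
elim: w => [//|j w]; rewrite /= expnS.
by elim/I3_ind: j; rewrite /=; lia.
Qed.

Lemma wt_lt i w : (wt i w < 2 ^ size w)%N.
Proof. have := wt_sum w; elim/I3_ind: i; lia. Qed.

Lemma wt_inj w w' : size w = size w' -> (forall i, wt i w = wt i w') -> w = w'.
Proof.
elim: w w' => [|j w IH] [|j' w']//= [sw] H.
have jj' : j = j'.
  apply/eqP/negP => /negP jj'.
  by have := H j; rewrite eqxx (negbTE jj') sw; have := wt_lt j w'; lia.
by rewrite jj' in H *; rewrite (IH w')// => i; have := H i; rewrite sw; lia.
Qed.

End barycentric.

(** * Limits along ultrafilters *)

Lemma ultra_fmap (S T : Type) (f : S -> T) (F : set_system S) :
  UltraFilter F -> UltraFilter (fmap f F).
Proof.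
move=> FU; split; first exact: fmap_proper_filter.
move=> G PG sFG; apply/predeqP => A; split; last exact: sFG.
move=> GA; have [//|FnA] := in_ultra_setVsetC (f @^-1` A) FU.
have GnA : G (~` A) by exact: sFG.
have : G set0 by rewrite -(setICr A); exact: filterI.
by move/filter_not_empty.
Qed.

(** Sequential pointwise compactness, along a filter instead of a subsequence. *)
Lemma pointwise_ultralimit (I : Type) (V : topologicalType) (A : I -> set V)
  (u : nat -> I -> V) :
  (forall i, compact (A i)) -> (forall n i, A i (u n i)) ->
  exists (U : set_system nat) (l : I -> V),
    [/\ ProperFilter U, \oo `<=` U, forall i, A i (l i) &
        forall i, u n i @[n --> U] --> l i].
Proof.
move=> cA uA; have [U [UU ooU]] := ultraFilterLemma eventually_filter.
have PU : ProperFilter U by apply: ultra_proper.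
have H i : exists l, A i l /\ u n i @[n --> U] --> l.
  have := cA i; rewrite compact_ultra => cAi.
  have uAi : (fmap (u ^~ i) U) (A i).
    by rewrite /fmap /=; apply: (@filterE _ U) => n; exact: uA.
  by have [l [Al cl]] := cAi _ (ultra_fmap (u ^~ i) UU) uAi; exists l.
have [l Hl] := choice H.
by exists U, l; split=> // i; case: (Hl i).
Qed.

(** * Cells of the gasket *)

Section gasket_geometry.
Variables (R : realType) (q : 'I_3 -> plane R).
Hypothesis hq : unit_equilateral q.
Variable K : set (plane R).
Hypothesis hK : is_gasket q K.
Local Notation edist := Defs.edist.
Local Notation Psi := (Psi q).
Local Notation psi := (psi q).
Local Notation bary := (bary q).
Implicit Types (x y z : plane R) (w v : seq 'I_3).

Let compactK : compact K. Proof. by case: hK. Qed.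

Definition cell w : set (plane R) := Psi w @` K.

Lemma closedK : closed K.
Proof. exact: compact_closed (@norm_hausdorff _ _) compactK. Qed.

Lemma psiK i x : K x -> K (psi i x).
Proof. by move=> Kx; case: hK => _ _ ->; exists i => //; exists x. Qed.

Lemma PsiK w x : K x -> K (Psi w x).
Proof. by move=> Kx; elim: w => [//|i w IH]; apply: psiK. Qed.

Lemma cell_sub w : cell w `<=` K.
Proof. by move=> _ [x Kx <-]; exact: PsiK. Qed.

Lemma cell_nil : cell [::] = K.
Proof. by rewrite /cell image_id. Qed.

Lemma cell_cat w v : cell (w ++ v) `<=` cell w.
Proof.
by move=> _ [x Kx <-]; exists (Psi v x); [exact: PsiK|rewrite Psi_cat].
Qed.

Lemma gasket_cover n x : K x -> exists2 w, w \in words n & cell w x.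
Proof.
elim: n x => [|n IH] x Kx; first by exists [::] => //; rewrite cell_nil.
have : (\bigcup_i (psi i @` K)) x by case: hK => _ _ <-.
move=> [i _ [y /IH[w wn [z Kz wzy]] yx]]; exists (i :: w).
  by rewrite mem_words /= eqSS -mem_words.
by exists z => //; rewrite Psi_cons wzy.
Qed.

Lemma cell_cover j w x : cell w x -> exists2 v, v \in words j & cell (w ++ v) x.
Proof.
move=> [y /(gasket_cover j)[v vj [z Kz <-]] <-].
by exists v => //; exists z => //; rewrite Psi_cat.
Qed.

Lemma bounded_gasket : exists2 M, 0 <= M & forall x, K x -> `|x| <= M.
Proof.
have [M [_ HM]] := compact_bounded compactK.
exists (`|M| + 1); first by rewrite addr_ge0.
by apply: HM; rewrite (le_lt_trans (ler_norm M))// ltrDl.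
Qed.

(** Each map halves the distance below 0, which is bounded on the compact [K]. *)
Lemma bary_ge0 i x : K x -> 0 <= bary i x.
Proof.
have [M M0 HM] := bounded_gasket.
have [B HB] : exists B, forall x, K x -> `|bary i x| <= B.
  exists (`|bary i 0| + 8 * M) => y Ky.
  have := bary_lipschitz hq i y 0; have := edist_le_norm y 0.
  rewrite subr0 => h1 h2; have h3 := HM y Ky.
  have := ler_normD (bary i 0) (bary i y - bary i 0).
  by rewrite addrCA subrr addr0 => /le_trans; apply; rewrite lerD2l; lra.
have H n y : K y -> - bary i y <= B * 2^-1 ^+ n.
  elim: n y => [|n IH] y Ky.
    by rewrite mulr1 (le_trans (ler_norm _))// normrN HB.
  have : (\bigcup_i (psi i @` K)) y by case: hK => _ _ <-.
  move=> [j _ [z Kz <-]]; rewrite bary_psi// exprS.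
  have := IH z Kz; have : (0 : R) <= (i == j)%:R by rewrite ler0n.
  set e := 2^-1 ^+ n; lra.
move=> Kx; rewrite -oppr_le0; apply: (@geometric_le0 _ _ B 2^-1).
  by apply/andP; split; lra.
by move=> n; exact: H.
Qed.

Lemma bary_le1 i x : K x -> bary i x <= 1.
Proof.
move=> Kx; have := bary_sum q x; have := bary_ge0 0 Kx; have := bary_ge0 1 Kx.
by have := bary_ge0 2 Kx; elim/I3_ind: i; lra.
Qed.

Lemma closed_approx z (M : R) :
  (forall n, exists2 y, K y & `|y - z| <= M * 2^-1 ^+ n) -> K z.
Proof.
move=> H; have /closure_id -> := closedK; move=> B /nbhs_ballP[e /= e0 eB].
suff [n Hn] : exists n, M * 2^-1 ^+ n < e.
  have [y Ky yz] := H n; exists y; split=> //; apply: eB.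
  by rewrite -ball_normE /= distrC (le_lt_trans yz).
apply: contrapT => /forallNP Hn.
have : e <= 0.
  apply: (@geometric_le0 _ _ M 2^-1); first by apply/andP; split; lra.
  by move=> n; rewrite leNgt; apply/negP/Hn.
by rewrite leNgt e0.
Qed.

Lemma vertexK i : K (q i).
Proof.
case: hK => _ [x Kx] _.
apply: (@closed_approx _ `|x - q i|) => n.
have fixn : Psi (nseq n i) (q i) = q i.
  by elim: n => [//|n IH]; rewrite /= IH psi_fix.
exists (Psi (nseq n i) x); first exact: PsiK.
by rewrite -[X in _ - X]fixn norm_Psi size_nseq mulrC.
Qed.

(** The sides of the triangle lie in the gasket: a side is the union of its images
   under the two maps at its ends. *)
Lemma sideK i j t : 0 <= t <= 1 -> K (q i + t *: (q j - q i)).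
Proof.
move=> t01; apply: (@closed_approx _ `|q j - q i|) => n.
elim: n t t01 => [|n IH] t t01.
  exists (q i); first exact: vertexK.
  rewrite opprD addrA subrr sub0r normrN normrZ mulr1.
  by rewrite ler_piMl// ger0_norm; lra.
have [t2|t2] := leP t 2^-1.
  have [|y Ky Hy] := IH (2 * t); first by lra.
  exists (psi i y); first exact: psiK.
  have -> : q i + t *: (q j - q i) = psi i (q i + (2 * t) *: (q j - q i)).
    rewrite /psi addrAC subrr add0r scalerA mulrA mulVf// mul1r addrC//.
  by rewrite norm_psi exprS mulrCA ler_pM2l.
have [|y Ky Hy] := IH (2 * t - 1); first by lra.
exists (psi j y); first exact: psiK.
have -> : q i + t *: (q j - q i) = psi j (q i + (2 * t - 1) *: (q j - q i)).
  rewrite /psi; apply/eqP; rewrite -pair_eqE /pair_eq /=; apply/andP.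
  split; apply/eqP.
    rewrite -[_ *: _]/(t * ((q j).1 - (q i).1)).
    rewrite -[_ *: _ in RHS]/(2^-1 * ((q i).1 + (2 * t - 1) * ((q j).1 - (q i).1) - (q j).1)).
    lra.
  rewrite -[_ *: _]/(t * ((q j).2 - (q i).2)).
  rewrite -[_ *: _ in RHS]/(2^-1 * ((q i).2 + (2 * t - 1) * ((q j).2 - (q i).2) - (q j).2)).
  lra.
by rewrite norm_psi exprS mulrCA ler_pM2l.
Qed.

(** * Neighboring cells *)

Definition touching w w' := [exists i, exists j, Psi w (q i) == Psi w' (q j)].

Lemma touchingP w w' : reflect (exists i j, Psi w (q i) = Psi w' (q j)) (touching w w').
Proof.
apply: (iffP existsP) => [[i /existsP[j /eqP H]]|[i [j H]]]; first by exists i, j.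
by exists i; apply/existsP; exists j; apply/eqP.
Qed.

Lemma touching_refl w : touching w w. Proof. by apply/touchingP; exists 0, 0. Qed.

Lemma touching_sym w w' : touching w w' = touching w' w.
Proof. by apply/touchingP/touchingP => -[i [j H]]; exists j, i. Qed.

(** The weights of cells that come close differ by at most one, and have the same
   sum, so that the second cell is a translate of the first along a side. *)
Lemma close_near w w' x y : size w = size w' -> cell w x -> cell w' y ->
  4 * edist x y < 2^-1 ^+ size w -> touching w w'.
Proof.
move=> sw [x' Kx' xE] [y' Ky' yE] xy.
have H i : `|(bary i x' + (wt i w)%:R) - (bary i y' + (wt i w')%:R)| < 1.
  have := bary_lipschitz hq i x y; rewrite -xE -yE !bary_Psi// -sw => h.
  have : `|(bary i x' + (wt i w)%:R) / 2 ^+ size w -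
            (bary i y' + (wt i w')%:R) / 2 ^+ size w| < 2^-1 ^+ size w.
    by rewrite (le_lt_trans h)// xE yE.
  rewrite -mulrBl normrM exprVn [X in _ * X]ger0_norm ?invr_ge0 ?exprn_ge0//.
  by rewrite -[ltRHS]mul1r ltr_pM2r// invr_gt0 exprn_gt0.
have D i : (wt i w <= (wt i w').+1)%N /\ (wt i w' <= (wt i w).+1)%N.
  have := H i; rewrite ltr_norml => /andP[h1 h2].
  have := bary_ge0 i Kx'; have := bary_le1 i Kx'.
  have := bary_ge0 i Ky'; have := bary_le1 i Ky'.
  move=> ? ? ? ?; split; rewrite -ltnS -(ltr_nat R) -!natr1; lra.
have S : (wt 0%R w + wt 1%R w + wt 2%R w = wt 0%R w' + wt 1%R w' + wt 2%R w')%N.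
  by have := wt_sum w; have := wt_sum w'; rewrite sw => <- [].
suff [i [j Hij]] : exists i j, forall k,
    ((k == i) + wt k w = (k == j) + wt k w')%N.
  apply/touchingP; exists i, j; apply: (bary_inj hq) => k.
  rewrite !bary_Psi// !bary_q// sw; congr (_ / _).
  by rewrite -!natrD Hij.
have [d0 d0'] := D 0; have [d1 d1'] := D 1; have [d2 d2'] := D 2.
(* The corners in the directions in which one weight exceeds the other. *)
pose i : 'I_3 := if (wt 0%R w < wt 0%R w')%N then 0
  else if (wt 1%R w < wt 1%R w')%N then 1 else 2.
pose j : 'I_3 := if (wt 0%R w' < wt 0%R w)%N then 0
  else if (wt 1%R w' < wt 1%R w)%N then 1 else 2.
exists i, j; rewrite /i /j; elim/I3_ind;
  case: (ltngtP (wt 0%R w) (wt 0%R w')) => ?;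
  case: (ltngtP (wt 1%R w) (wt 1%R w')) => ? /=; lia.
Qed.

(** A touching cell is determined by the indices of the two corners that
   coincide. *)
Lemma near_count n w : size w = n -> (count (touching w) (words n) <= 9)%N.
Proof.
move=> wn; rewrite -size_filter; set s := [seq _ <- _ | _].
have us : uniq s by rewrite filter_uniq// words_uniq.
have Hs w' : w' \in s -> size w' = n /\ touching w w'.
  by rewrite mem_filter mem_words => /andP[h /eqP].
have ex w' : exists ij : 'I_3 * 'I_3,
    touching w w' -> Psi w (q ij.1) = Psi w' (q ij.2).
  have [/touchingP[i [j H]]|_] := boolP (touching w w'); first by exists (i, j).
  by exists (0, 0).
have [phi Hphi] := choice ex.
have inj : {in s &, injective phi}.
  move=> v v' /Hs[sv /Hphi Hv] /Hs[sv' /Hphi Hv'] e.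
  apply: wt_inj; first by rewrite sv sv'.
  move=> i; have : bary i (Psi v (q (phi v).2)) = bary i (Psi v' (q (phi v').2)).
    by rewrite -Hv -Hv' e.
  rewrite !bary_Psi// sv sv' e => /(mulIf _)/addrI/eqP.
  by rewrite invr_eq0 expf_neq0// eqr_nat => /(_ isT)/eqP.
have -> : 9%N = size (enum {: 'I_3 * 'I_3}).
  by rewrite -cardE card_prod card_ord.
rewrite -(size_map phi); apply: uniq_leq_size.
  by rewrite map_inj_in_uniq.
by move=> ij _; rewrite mem_enum.
Qed.

Lemma sum_near_le n (G : seq 'I_3 -> R) : (forall w, 0 <= G w) ->
  \sum_(w <- words n) \sum_(w' <- words n | touching w w') G w' <=
  9 * \sum_(w <- words n) G w.
Proof.
move=> G0; rewrite (exchange_big_dep xpredT)//= mulr_sumr.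
rewrite big_seq [leRHS]big_seq; apply: ler_sum => w'.
rewrite mem_words => /eqP wn.
rewrite big_const_seq iter_addr_0 -[leLHS]mulr_natl ler_wpM2r//.
rewrite ler_nat (eq_count (a2 := touching w')) ?near_count// => w.
by rewrite touching_sym.
Qed.

Lemma sum_near_const_le n (G : seq 'I_3 -> R) : (forall w, 0 <= G w) ->
  \sum_(w <- words n) \sum_(w' <- words n | touching w w') G w <=
  9 * \sum_(w <- words n) G w.
Proof.
move=> G0; apply: le_trans (sum_near_le n G0).
rewrite (exchange_big_dep xpredT)//= le_eqVlt; apply/orP; left; apply/eqP.
by apply: eq_bigr => w _; apply: eq_bigl => w'; rewrite touching_sym.
Qed.

End gasket_geometry.

(** * Curves and geodesic balls *)

Lemma within_continuousP (R : realType) (V W : normedModType R) (A : set V) (f : V -> W) :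
  {within A, continuous f} <->
  forall x, A x -> forall e, 0 < e -> exists2 d, 0 < d &
    forall y, A y -> `|x - y| < d -> `|f x - f y| < e.
Proof.
split=> [/subspace_continuousP H x Ax e e0|H].
  have /cvgrPdist_lt/(_ e e0) := H x Ax.
  rewrite near_withinE => /nbhs_ballP[d /= d0 Hd].
  by exists d => // y Ay xy; apply: Hd => //; rewrite -ball_normE.
apply/subspace_continuousP => x Ax; apply/cvgrPdist_lt => e e0.
have [d d0 Hd] := H x Ax e e0.
rewrite near_withinE; apply/nbhs_ballP; exists d => //= y.
by rewrite -ball_normE /= => xy Ay; exact: Hd.
Qed.

Section geodesics.
Variables (R : realType) (q : 'I_3 -> plane R).
Hypothesis hq : unit_equilateral q.
Variable K : set (plane R).
Hypothesis hK : is_gasket q K.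
Local Notation edist := Defs.edist.
Local Notation Psi := (Psi q).
Local Notation psi := (psi q).
Local Notation cell := (cell q K).
Local Notation touching := (touching q).
Implicit Types (x y z : plane R) (w : seq 'I_3).

Definition lipschitz_curve (L : R) (g : R -> plane R) : Prop :=
  (forall s t, `|g s - g t| <= L * `|s - t|) /\ forall t, K (g t).

(** A path that ends within [M / 2 ^ n] of [x] is obtained from one with [n - 1] by
   running along half a side and then through the image of that path under one
   of the three maps; the two halves have the same speed. *)
Lemma approximate_curve : exists M : R, forall n x i, K x ->
  exists g, [/\ lipschitz_curve 1 g, g 0 = q i & `|g 1 - x| <= M * 2^-1 ^+ n].
Proof.
have [M M0 HM] := bounded_gasket hK.
exists (M + M) => n; elim: n => [|n IH] x i Kx.
  exists (fun=> q i); split=> //; last first.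
    have hx := HM _ Kx; have hi := HM _ (vertexK hK i).
    by rewrite mulr1 (le_trans (ler_normB _ _))// lerD.
  split=> [s t|t]; last exact: (vertexK hK).
  by rewrite subrr normr0 mulr_ge0.
have : (\bigcup_i (psi i @` K)) x by case: hK => _ _ <-.
move=> [j _ [x' Kx' xE]].
have [g [[gL gK] g0 g1]] := IH x' i Kx'.
pose c t : R := Num.max 0 (2 * t).
pose h t : plane R := if t <= 2^-1 then q i + c t *: (psi j (q i) - q i)
  else psi j (g (2 * t - 1)).
have nq : `|psi j (q i) - q i| <= 2^-1.
  rewrite psi_mid -[X in _ - X](psi_fix q i) norm_psi ler_piMr//.
  have [->|ji] := eqVneq j i; first by rewrite subrr normr0.
  by rewrite -(hq ji) norm_le_edist.
have hmid : h 2^-1 = psi j (q i).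
  rewrite /h lexx /c divff// (_ : Num.max 0 1 = 1) ?scale1r ?subrKC//.
  by apply/max_idPr.
have c_lip s t : s <= t -> `|c s - c t| <= 2 * (t - s).
  by rewrite /c => st; case: (leP 0 (2 * s)) => ?; case: (leP 0 (2 * t)) => ?;
    rewrite ler_norml; apply/andP; split; lra.
have h1 s t : s <= t -> t <= 2^-1 -> `|h s - h t| <= t - s.
  move=> st t2; rewrite /h t2 (le_trans st t2).
  rewrite opprD addrACA subrr add0r -scalerBl normrZ.
  rewrite (_ : t - s = (2 * (t - s)) * 2^-1); last by lra.
  by rewrite ler_pM// c_lip.
have h2' t : 2^-1 <= t -> h t = psi j (g (2 * t - 1)).
  rewrite le_eqVlt => /orP[/eqP <-|t2].
    by rewrite hmid divff// subrr g0.
  by rewrite /h leNgt t2.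
have h2 s t : s <= t -> 2^-1 <= s -> `|h s - h t| <= t - s.
  move=> st s2; rewrite !h2'//; last exact: le_trans st.
  rewrite norm_psi; have := gL (2 * s - 1) (2 * t - 1).
  rewrite mul1r distrC [X in _ <= X]distrC [X in _ <= X]ger0_norm; last by lra.
  by rewrite distrC; lra.
exists h; split.
- split.
    suff hst s t : s <= t -> `|h s - h t| <= t - s.
      move=> s t; rewrite mul1r; case: (leP s t) => st.
        by rewrite distrC (distrC s) (@ger0_norm _ (t - s)) ?subr_ge0// distrC hst.
      by rewrite distrC (@ger0_norm _ (s - t)) ?subr_ge0 ?hst// ltW.
    move=> st; have [t2|t2] := leP t 2^-1; first exact: h1.
    have [s2|s2] := leP 2^-1 s; first exact: h2.
    rewrite (_ : h s - h t = (h s - h 2^-1) + (h 2^-1 - h t)); last first.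
      by rewrite addrA subrK.
    rewrite (le_trans (ler_normD _ _))//.
    have := h1 s 2^-1 (ltW s2) (lexx _); have := h2 2^-1 t (ltW t2) (lexx _).
    lra.
  move=> t; rewrite /h; case: ifPn => t2; last exact: (psiK hK).
  have -> : q i + c t *: (psi j (q i) - q i) = q i + (c t / 2) *: (q j - q i).
    rewrite -scalerA psi_mid -[X in _ *: (_ - X)](psi_fix q i) psi_sub//.
  apply: (sideK hK); rewrite /c; case: (leP 0 (2 * t)) => ?; lra.
- rewrite /h invr_ge0 ler0n /c mulr0 (_ : Num.max 0 0 = 0) ?scale0r ?addr0//.
  exact/max_idPl.
- rewrite h2'; last by lra.
  rewrite mulr1 (_ : 2 - 1 = 1 :> R); last by lra.
  by rewrite -xE norm_psi exprS mulrCA ler_pM2l.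
Qed.

(** The approximating curves have a limit along an ultrafilter, at every
   parameter by compactness of [K]; the common Lipschitz bound passes to it. *)
Lemma curve_from_vertex x i : K x ->
  exists g, [/\ lipschitz_curve 1 g, g 0 = q i & g 1 = x].
Proof.
move=> Kx; have [M HM] := approximate_curve.
have /choice[G HG] n := HM n x i Kx.
have compK (t : R) : compact K by case: hK.
have GK n t : K (G n t) by case: (HG n) => -[].
have [U [g [PU ooU Kg cvg]]] := @pointwise_ultralimit R (plane R) (fun=> K) G compK GK.
exists g; split.
- split=> // s t; rewrite mul1r.
  have cn : `|G n s - G n t| @[n --> U] --> `|g s - g t|.
    by apply: cvg_norm; apply: cvgB.
  apply: (@closed_cvg _ _ U _ _ (fun r => r <= `|s - t|) _ _ _ cn).
    exact: closed_le.
  by apply: nearW => n; case: (HG n) => -[/(_ s t)]; rewrite mul1r.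
- apply: (@cvg_unique _ (@norm_hausdorff _ _) (G n 0 @[n --> U])).
    exact: cvg.
  rewrite /= (_ : (fun n => G n 0) = fun=> q i); first exact: cvg_cst.
  by apply/funext => n; case: (HG n).
- apply: (@cvg_unique _ (@norm_hausdorff _ _) (G n 1 @[n --> U])).
    exact: cvg.
  have cX : G n 1 @[n --> \oo] --> x.
    apply/cvgrPdist_le => e e0.
    have cM : M * 2^-1 ^+ n @[n --> \oo] --> M * 0.
      by apply: cvgZr => /=; apply: cvg_expr; rewrite ger0_norm//; lra.
    rewrite mulr0 in cM; have /cvgrPdist_le/(_ e e0) := cM.
    apply: filterS => n; rewrite sub0r normrN => /(le_trans (ler_norm _)).
    by apply: le_trans; rewrite distrC; case: (HG n).
  move=> A /cX; exact: ooU.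
Qed.

(** * Length *)

Fixpoint polygon (g : R -> plane R) (a : R) (s : seq R) : R :=
  if s is t :: s' then edist (g a) (g t) + polygon g t s' else 0.

Lemma polygonal_lengthE g s : polygonal_length g s = polygon g 0 s.
Proof.
rewrite /polygonal_length; set d : R := (X in nth X (X :: s)).
suff H a : \sum_(0 <= n < size s) edist (g (nth d (a :: s) n)) (g (nth d s n)) =
    polygon g a s by exact: H.
elim: s a => [|t s IH] a; first by rewrite big_nil.
by rewrite /= big_nat_recl//= IH.
Qed.

Lemma polygon_le (g : R -> plane R) (L a : R) s : 0 <= L ->
  (forall s t, `|g s - g t| <= L * `|s - t|) -> path <%R a s ->
  polygon g a s <= 2 * L * (last a s - a).
Proof.
move=> L0 gL; elim: s a => [|t s IH] a /=; first by rewrite subrr mulr0.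
move=> /andP[at_ /IH H]; have := edist_le_norm (g a) (g t).
have := gL a t; rewrite (distrC a) (@ger0_norm _ (t - a)) ?subr_ge0 ?(ltW at_)//.
have -> : 2 * L * (last t s - a) = 2 * (L * (t - a)) + 2 * L * (last t s - t) by ring.
lra.
Qed.

Lemma euclid_triangle x y z : edist x z <= edist x y + edist y z.
Proof.
rewrite -(@ler_pXn2r _ 2) ?nnegrE ?euclid_ge0 ?addr_ge0 ?euclid_ge0//.
have A : edist x z ^+ 2 = edist x y ^+ 2 + edist y z ^+ 2 +
    2 * ((x.1 - y.1) * (y.1 - z.1) + (x.2 - y.2) * (y.2 - z.2)).
  by rewrite !sqr_edist; ring.
have B : (x.1 - y.1) * (y.1 - z.1) + (x.2 - y.2) * (y.2 - z.2) <=
    edist x y * edist y z.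
  set X := (X in X <= _).
  have Y0 : 0 <= edist x y * edist y z by rewrite mulr_ge0 ?euclid_ge0.
  have : X ^+ 2 <= (edist x y * edist y z) ^+ 2.
    rewrite exprMn !sqr_edist /X.
    have := sqr_ge0 ((x.1 - y.1) * (y.2 - z.2) - (x.2 - y.2) * (y.1 - z.1)).
    by lra.
  by move: Y0; move: X (edist x y * edist y z) => X Y; nra.
by rewrite A sqrrD; lra.
Qed.

Definition concat_curve (g h : R -> plane R) (t : R) : plane R :=
  if t <= 2^-1 then g (2 * t) else h (2 * t - 1).

(** A polygon that jumps over the parameter [1 / 2] is compared with the one
   that also stops there, which is longer. *)
Lemma polygon_concat g h (a : R) s : g 1 = h 0 -> 0 <= a <= 2^-1 ->
  path <%R a s -> all (fun t : R => t <= 1) s ->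
  exists s1 s2 : seq R, [/\ path <%R (2 * a) s1 /\ path <%R 0 s2,
    all (fun t : R => t <= 1) s1 /\ all (fun t : R => t <= 1) s2 &
    polygon (concat_curve g h) a s <= polygon g (2 * a) s1 + polygon h 0 s2].
Proof.
move=> gh; elim: s a => [|t s IH] a /andP[a0 a2] /=.
  by exists [::], [::]; split=> //=; rewrite addr0.
move=> /andP[at_ ps] /andP[t1 alls].
have [t2|t2] := leP t 2^-1.
  have [|s1 [s2 [[p1 p2] [al1 al2] Hle]]] := IH t _ ps alls.
    by rewrite t2 (le_trans a0 (ltW at_)).
  exists (2 * t :: s1), s2; split=> //=.
  - by rewrite p1 andbT ltr_pM2l.
  - by rewrite al1 andbT; split=> //; lra.
  - by rewrite {1 2}/concat_curve a2 t2 -addrA lerD2l.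
have polyE (b : R) (s' : seq R) : 2^-1 < b -> path <%R b s' ->
    polygon (concat_curve g h) b s' =
    polygon h (2 * b - 1) [seq 2 * u - 1 | u <- s'].
  elim: s' b => [//|u s' IHs] b b2 /= /andP[bu pu].
  rewrite IHs//; last exact: lt_trans bu.
  by rewrite /concat_curve !leNgt b2 (lt_trans b2 bu).
have pathE (b : R) (s' : seq R) : path <%R b s' -> path <%R (2 * b - 1) [seq 2 * u - 1 | u <- s'].
  elim: s' b => [//|u s' IHs] b /= /andP[bu /IHs ->]; rewrite andbT; lra.
have allE (s' : seq R) : all (fun t : R => t <= 1) s' ->
    all (fun t : R => t <= 1) [seq 2 * u - 1 | u <- s'].
  elim: s' => [//|u s' IHs] /= /andP[u1 /IHs ->]; rewrite andbT; lra.
pose s1 : seq R := if 2 * a < 1 then [:: 1] else [::].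
exists s1, [seq 2 * u - 1 | u <- t :: s]; split.
- split; first by rewrite /s1; case: ifP => //= ->.
  by rewrite /= pathE// andbT; lra.
- split; first by rewrite /s1; case: ifP => //= _; rewrite lexx.
  by apply: allE; rewrite /= t1 alls.
have t2f : (t <= 2^-1) = false by apply/negbTE; rewrite -ltNge.
rewrite polyE//= addrA lerD2r /concat_curve a2 t2f.
have -> : polygon g (2 * a) s1 = edist (g (2 * a)) (g 1).
  rewrite /s1; case: ifPn => /= [|a1]; first by rewrite addr0.
  have -> : 2 * a = 1 by lra.
  by apply/esym/eqP; rewrite sqrtr_eq0 !subrr expr0n /= addr0.
by rewrite gh euclid_triangle.
Qed.

(** A list of parameters that does not reach 1 is extended by 1. *)
Lemma polygon_le_length g (s : seq R) L : (curve_length g <= L%:E)%E ->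
  path <%R 0 s -> all (fun t : R => t <= 1) s -> polygon g 0 s <= L.
Proof.
move=> gL ps als.
have part s' : itv_partition 0 1 s' -> polygon g 0 s' <= L.
  move=> ps'; rewrite -lee_fin (le_trans _ gL)// -polygonal_lengthE.
  by apply: ereal_sup_ubound; exists s'.
have [l1|l1] := ltP (last 0 s) 1.
  apply: (@le_trans _ _ (polygon g 0 (rcons s 1))).
    elim: (s) 0 => [|t s' IH] a /=; first by rewrite addr0 euclid_ge0.
    by rewrite lerD2l.
  by apply: part; split; rewrite ?rcons_path ?ps// last_rcons.
case: s ps als l1 => [|t s] ps als l1; first by rewrite /= ler10 in l1.
apply: part; split=> //; rewrite eq_le l1 andbT.
by move/allP: als; apply; rewrite /= mem_last.
Qed.

Lemma curve_concat x y z g h : curve_in K x y g -> curve_in K y z h ->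
  curve_in K x z (concat_curve g h).
Proof.
move=> [/within_continuousP cg g0 g1 gK] [/within_continuousP ch h0 h1 hK'].
have in01 (t : R) : `[0, 1]%classic t = (0 <= t <= 1).
  by apply/propext; rewrite /= in_itv.
have E2 (t : R) : 2^-1 <= t -> concat_curve g h t = h (2 * t - 1).
  rewrite le_eqVlt => /orP[/eqP <-|t2]; last by rewrite /concat_curve leNgt t2.
  by rewrite /concat_curve lexx divff// subrr g1 h0.
split.
- rewrite (_ : [set` _] = `[0, 2^-1] `|` `[2^-1, 1]); last first.
    apply/seteqP; split=> t /=; rewrite !in_itv /=.
      by move=> ?; case: (leP t 2^-1) => ?; [left|right]; lra.
    by move=> [] ?; lra.
  apply: withinU_continuous; [exact: interval_closed|exact: interval_closed| |].
    apply/within_continuousP => s; rewrite /= in_itv /= => s01 e e0.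
    have s01' : `[0, 1]%classic (2 * s) by rewrite in01; lra.
    have [d d0 Hd] := cg (2 * s) s01' e e0.
    exists (d / 2); first by rewrite divr_gt0.
    move=> t; rewrite /= in_itv /= => t01 st.
    have [[_ sE] [_ tE]] := (andP s01, andP t01); rewrite /concat_curve sE tE.
    apply: Hd; first by rewrite in01; lra.
    by rewrite -mulrBr normrM ger0_norm// -ltr_pdivlMl// mulrC.
  apply/within_continuousP => s; rewrite /= in_itv /= => s01 e e0.
  have s01' : `[0, 1]%classic (2 * s - 1) by rewrite in01; lra.
  have [d d0 Hd] := ch (2 * s - 1) s01' e e0.
  exists (d / 2); first by rewrite divr_gt0.
  move=> t; rewrite /= in_itv /= => t01 st.
  have [[s2 _] [t2 _]] := (andP s01, andP t01); rewrite !E2//.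
  apply: Hd; first by rewrite in01; lra.
  rewrite (_ : _ - _ = 2 * (s - t)); last by lra.
  by rewrite normrM ger0_norm// -ltr_pdivlMl// mulrC.
- by rewrite /concat_curve invr_ge0 ler0n mulr0.
- rewrite E2; last by lra.
  have -> : 2 * 1 - 1 = 1 :> R by lra.
  exact: h1.
- move=> t t01; rewrite /concat_curve; case: (leP t 2^-1) => t2.
    by apply: gK; lra.
  by apply: hK'; lra.
Qed.

Lemma curve_length_concat g h L M : g 1 = h 0 ->
  (curve_length g <= L%:E)%E -> (curve_length h <= M%:E)%E ->
  (curve_length (concat_curve g h) <= (L + M)%:E)%E.
Proof.
move=> gh gL hM; apply: ge_ereal_sup => _ [s [ps /eqP ls] <-].
rewrite lee_fin polygonal_lengthE.
have lastP a (u : seq R) : path <%R a u -> a <= last a u.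
  elim: u a => [//|t u IH] a /= /andP[at_ /IH]; exact/le_trans/ltW.
have allP a (u : seq R) : path <%R a u -> all (fun t : R => t <= last a u) u.
  elim: u a => [//|t u IH] a /= /andP[_ pu]; rewrite (IH t)// andbT.
  exact: lastP.
have als : all (fun t : R => t <= 1) s by rewrite -ls; exact: allP.
have [|s1 [s2 [[p1 p2] [al1 al2] H]]] := polygon_concat gh _ ps als.
  by rewrite lexx invr_ge0 ler0n.
rewrite mulr0 in p1 H; rewrite (le_trans H)// lerD//.
  exact: polygon_le_length gL _ _.
exact: polygon_le_length hM _ _.
Qed.

Lemma geodist_le x y g L : curve_in K x y g -> (curve_length g <= L)%E ->
  (geodist K x y <= L)%E.
Proof. by move=> gxy; apply: le_trans; apply: ereal_inf_lbound; exists g. Qed.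

Lemma geodist_triangle x y z a b : (geodist K x y < a%:E)%E ->
  (geodist K y z < b%:E)%E -> (geodist K x z <= (a + b)%:E)%E.
Proof.
move=> /ereal_inf_lt[_ [g gxy <-] ga] /ereal_inf_lt[_ [h hyz <-] hb].
apply: (geodist_le (curve_concat gxy hyz)).
case: gxy hyz => _ _ g1 _ [_ h0 _ _].
by apply: curve_length_concat; rewrite ?g1 ?h0// ltW.
Qed.

Lemma edist_le_geodist x y : ((edist x y)%:E <= geodist K x y)%E.
Proof.
apply: le_ereal_inf_tmp => _ [g [_ g0 g1 _] <-].
apply: ereal_sup_ubound; exists [:: 1]; first by split; rewrite /= ?ltr01.
by rewrite polygonal_lengthE /= addr0 g0 g1.
Qed.

Lemma geodist_lipschitz g L : 0 <= L -> lipschitz_curve L g ->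
  (geodist K (g 0%R) (g 1%R) <= (2 * L)%:E)%E.
Proof.
move=> L0 [gL gK]; apply: (@geodist_le _ _ g).
  split=> //; apply: continuous_subspaceT => s.
  apply/cvgrPdist_lt => e e0; apply/nbhs_ballP.
  have L1 : 0 < L + 1 by rewrite ltr_wpDl.
  exists (e / (L + 1)) => /=; first by rewrite divr_gt0.
  move=> t; rewrite /ball_ /= ltr_pdivlMr// => st.
  apply: le_lt_trans (gL s t) _; rewrite mulrC; apply: le_lt_trans st.
  by rewrite ler_wpM2l// lerDl.
apply: ge_ereal_sup => _ [s [ps /eqP ls] <-].
rewrite lee_fin polygonal_lengthE (le_trans (polygon_le L0 gL ps))//.
by rewrite ls subr0 mulr1.
Qed.

Lemma lipschitz_Psi w L g : lipschitz_curve L g ->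
  lipschitz_curve (2^-1 ^+ size w * L) (Psi w \o g).
Proof.
move=> [gL gK]; split=> [s t|t]; last exact: (PsiK hK).
by rewrite /= norm_Psi -mulrA ler_pM2l ?exprn_gt0.
Qed.

Lemma lipschitz_reverse L g : lipschitz_curve L g ->
  lipschitz_curve L (fun t => g (1 - t)).
Proof.
move=> [gL gK]; split=> // s t; rewrite (le_trans (gL _ _))//.
by rewrite opprB addrC addrA subrK distrC.
Qed.

Lemma geodist_vertex w i x : cell w x ->
  (geodist K (Psi w (q i)) x <= (2 * 2^-1 ^+ size w)%:E)%E /\
  (geodist K x (Psi w (q i)) <= (2 * 2^-1 ^+ size w)%:E)%E.
Proof.
move=> [y Ky <-]; have [g [gL g0 g1]] := curve_from_vertex i Ky.
have e0 : 0 <= 2^-1 ^+ size w :> R by rewrite exprn_ge0// invr_ge0.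
have := lipschitz_Psi w gL; rewrite mulr1 => wL.
have := geodist_lipschitz e0 wL; rewrite /= g0 g1 => H1; split=> //.
by have := geodist_lipschitz e0 (lipschitz_reverse wL); rewrite /= subr0 subrr g0 g1.
Qed.

(** Through the common vertex, at distance at most [2 * 2 ^- size w] from both
   points; the constant 5 leaves room for strict inequalities. *)
Lemma geodist_near w w' x y : size w = size w' -> touching w w' ->
  cell w x -> cell w' y -> (geodist K x y <= (5 * 2^-1 ^+ size w)%:E)%E.
Proof.
move=> sw /touchingP[i [j ij]] /(geodist_vertex i)[_ H1] /(geodist_vertex j)[H2 _].
have e0 : 0 < 2^-1 ^+ size w :> R by rewrite exprn_gt0// invr_gt0.
rewrite -sw -ij in H2.
rewrite (_ : 5 * _ = (5 / 2) * 2^-1 ^+ size w + (5 / 2) * 2^-1 ^+ size w); last by lra.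
by apply: geodist_triangle; [apply: le_lt_trans H1 _|apply: le_lt_trans H2 _];
  rewrite lte_fin; lra.
Qed.

Lemma geoball_near_cover n w x rho y : size w = n -> cell w x ->
  4 * rho <= 2^-1 ^+ n -> geoball K x rho y ->
  exists w', [/\ w' \in words n, touching w w' & cell w' y].
Proof.
move=> wn wx rn [Ky xy]; have [w' w'n w'y] := gasket_cover hK n Ky.
exists w'; split=> //; move: w'n; rewrite mem_words => /eqP w'n.
apply: (close_near hq hK _ wx w'y); first by rewrite wn w'n.
have := le_lt_trans (edist_le_geodist x y) xy; rewrite lte_fin wn; lra.
Qed.

Lemma near_sub_geoball w w' x y rho : size w = size w' -> touching w w' ->
  cell w x -> cell w' y -> 5 * 2^-1 ^+ size w < rho -> geoball K x rho y.
Proof.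
move=> sw ww' wx w'y r5; split; first exact: (cell_sub hK w'y).
by rewrite (le_lt_trans (geodist_near sw ww' wx w'y))// lte_fin.
Qed.

Lemma measurable_gasket : measurable (K : set (borel_plane R)).
Proof.
rewrite -(setCK K); apply: measurableC; apply: sub_sigma_algebra.
by rewrite openC; exact: (closedK hK).
Qed.

Lemma closed_cell w : closed (cell w).
Proof.
apply: compact_closed; first exact: norm_hausdorff.
apply: continuous_compact; last by case: hK.
apply/within_continuousP => z _ e e0; exists e => // y _ zy.
rewrite norm_Psi (le_lt_trans _ zy)// ler_piMl// exprn_ile1// ?invr_ge0//.
by rewrite invf_le1//; lra.
Qed.

Lemma measurable_cell w : measurable (cell w : set (borel_plane R)).
Proof.
rewrite -(setCK (cell w)); apply: measurableC; apply: sub_sigma_algebra.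
by rewrite openC; exact: closed_cell.
Qed.

(** The geodesic and the Euclidean metric define the same topology on the
   gasket, so that geodesic balls are relatively open. *)
Lemma measurable_geoball x rho :
  measurable (geoball K x rho : set (borel_plane R)).
Proof.
pose S := [set yd : plane R * R | geoball K x rho yd.1 /\ 0 < yd.2 /\
  forall z, K z -> `|yd.1 - z| < yd.2 -> geoball K x rho z].
rewrite (_ : geoball K x rho = K `&` \bigcup_(yd in S) ball yd.1 yd.2).
  apply: measurableI; first exact: measurable_gasket.
  apply: sub_sigma_algebra; apply: bigcup_open => yd [_ [d0 _]].
  exact: ball_open.
apply/seteqP; split=> [y By|y [Ky [[z d] [/= Bz [d0 H]]]]]; last first.
  by rewrite -ball_normE /= => zy; exact: H.
split; first by case: By.
case: (By) => Ky xy.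
have [e e0 He] : exists2 e, 0 < e & (geodist K x y < (rho - e)%:E)%E.
  have G0 : (0 <= geodist K x y)%E.
    by apply: le_trans (edist_le_geodist x y); rewrite lee_fin euclid_ge0.
  move: xy G0; case: (geodist K x y) => [g| |]//.
  rewrite lte_fin lee_fin => gr g0; exists ((rho - g) / 2).
    by rewrite divr_gt0// subr_gt0.
  by rewrite lte_fin; lra.
have [n Hn] : exists n, 6 * 2^-1 ^+ n < e.
  apply: contrapT => /forallNP Hn.
  suff : e <= 0 by lra.
  apply: (@geometric_le0 _ _ 6 2^-1); first by apply/andP; split; lra.
  by move=> n; rewrite leNgt; apply/negP/Hn.
have p0 : 0 < 2^-1 ^+ n :> R by rewrite exprn_gt0.
have d0 : 0 < 2^-1 ^+ n / 8 :> R by rewrite divr_gt0.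
exists (y, 2^-1 ^+ n / 8); last by rewrite /=; exact: ballxx.
split=> //=; split=> // z Kz yz; split=> //.
have [w wn wy] := gasket_cover hK n Ky.
have [w' w'n w'z] := gasket_cover hK n Kz.
move: wn w'n; rewrite !mem_words => /eqP wn /eqP w'n.
have ww' : touching w w'.
  apply: (close_near hq hK _ wy w'z); first by rewrite wn w'n.
  by have := edist_le_norm y z; rewrite wn; lra.
have := geodist_near (etrans wn (esym w'n)) ww' wy w'z; rewrite wn => yz5.
rewrite (_ : rho = (rho - e) + e); last by rewrite subrK.
have yz6 : (geodist K y z < (6 * 2^-1 ^+ n)%:E)%E.
  by rewrite (le_lt_trans yz5)// lte_fin; lra.
by apply: le_lt_trans (geodist_triangle He yz6) _; rewrite lte_fin; lra.
Qed.

End geodesics.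

(** * Discrete energies *)

Section discrete_energy.
Variables (R : realType) (p : R).
Hypothesis hp : 1 <= p.
Variable q : 'I_3 -> plane R.
Hypothesis hq : unit_equilateral q.
Local Notation pw := (pw p).
Local Notation kap := (kap p).
Local Notation Psi := (Psi q).
Local Notation psi := (psi q).
Local Notation touching := (touching q).
Implicit Types (u : plane R -> R) (w v : seq 'I_3) (g : seq 'I_3 -> R).

Definition corners u w : 'rV[R]_3 := \row_j u (Psi w (q j)).

(** The energy without the factor [r ^- n]. *)
Definition senergy n u : R := \sum_(w <- words n) Fp p (corners u w).

Lemma senergy_ge0 n u : 0 <= senergy n u.
Proof. by apply: sumr_ge0 => w _; exact: Fp_ge0. Qed.

Lemma corners_cat u w v : corners u (w ++ v) = corners (u \o Psi w) v.
Proof. by apply/rowP => j; rewrite !mxE Psi_cat. Qed.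

Lemma senergy_cat n j u :
  senergy (n + j) u = \sum_(w <- words n) senergy j (u \o Psi w).
Proof.
rewrite /senergy sum_words_cat; apply: eq_bigr => w _; apply: eq_bigr => v _.
by rewrite corners_cat.
Qed.

Lemma senergyS n u : senergy n.+1 u = \sum_i senergy n (u \o psi i).
Proof. by rewrite /senergy sum_wordsS. Qed.

Lemma edge_le_senergy n u w i j : w \in words n ->
  pw (u (Psi w (q i)) - u (Psi w (q j))) <= senergy n u.
Proof.
move=> wn; have := edge_le_Fp hp (corners u w) i j; rewrite !mxE => /le_trans.
apply; rewrite /senergy (big_rem w)//= lerDl; apply: sumr_ge0 => v _.
exact: Fp_ge0.
Qed.

(** The reflection of the vertices of cell [i] that exchanges the two vertices
   other than [q i]: cell [i] carries at [q j] the value that the renormalization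
   sum puts at the reflected index. *)
Definition reflect3 (i : 'I_3) : {perm 'I_3} := tperm (i + 1) (i + 2).

Lemma reflect3E i j : reflect3 i j = - (i + j).
Proof.
by move: i j; elim/I3_ind; elim/I3_ind; rewrite permE /=; exact: val_inj.
Qed.

Lemma mid_value u (i j k : 'I_3) : i != j -> k = - (i + j) ->
  u (psi (k + 1) (q (k + 2))) = u (psi i (q j)).
Proof.
move=> ij ->.
have : ((- (i + j) + 1 == i) && (- (i + j) + 2 == j)) ||
       ((- (i + j) + 1 == j) && (- (i + j) + 2 == i)).
  by move: i j ij; elim/I3_ind; elim/I3_ind.
by move=> /orP[] /andP[/eqP -> /eqP ->]//; rewrite psi_mid.
Qed.

(** The values of [u] at the inner vertices are one competitor in each
   renormalization. *)
Lemma renorm_iter_le_senergy n u : renorm_iter p n (corners u [::]) <= senergy n u.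
Proof.
elim: n u => [|n IH] u; first by rewrite /senergy sum_words0.
(* The inner vertex opposite to the corner [q k]. *)
pose b : 'rV[R]_3 := \row_k u (psi (k + 1) (q (k + 2))).
have hA := renorm_iter_regular hp n.
rewrite (le_trans (renorm_le _ b (regular_ge0 hA)))// senergyS.
apply: ler_sum => i _; apply: le_trans (IH _).
rewrite -(regular_perm hA (reflect3 i)) le_eqVlt; apply/orP; left; apply/eqP.
congr renorm_iter; apply/rowP => j; rewrite !mxE reflect3E.
have [->|ji] := eqVneq j i.
  rewrite (_ : - (i + i) = i) ?eqxx /= ?psi_fix//.
  by elim/I3_ind: (i); exact: val_inj.
rewrite ifF; first by apply: mid_value; rewrite // eq_sym.
by apply/negbTE; move: i j ji; elim/I3_ind; elim/I3_ind.
Qed.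

(** * Functions on cells and functions on vertices *)

Definition gradient n g : R :=
  \sum_(w <- words n) \sum_(w' <- words n | touching w w') pw (g w' - g w).

Lemma gradient_ge0 n g : 0 <= gradient n g.
Proof. by apply: sumr_ge0 => w _; apply: sumr_ge0 => w' _; exact: pw_ge0. Qed.

(** A vertex is a corner of several cells, and one of their values is chosen;
   any choice changes a value at most by the differences on touching cells. *)
Definition vertex_fun n g : plane R -> R := fun z =>
  g (xget [::] [set v | v \in words n /\ exists i, Psi v (q i) = z]).

Lemma vertex_funE n g v i : v \in words n -> exists v',
  [/\ v' \in words n, touching v v', exists j, Psi v' (q j) = Psi v (q i) &
      vertex_fun n g (Psi v (q i)) = g v'].
Proof.
move=> vn; rewrite /vertex_fun; set S := [set _ | _].
have [|v'n [j v'j]] := @xgetPex _ [::] S; first by exists v; split=> //; exists i.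
exists (xget [::] S); split=> //; last by exists j.
by apply/touchingP; exists i, j.
Qed.

Lemma vertex_fun_diff n g v i : v \in words n ->
  pw (vertex_fun n g (Psi v (q i)) - g v) <=
  \sum_(w' <- words n | touching v w') pw (g w' - g v).
Proof.
move=> vn; have [v' [v'n vv' _ ->]] := vertex_funE g i vn.
rewrite (big_rem v')//= vv' lerDl; apply: sumr_ge0 => w _; exact: pw_ge0.
Qed.

Lemma senergy_vertex_fun n g :
  senergy n (vertex_fun n g) <= 6 * kap * gradient n g.
Proof.
rewrite /senergy /gradient mulr_sumr big_seq [leRHS]big_seq.
apply: ler_sum => v vn; rewrite FpE !mxE.
set G := \sum_(w' <- _ | _) _.
have H i j : pw (vertex_fun n g (Psi v (q i)) - vertex_fun n g (Psi v (q j))) <=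
    2 * kap * G.
  apply: le_trans (pwB hp _ (g v) _) _; rewrite (pwC p (g v)) -mulrA mulrCA.
  rewrite ler_pM2l ?kap_gt0// (_ : 2 * G = G + G); last by ring.
  by apply: lerD; exact: vertex_fun_diff.
have := H 0 1; have := H 1 2; have := H 2 0; lra.
Qed.

Lemma gradient_corner n u :
  gradient n (fun w => u (Psi w (q 0))) <= 18 * kap * senergy n u.
Proof.
have F0 w : 0 <= Fp p (corners u w) by exact: Fp_ge0.
apply: (@le_trans _ _ (kap * (9 * senergy n u + 9 * senergy n u))); last first.
  by have := kap_gt0 hp; nra.
have h1 := @sum_near_le R q hq n (fun w => Fp p (corners u w)) F0.
have h2 := @sum_near_const_le R q hq n (fun w => Fp p (corners u w)) F0.
apply: (@le_trans _ _ (kap * (\sum_(w <- words n)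
   \sum_(w' <- words n | touching w w') Fp p (corners u w') +
  \sum_(w <- words n) \sum_(w' <- words n | touching w w') Fp p (corners u w)))).
  rewrite -big_split mulr_sumr; apply: ler_sum => w _.
  rewrite -big_split mulr_sumr; apply: ler_sum => w' /touchingP[i [j ij]] /=.
  apply: le_trans (pwB hp _ (u (Psi w (q i))) _) _.
  rewrite ler_pM2l ?kap_gt0// lerD//; last first.
    by have := edge_le_Fp hp (corners u w) i 0; rewrite !mxE.
  by rewrite ij; have := edge_le_Fp hp (corners u w') 0 j; rewrite !mxE.
by rewrite ler_pM2l ?kap_gt0// lerD.
Qed.

Variable r : R.
Hypothesis hr : scaling p r.

Let r_gt0 : 0 < r. Proof. by case: hr. Qed.

(** The restriction of [u] to a cell of level [n] has at level [j] at least the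
   optimal energy for its values at the corners. *)
Lemma senergy_mono : exists2 C, 0 < C &
  forall n j u, senergy n u <= C / r ^+ j * senergy (n + j) u.
Proof.
have [_ [c [C [c0 C0 H]]]] := hr.
exists c^-1; first by rewrite invr_gt0.
move=> n j u; rewrite -invfM ler_pdivlMl; last first.
  by rewrite mulr_gt0// exprn_gt0.
rewrite senergy_cat mulr_sumr; apply: ler_sum => w _.
have /andP[h _] := H j (corners u w).
apply: (le_trans h); rewrite -[X in corners u X]cats0 corners_cat.
exact: renorm_iter_le_senergy.
Qed.

(** The distance from a value to the value at the corner [q 0] is summed over
   dyadic scales; in the recursion the constant grows by a factor at most
   2 * r / 3 < 1 relative to [(3 / r) ^+ j]. *)
Lemma poincare : exists2 L, 0 < L & forall j u,
  \sum_(v <- words j) pw (u (Psi v (q 0)) - u (q 0)) <=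
  L * (3 / r) ^+ j * senergy j u.
Proof.
have [C1 C10 mono] := senergy_mono; have [C C0 pw2] := pwD_weighted hp.
have r1 := scaling_le1 hp hr.
pose L := 3 * C * C1; have L0 : 0 < L by rewrite !mulr_gt0.
exists L => // j; elim: j => [|j IH] u.
  rewrite sum_words0 subrr pw0// !mulr_ge0 ?senergy_ge0// ltW//.
rewrite sum_wordsS.
have step i : \sum_(v <- words j) pw (u (Psi (i :: v) (q 0)) - u (q 0)) <=
    2 * (L * (3 / r) ^+ j * senergy j (u \o psi i)) +
    C * (3 ^+ j * (C1 / r ^+ j * senergy j.+1 u)).
  apply: (@le_trans _ _ (\sum_(v <- words j)
     (2 * pw ((u \o psi i) (Psi v (q 0)) - (u \o psi i) (q 0)) +
      C * (C1 / r ^+ j * senergy j.+1 u)))).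
    apply: ler_sum => v _.
    rewrite (_ : u _ - u (q 0) = ((u \o psi i) (Psi v (q 0)) - (u \o psi i) (q 0))
      + ((u \o psi i) (q 0) - u (q 0))); last by rewrite /=; ring.
    rewrite (le_trans (pw2 _ _))// lerD2l ler_pM2l//.
    apply: le_trans (mono 1%N j u).
    rewrite -{2}(psi_fix q 0) /= psi_mid.
    by apply: (@edge_le_senergy 1 u [:: 0] i 0); rewrite mem_words.
  rewrite big_split /= -mulr_sumr sum_words_const lerD//.
    by rewrite ler_pM2l//; exact: (IH (u \o psi i)).
  by rewrite mulrCA.
apply: (le_trans (ler_sum _ (fun i _ => step i))).
rewrite big_split /= -!mulr_sumr -senergyS sumr_const card_ord.
set E := senergy j.+1 u; have E0 : 0 <= E by exact: senergy_ge0.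
rewrite exprSr expr_div_n; set X := 3 ^+ j / r ^+ j.
have X0 : 0 < X by rewrite divr_gt0// exprn_gt0.
have -> : 2 * (L * X * E) + C * (3 ^+ j * (C1 / r ^+ j * (E *+ 3))) =
  3 * L * (X * E) by rewrite /L /X; ring.
have -> : L * (X * (3 / r)) * E = 3 * L * (X * E) / r by ring.
have XE : 0 <= 3 * L * (X * E) by apply: mulr_ge0; rewrite mulr_ge0// ltW.
by rewrite ler_pdivlMr// ler_piMr.
Qed.

Lemma poincare_cells : exists2 L, 0 < L & forall n j u,
  \sum_(w <- words n) \sum_(v <- words j)
     pw (u (Psi (w ++ v) (q 0)) - u (Psi w (q 0))) <=
  L * (3 / r) ^+ j * senergy (n + j) u.
Proof.
have [L L0 H] := poincare; exists L => // n j u.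
rewrite senergy_cat mulr_sumr; apply: ler_sum => w _; apply: le_trans (H j _).
by apply: ler_sum => v _; rewrite Psi_cat.
Qed.

End discrete_energy.

(** * Lower integrals *)

Section lower_integral.
Context d (T : measurableType d) (R : realType).
Variable mu : {measure set T -> \bar R}.
Implicit Types (A B : set T) (f g : T -> \bar R).

(** The integral of a non-negative function is a supremum over simple functions
   below it, and a larger function has more of them. *)
Lemma le_lower_integral A B f g :
  (forall x, A x -> (0 <= f x)%E) -> (forall x, B x -> (0 <= g x)%E) ->
  (forall x, ((f \_ A) x <= (g \_ B) x)%E) ->
  (\int[mu]_(x in A) f x <= \int[mu]_(x in B) g x)%E.
Proof.
move=> f0 g0 fg; rewrite !ge0_integralE//.
apply: le_ereal_sup => _ [h /= hf <-]; exists h => //= x.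
exact: le_trans (hf x) (fg x).
Qed.

Lemma le_lower_integral_same A f g :
  (forall x, A x -> (0 <= f x)%E) -> (forall x, A x -> (f x <= g x)%E) ->
  (\int[mu]_(x in A) f x <= \int[mu]_(x in A) g x)%E.
Proof.
move=> f0 fg; apply: le_lower_integral => // [x Ax|x].
  exact: le_trans (f0 x Ax) (fg x Ax).
by rewrite !patchE; case: ifPn => // /set_mem; exact: fg.
Qed.

(** For the outer integrand of the Korevaar-Schoen energy as [f], the
   measurability of which is not evident. *)
Lemma le_lower_integral_cover (I : eqType) (s : seq I) A f (B : I -> set T)
    (g : I -> T -> \bar R) :
  (forall x, A x -> (0 <= f x)%E) ->
  (forall i, measurable (B i)) -> (forall i, measurable_fun (B i) (g i)) ->
  (forall i x, B i x -> (0 <= g i x)%E) ->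
  (forall x, A x -> exists i, [/\ i \in s, B i x & (f x <= g i x)%E]) ->
  (\int[mu]_(x in A) f x <= \sum_(i <- s) \int[mu]_(x in B i) g i x)%E.
Proof.
move=> f0 mB mg g0 H.
have gB0 i x : (0 <= (g i \_ (B i)) x)%E.
  by rewrite patchE; case: ifPn => // /set_mem; exact: g0.
rewrite (eq_bigr (fun i => \int[mu]_x (g i \_ (B i)) x)%E); last first.
  by move=> i _; rewrite integral_mkcond.
rewrite -ge0_integral_sum//; last first.
  by move=> i; apply/(measurable_restrictT _ _).1.
apply: le_lower_integral => // [x _|x]; first exact: sume_ge0.
rewrite patch_setT patchE; case: ifPn => [/set_mem Ax|_]; last exact: sume_ge0.
have [i [si Bix fg]] := H x Ax.
rewrite (big_rem i)//= patchE mem_set// (le_trans fg)// leeDl//.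
exact: sume_ge0.
Qed.

(** The simple function with value [a i] on [B i] lies below [N * f] when no point
   is covered more than [N] times. *)
Lemma ge_lower_integral_cover (I : eqType) (s : seq I) (A : set T) f
    (B : I -> set T) (a : I -> R) (N : R) : 0 < N ->
  (forall x, A x -> (0 <= f x)%E) ->
  (forall i, measurable (B i)) -> (forall i, B i `<=` A) -> (forall i, 0 <= a i) ->
  (forall i x, i \in s -> B i x -> ((a i)%:E <= f x)%E) ->
  (forall x, \sum_(i <- s) (x \in B i)%:R <= N) ->
  (\sum_(i <- s) (a i)%:E * mu (B i) <= N%:E * \int[mu]_(x in A) f x)%E.
Proof.
move=> N0 f0 mB BA a0 af cov.
have aN i : 0 <= a i / N by rewrite divr_ge0// ltW.
have -> : (\sum_(i <- s) (a i)%:E * mu (B i) =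
    N%:E * \sum_(i <- s) (a i / N)%:E * mu (B i))%E.
  rewrite ge0_sume_distrr; last by move=> i _; rewrite mule_ge0// lee_fin.
  apply: eq_bigr => i _; rewrite muleA -EFinM mulrCA divff ?mulr1//.
  by rewrite gt_eqF.
rewrite lee_pmul2l// ?lte_fin//.
have E i : ((a i / N)%:E * mu (B i) =
    \int[mu]_x ((cst (a i / N)%:E \_ (B i)) x))%E.
  by rewrite -integral_mkcond integral_cst.
rewrite (eq_bigr _ (fun i _ => E i)) -ge0_integral_sum//; last 2 first.
- by move=> i; apply/(measurable_restrictT _ _).1 => //; exact: measurable_cst.
- by move=> i x _; rewrite patchE; case: ifPn => // _; rewrite lee_fin.
apply: le_lower_integral => // [x _|x].
  apply: sume_ge0 => i _; rewrite patchE; case: ifPn => // _.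
  by rewrite lee_fin.
rewrite patch_setT.
have -> : (\sum_(i <- s) (cst (a i / N)%:E \_ (B i)) x =
    (\sum_(i <- s) (a i / N) * (x \in B i)%:R)%:E)%E.
  rewrite -sumEFin; apply: eq_bigr => i _; rewrite patchE.
  by case: ifPn => _; rewrite ?mulr1 ?mulr0.
rewrite patchE; case: ifPn => xA; last first.
  rewrite big1// => i _; case: (boolP (x \in B i)) => [|_]; last by rewrite mulr0.
  by move=> /set_mem/BA/mem_set; rewrite (negbTE xA).
have := f0 x (set_mem xA); case fx : (f x) => [y| |]; rewrite ?leey//.
rewrite !lee_fin => y0.
apply: (@le_trans _ _ (\sum_(i <- s) (y / N) * (x \in B i)%:R)).
  rewrite big_seq [leRHS]big_seq; apply: ler_sum => i si.
  case: (boolP (x \in B i)) => [/set_mem xB|_]; last by rewrite !mulr0.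
  rewrite !mulr1 ler_pM2r ?invr_gt0//.
  by have := af i x si xB; rewrite fx lee_fin.
rewrite -mulr_sumr mulrAC ler_pdivrMr//.
by apply: ler_wpM2l.
Qed.

End lower_integral.

(** * Oscillation on cells *)

Section oscillation.
Variables (R : realType) (q : 'I_3 -> plane R).
Hypothesis hq : unit_equilateral q.
Variable K : set (plane R).
Hypothesis hK : is_gasket q K.
Variable mu : {measure set (borel_plane R) -> \bar R}.
Hypothesis hmu : is_gasket_measure q K mu.
Variable p : R.
Hypothesis hp : 1 <= p.
Local Notation pw := (pw p).
Local Notation kap := (kap p).
Local Notation cell := (cell q K).
Implicit Types (w v : seq 'I_3) (g : seq 'I_3 -> R).

Lemma mu_cell w : mu (cell w) = (3 ^- size w)%:E.
Proof. by case: hmu => _ /(_ _ (in_tuple w)). Qed.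

Lemma mu_gasket : mu K = 1%E.
Proof. by rewrite -(cell_nil q K) mu_cell /= expr0 invr1. Qed.

Variable f : plane R -> R.
Hypothesis hf : Lp K mu p f.

Let mf : measurable_fun (K : set (borel_plane R)) (f : borel_plane R -> R).
Proof. by case: hf. Qed.

Lemma measurable_pw_diff (D : set (borel_plane R)) c :
  measurable D -> D `<=` K ->
  measurable_fun D (fun x : borel_plane R => (pw (f x - c))%:E).
Proof.
move=> mD DK; apply/measurable_EFinP.
apply: (measurableT_comp (measurable_powR p)).
apply: measurableT_comp => //; apply: measurable_funB => //.
apply: measurable_funS mf => //; exact: (measurable_gasket hK).
Qed.

Lemma measurable_affine_pw w c a b :
  measurable_fun (cell w : set (borel_plane R))
    (fun x : borel_plane R => (a * pw (f x - c) + b)%:E).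
Proof.
apply/measurable_EFinP; apply: measurable_funD => //.
apply: measurable_funM => //.
apply/measurable_EFinP.
exact: (measurable_pw_diff c (measurable_cell hK w) (cell_sub hK (w := w))).
Qed.

Lemma integral_pw_fin w c :
  (\int[mu]_(x in cell w) (pw (f x - c))%:E < +oo)%E.
Proof.
have mK := measurable_gasket hK; have mw := measurable_cell hK w.
have mfK : measurable_fun (K : set (borel_plane R)) (fun x : borel_plane R => (pw (f x))%:E).
  have := measurable_pw_diff 0 mK (@subset_refl _ K).
  by under eq_fun do rewrite subr0.
apply: (@le_lt_trans _ _ (\int[mu]_(x in K) (kap%:E * ((pw (f x))%:E + (pw c)%:E)))%E).
  apply: le_lower_integral => [x _|x _|x]; rewrite -?EFinM -?EFinD.
  - by rewrite lee_fin pw_ge0.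
  - by rewrite lee_fin mulr_ge0 ?addr_ge0 ?pw_ge0// ltW ?kap_gt0.
  rewrite !patchE; case: ifPn => [/set_mem xw|_].
    rewrite mem_set; last exact: (cell_sub hK) xw.
    by rewrite lee_fin -(pwN p c) pwD.
  by case: ifPn => // _; rewrite lee_fin mulr_ge0 ?addr_ge0 ?pw_ge0// ltW ?kap_gt0.
have k0 : (0 <= kap)%R by rewrite ltW ?kap_gt0.
rewrite ge0_integralZl_EFin//; last 2 first.
- by move=> x _; rewrite -EFinD lee_fin addr_ge0 ?pw_ge0.
- by apply: emeasurable_funD.
rewrite ge0_integralD//; last 2 first.
- by move=> x _; rewrite lee_fin pw_ge0.
- by move=> x _; rewrite lee_fin pw_ge0.
rewrite integral_cst// mu_gasket mule1.
rewrite lte_mul_pinfty// ?lee_fin// lte_add_pinfty// ?ltry//.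
by case: hf.
Qed.

(** The [p]-th power of the [L^p] distance between [f] and a constant on a cell,
   as a real number. *)
Definition Iosc w c : R := fine (\int[mu]_(x in cell w) (pw (f x - c))%:E).

Lemma IoscE w c : (\int[mu]_(x in cell w) (pw (f x - c))%:E)%E = (Iosc w c)%:E.
Proof.
rewrite fineK// ge0_fin_numE ?integral_pw_fin//.
by apply: integral_ge0 => x _; rewrite lee_fin pw_ge0.
Qed.

Lemma Iosc_ge0 w c : 0 <= Iosc w c.
Proof.
by rewrite -lee_fin -IoscE; apply: integral_ge0 => x _; rewrite lee_fin pw_ge0.
Qed.

Lemma integral_affine_pw w c a b : 0 <= a -> 0 <= b ->
  (\int[mu]_(x in cell w) (a * pw (f x - c) + b)%:E)%E =
  (a * Iosc w c + b * 3 ^- size w)%:E.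
Proof.
move=> a0 b0; have mw := measurable_cell hK w.
have mpw := measurable_pw_diff c mw (cell_sub hK (w := w)).
under eq_integral do rewrite EFinD EFinM.
rewrite ge0_integralD//; last 2 first.
- by move=> x _; rewrite -EFinM lee_fin mulr_ge0 ?pw_ge0.
- exact: emeasurable_funM.
rewrite ge0_integralZl_EFin//; last by move=> x _; rewrite lee_fin pw_ge0.
by rewrite IoscE integral_cst// mu_cell -EFinM.
Qed.

Lemma Iosc_shift w c c' : Iosc w c <= kap * (Iosc w c' + 3 ^- size w * pw (c' - c)).
Proof.
have k0 := kap_gt0 hp.
have : (\int[mu]_(x in cell w) (pw (f x - c))%:E <= \int[mu]_(x in cell w)
    (kap * pw (f x - c') + kap * pw (c' - c))%:E)%E.
  apply: le_lower_integral_same => x _; rewrite lee_fin ?pw_ge0//.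
  by rewrite -mulrDr pwB.
rewrite IoscE integral_affine_pw ?lee_fin ?(ltW k0)//; last first.
  by rewrite mulr_ge0 ?pw_ge0// ltW.
lra.
Qed.

Lemma pw_le_Iosc w c c' : 3 ^- size w * pw (c' - c) <= kap * (Iosc w c' + Iosc w c).
Proof.
have k0 := kap_gt0 hp.
have : (\int[mu]_(x in cell w) (0 * pw (f x - c) + pw (c' - c))%:E <=
    \int[mu]_(x in cell w) (kap%:E * ((pw (f x - c'))%:E + (pw (f x - c))%:E)))%E.
  apply: le_lower_integral_same => x _; rewrite mul0r add0r ?lee_fin ?pw_ge0//.
  by rewrite (pwC p (f x) c') pwB.
have mw := measurable_cell hK w.
have mpw z := measurable_pw_diff z mw (cell_sub hK (w := w)).
rewrite integral_affine_pw ?pw_ge0// mul0r add0r.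
rewrite ge0_integralZl_EFin//; last 3 first.
- by move=> x _; rewrite -EFinD lee_fin addr_ge0 ?pw_ge0.
- by apply: emeasurable_funD.
- exact: ltW.
rewrite ge0_integralD//; last 2 first.
- by move=> x _; rewrite lee_fin pw_ge0.
- by move=> x _; rewrite lee_fin pw_ge0.
by rewrite !IoscE -EFinD -EFinM lee_fin mulrC.
Qed.

Lemma Iosc_split w j c : Iosc w c <= \sum_(v <- words j) Iosc (w ++ v) c.
Proof.
rewrite -lee_fin -IoscE -sumEFin.
rewrite (eq_bigr (fun v => \int[mu]_(x in cell (w ++ v)) (pw (f x - c))%:E)%E); last first.
  by move=> v _; rewrite IoscE.
apply: (@le_lower_integral_cover _ _ _ mu _ (words j) (cell w) _
  (fun v => cell (w ++ v)) (fun _ x => (pw (f x - c))%:E)).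
- by move=> x _; rewrite lee_fin pw_ge0.
- by move=> v; exact: (measurable_cell hK).
- move=> v; exact: (measurable_pw_diff c (measurable_cell hK (w ++ v)) (cell_sub hK (w := w ++ v))).
- by move=> v x _; rewrite lee_fin pw_ge0.
- by move=> x /(cell_cover hK j)[v vj vx]; exists v.
Qed.

(** The discrete counterpart of the Korevaar-Schoen energy. The factor [3 ^- n]
   is the measure of a cell. *)
Definition oscillation n g : R :=
  \sum_(w <- words n) Iosc w (g w) + 3 ^- n * gradient p q n g.

Lemma sum_Iosc_ge0 n g : 0 <= \sum_(w <- words n) Iosc w (g w).
Proof. by apply: sumr_ge0 => w _; exact: Iosc_ge0. Qed.

Lemma gradient_term_ge0 n g : 0 <= 3 ^- n * gradient p q n g.
Proof. by rewrite mulr_ge0 ?invr_ge0 ?exprn_ge0 ?gradient_ge0. Qed.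

Lemma oscillation_ge0 n g : 0 <= oscillation n g.
Proof. by rewrite addr_ge0 ?sum_Iosc_ge0 ?gradient_term_ge0. Qed.

End oscillation.

(** * Oscillations and averages over balls, upper bounds *)

Section energy_comparison.
Variables (R : realType) (q : 'I_3 -> plane R).
Hypothesis hq : unit_equilateral q.
Variable K : set (plane R).
Hypothesis hK : is_gasket q K.
Variable mu : {measure set (borel_plane R) -> \bar R}.
Hypothesis hmu : is_gasket_measure q K mu.
Variable p : R.
Hypothesis hp : 1 <= p.
Local Notation pw := (pw p).
Local Notation kap := (kap p).
Local Notation Psi := (Psi q).
Local Notation cell := (cell q K).
Local Notation touching := (touching q).
Local Notation Iosc := (Iosc q K mu p).
Local Notation oscillation := (oscillation q K mu p).
Local Notation senergy := (senergy p q).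
Local Notation gradient := (gradient p q).


Let k0 : 0 < kap. Proof. exact: kap_gt0. Qed.

Section weak_monotonicity.
Variable r : R.
Hypothesis hr : scaling p r.

Let r_gt0 : 0 < r. Proof. by case: hr. Qed.

(** Coarsening a function on the vertices: the two terms are the error of
   approximating [f] on fine cells and the Poincare inequality. The first one
   does not carry the factor [(3 / r) ^+ j]. *)
Lemma oscillation_corner : exists2 C, 0 < C & forall f, Lp K mu p f ->
  forall n j u, oscillation f n (fun w => u (Psi w (q 0))) <=
    C * (\sum_(v <- words (n + j)) Iosc f v (u (Psi v (q 0))) +
         (3 / r) ^+ j * (3 ^- (n + j) * senergy (n + j) u)).
Proof.
have [L L0 HL] := poincare_cells hp q hr; have [C1 C10 mono] := senergy_mono hp q hr.
exists (kap * (1 + L) + 18 * kap * C1).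
  by rewrite addr_gt0 ?mulr_gt0 ?addr_gt0.
move=> f hf n j u.
set S := \sum_(v <- words (n + j)) _; set E := senergy (n + j) u.
have S0 : 0 <= S by apply: sumr_ge0 => v _; exact: (Iosc_ge0 hK hmu hp hf).
have E0 : 0 <= E by exact: senergy_ge0.
set X := (3 / r) ^+ j; set Y := 3 ^- (n + j).
have X0 : 0 <= X by rewrite exprn_ge0 ?divr_ge0// ltW.
have Y0 : 0 <= Y by rewrite invr_ge0 exprn_ge0.
have bnd1 : \sum_(w <- words n) Iosc f w (u (Psi w (q 0))) <=
    kap * (S + L * (X * (Y * E))).
  apply: (@le_trans _ _ (\sum_(w <- words n) \sum_(v <- words j)
     kap * (Iosc f (w ++ v) (u (Psi (w ++ v) (q 0))) +
       Y * pw (u (Psi (w ++ v) (q 0)) - u (Psi w (q 0)))))).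
    rewrite big_seq [leRHS]big_seq; apply: ler_sum => w.
    rewrite mem_words => /eqP wn.
    apply: (le_trans (Iosc_split hK hmu hp hf w j _)).
    rewrite big_seq [leRHS]big_seq; apply: ler_sum => v.
    rewrite mem_words => /eqP vj.
    have := Iosc_shift hK hmu hp hf (w ++ v) (u (Psi w (q 0)))
      (u (Psi (w ++ v) (q 0))).
    by rewrite size_cat wn vj.
  under eq_bigr do rewrite -mulr_sumr big_split/= -[X in _ + X]mulr_sumr.
  rewrite -mulr_sumr ler_pM2l// big_split/=.
  rewrite -(sum_words_cat n j (fun v => Iosc f v (u (Psi v (q 0))))) lerD2l.
  rewrite -mulr_sumr (_ : L * (X * (Y * E)) = Y * (L * X * E)); last by ring.
  by rewrite ler_wpM2l.
have bnd2 : 3 ^- n * gradient n (fun w => u (Psi w (q 0))) <=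
    18 * kap * C1 * (X * (Y * E)).
  have -> : 18 * kap * C1 * (X * (Y * E)) =
      3 ^- n * (18 * kap * (C1 / r ^+ j * E)).
    rewrite /X /Y expr_div_n exprD; field.
    by rewrite !expf_neq0// gt_eqF.
  rewrite ler_wpM2l ?invr_ge0 ?exprn_ge0//.
  apply: (le_trans (gradient_corner hp hq n u)).
  by rewrite ler_pM2l ?mulr_gt0.
rewrite /oscillation; apply: (le_trans (lerD bnd1 bnd2)).
have Z0 : 0 <= X * (Y * E) by rewrite !mulr_ge0.
move: bnd1 bnd2 => _ _; move: (X * (Y * E)) Z0 => Z Z0.
have k0' := ltW k0.
have := mulr_ge0 k0' (mulr_ge0 (ltW L0) S0).
have := mulr_ge0 k0' (mulr_ge0 (ltW C10) S0).
have := mulr_ge0 k0' Z0.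
lra.
Qed.

(** The coarse values are those at the corner [q 0] of the function on the
   vertices that the fine values define. *)
Lemma oscillation_weak_mono : exists2 C, 0 < C & forall f, Lp K mu p f ->
  forall n j g, exists g', oscillation f n g' <=
    C * (3 / r) ^+ j * oscillation f (n + j) g.
Proof.
have [C C0 HC] := oscillation_corner.
exists (C * (7 * kap)); first by rewrite !mulr_gt0.
move=> f hf n j g; set u := vertex_fun q (n + j) g.
exists (fun w => u (Psi w (q 0))); apply: (le_trans (HC f hf n j u)).
rewrite -!mulrA ler_pM2l// mulrA.
have r1 := scaling_le1 hp hr.
set X := (3 / r) ^+ j.
have X1 : 1 <= X by rewrite exprn_ege1// ler_pdivlMr//; lra.
have S : \sum_(v <- words (n + j)) Iosc f v (u (Psi v (q 0))) <=
    kap * oscillation f (n + j) g.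
  rewrite /oscillation /gradient mulr_sumr -big_split mulr_sumr /=.
  rewrite big_seq [leRHS]big_seq; apply: ler_sum => v vk.
  apply: (le_trans (Iosc_shift hK hmu hp hf v _ (g v))).
  have sv : size v = (n + j)%N by apply/eqP; rewrite -mem_words.
  rewrite ler_pM2l// lerD2l sv ler_wpM2l ?invr_ge0 ?exprn_ge0//.
  by rewrite pwC; exact: vertex_fun_diff.
have T : 3 ^- (n + j) * senergy (n + j) u <= 6 * kap * oscillation f (n + j) g.
  have := senergy_vertex_fun hp q (n + j) g; rewrite -/u => H.
  apply: (@le_trans _ _ (6 * kap * (3 ^- (n + j) * gradient (n + j) g))).
    by rewrite mulrCA ler_wpM2l ?invr_ge0 ?exprn_ge0.
  rewrite ler_pM2l ?mulr_gt0// lerDr; exact: (sum_Iosc_ge0 hK hmu hp hf).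
have O0 : 0 <= oscillation f (n + j) g by exact: (oscillation_ge0 hK hmu hp hf).
have kO : 0 <= kap * oscillation f (n + j) g by rewrite mulr_ge0// ltW.
have X0 : 0 <= X by lra.
have XT := ler_wpM2l X0 T.
have XO : kap * oscillation f (n + j) g <= X * (kap * oscillation f (n + j) g).
  by rewrite ler_peMl.
rewrite -mulrA (_ : 7 * _ = X * (kap * oscillation f (n + j) g) +
  X * (6 * kap * oscillation f (n + j) g)); last by ring.
by rewrite lerD// (le_trans S).
Qed.

End weak_monotonicity.

Section ball_averages.
Variable f : plane R -> R.
Hypothesis hf : Lp K mu p f.
Variables (alpha rho : R).
Hypothesis rho_gt0 : 0 < rho.
Local Notation rpa := (rho `^ (p * alpha)).

Let rpa_gt0 : 0 < rpa. Proof. exact: powR_gt0. Qed.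

Definition KSintegrand (x : plane R) : \bar R :=
  ((mu (geoball K x rho))^-1 *
      \int[mu]_(y in geoball K x rho) (pw (f y - f x) / rpa)%:E)%E.

Lemma KSintegrand_ge0 x : (0 <= KSintegrand x)%E.
Proof.
apply: mule_ge0; first by rewrite inve_ge0.
by apply: integral_ge0 => y _; rewrite lee_fin divr_ge0 ?pw_ge0// ltW.
Qed.

(** The averages at scale [rho] are controlled by the oscillation at level [n]
   when the balls meet only cells that touch the cell of their center. *)
Lemma KSenergy_le_oscillation n (m : R) g : 0 < m ->
  (forall x, K x -> (m%:E <= mu (geoball K x rho))%E) ->
  (forall w x y, w \in words n -> cell w x -> geoball K x rho y ->
     exists w', [/\ w' \in words n, touching w w' & cell w' y]) ->
  (KSenergy K mu p alpha f rho <=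
    (18 * kap ^+ 2 * (m^-1 * 3 ^- n) / rpa * oscillation f n g)%:E)%E.
Proof.
move=> m0 Bm cov.
pose a := kap ^+ 2 / rpa.
have a0 : 0 < a by rewrite divr_gt0// exprn_gt0.
pose S w := \sum_(w' <- words n | touching w w')
  (Iosc f w' (g w') + 3 ^- n * pw (g w' - g w)).
have S0 w : 0 <= S w.
  apply: sumr_ge0 => w' _.
  by rewrite addr_ge0 ?(Iosc_ge0 hK hmu hp hf)// mulr_ge0 ?pw_ge0// invr_ge0 exprn_ge0.
pose A := m^-1 * a * (9 * 3 ^- n).
have n0 : 0 < 3 ^- n :> R by rewrite invr_gt0 exprn_gt0.
have A0 : 0 < A by rewrite !mulr_gt0// invr_gt0.
pose B w := m^-1 * a * S w.
have B0 w : 0 <= B w by rewrite !mulr_ge0// ?invr_ge0 ltW.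
have pointwise w x : w \in words n -> cell w x ->
    (KSintegrand x <= (A * pw (f x - g w) + B w)%:E)%E.
  move=> wn wx; have Kx := cell_sub hK wx.
  pose b w' := a * (pw (g w' - g w) + pw (f x - g w)).
  have b0 w' : 0 <= b w' by rewrite /b mulr_ge0 ?addr_ge0 ?pw_ge0// ltW.
  have inner : (\int[mu]_(y in geoball K x rho) (pw (f y - f x) / rpa)%:E <=
     \sum_(w' <- [seq w' <- words n | touching w w'])
       \int[mu]_(y in cell w') (a * pw (f y - g w') + b w')%:E)%E.
    apply: (@le_lower_integral_cover _ _ _ mu _ _ (geoball K x rho) _
      (fun w' => cell w') (fun w' y => (a * pw (f y - g w') + b w')%:E)).
    - by move=> y _; rewrite lee_fin divr_ge0 ?pw_ge0// ltW.
    - move=> w'; exact: (measurable_cell hK).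
    - move=> w'; exact: (measurable_affine_pw hK hf).
    - by move=> w' y _; rewrite lee_fin addr_ge0// mulr_ge0 ?pw_ge0// ltW.
    - move=> y /(cov w x y wn wx)[w' [w'n ww' w'y]].
      exists w'; split=> //; first by rewrite mem_filter ww'.
      rewrite lee_fin -mulrDr /a mulrAC ler_pM2r ?invr_gt0//.
      rewrite (_ : f y - f x = (f y - g w') + (g w' - g w) + (g w - f x)); last by ring.
      by apply: (le_trans (pwD3 hp _ _ _)); rewrite (pwC p (g w)) addrA.
  have innerE : (\sum_(w' <- [seq w' <- words n | touching w w'])
       \int[mu]_(y in cell w') (a * pw (f y - g w') + b w')%:E <=
       (a * (S w + 9 * 3 ^- n * pw (f x - g w)))%:E)%E.
    rewrite big_filter (eq_bigr (fun w' => (a * Iosc f w' (g w') +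
       b w' * 3 ^- size w')%:E)); last first.
      move=> w' _; rewrite (integral_affine_pw hK hmu hp hf)//; exact: ltW.
    rewrite sumEFin lee_fin.
    rewrite big_seq_cond (eq_bigr (fun w' => a * (Iosc f w' (g w') +
        3 ^- n * pw (g w' - g w)) + a * (3 ^- n * pw (f x - g w)))); last first.
      move=> w' /andP[]; rewrite mem_words => /eqP -> _; rewrite /b; ring.
    rewrite -big_seq_cond big_split /= -mulr_sumr -/(S w) mulrDr lerD2l.
    rewrite big_const_seq iter_addr_0 -[leLHS]mulr_natl.
    rewrite (_ : a * (9 * 3 ^- n * _) = 9 * (a * (3 ^- n * pw (f x - g w)))); last by ring.
    have c0 : 0 <= a * (3 ^- n * pw (f x - g w)).
      apply: mulr_ge0; first exact: ltW.
      by apply: mulr_ge0; [exact: ltW|exact: pw_ge0].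
    apply: ler_wpM2r => //.
    rewrite ler_nat; apply: (near_count hq).
    by apply/eqP; rewrite -mem_words.
  have int0 : (0 <= \int[mu]_(y in geoball K x rho) (pw (f y - f x) / rpa)%:E)%E.
    by apply: integral_ge0 => y _; rewrite lee_fin divr_ge0 ?pw_ge0// ltW.
  have inv_le : ((mu (geoball K x rho))^-1 <= (m^-1)%:E)%E.
    have -> : (m^-1)%:E = (m%:E)^-1%E by rewrite inver gt_eqF.
    by rewrite lee_pV2 ?Bm// ?inE ?lee_fin ?(ltW m0).
  rewrite (_ : A * _ + B w = m^-1 * (a * (S w + 9 * 3 ^- n * pw (f x - g w)))); last first.
    by rewrite /A /B; ring.
  rewrite EFinM; apply: lee_pmul => //; first by rewrite inve_ge0.
  exact: le_trans inner innerE.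
have := @le_lower_integral_cover _ _ _ mu _ (words n) K KSintegrand
  (fun w => cell w) (fun w x => (A * pw (f x - g w) + B w)%:E).
move=> /(_ (fun x _ => KSintegrand_ge0 x) (measurable_cell hK)) H.
have {}H : (KSenergy K mu p alpha f rho <= \sum_(w <- words n)
    \int[mu]_(x in cell w) (A * pw (f x - g w) + B w)%:E)%E.
  apply: H.
  - move=> w; exact: (measurable_affine_pw hK hf).
  - move=> w x _; rewrite lee_fin addr_ge0// mulr_ge0 ?pw_ge0//; exact: ltW.
  - move=> x /(gasket_cover hK n)[w wn wx]; exists w; split=> //.
    exact: pointwise.
apply: (le_trans H).
rewrite (eq_bigr (fun w => (A * Iosc f w (g w) + B w * 3 ^- size w)%:E)); last first.
  by move=> w _; rewrite (integral_affine_pw hK hmu hp hf)// ltW.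
rewrite sumEFin lee_fin.
rewrite big_seq (eq_bigr (fun w => m^-1 * a * 3 ^- n * (9 * Iosc f w (g w) + S w)));
  last first.
  move=> w; rewrite mem_words => /eqP ->; rewrite /A /B; ring.
rewrite -big_seq -mulr_sumr.
have -> : 18 * kap ^+ 2 * (m^-1 / 3 ^+ n) / rpa * oscillation f n g =
    m^-1 * a * 3 ^- n * (18 * oscillation f n g) by rewrite /a; ring.
rewrite ler_pM2l; last by rewrite !mulr_gt0// invr_gt0.
rewrite big_split /= -mulr_sumr.
have -> : \sum_(w <- words n) S w =
   \sum_(w <- words n) \sum_(w' <- words n | touching w w') Iosc f w' (g w') +
   3 ^- n * gradient n g.
  rewrite /S /gradient mulr_sumr -big_split /=; apply: eq_bigr => w _.
  by rewrite mulr_sumr -big_split.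
have I0 w : 0 <= Iosc f w (g w) by exact: (Iosc_ge0 hK hmu hp hf).
have := @sum_near_le R q hq n (fun w => Iosc f w (g w)) I0.
have := gradient_term_ge0 q p n g; have := sum_Iosc_ge0 hK hmu hp hf n g.
rewrite /oscillation.
set X1 := \sum_(w <- words n) \sum_(w' <- words n | touching w w') Iosc f w' (g w').
set X2 := \sum_(w <- words n) Iosc f w (g w).
set X3 := 3 ^- n * gradient n g.
lra.
Qed.

End ball_averages.

End energy_comparison.

(** * Oscillations and averages over balls, lower bounds *)

Section energy_comparison_below.
Variables (R : realType) (q : 'I_3 -> plane R).
Hypothesis hq : unit_equilateral q.
Variable K : set (plane R).
Hypothesis hK : is_gasket q K.
Variable mu : {measure set (borel_plane R) -> \bar R}.
Hypothesis hmu : is_gasket_measure q K mu.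
Variable p : R.
Hypothesis hp : 1 <= p.
Local Notation pw := (pw p).
Local Notation kap := (kap p).
Local Notation cell := (cell q K).
Local Notation touching := (touching q).
Local Notation Iosc := (Iosc q K mu p).
Local Notation oscillation := (oscillation q K mu p).
Local Notation gradient := (gradient p q).


Let k0 : 0 < kap. Proof. exact: kap_gt0. Qed.

Section ball_averages_below.
Variable f : plane R -> R.
Hypothesis hf : Lp K mu p f.
Variables (alpha rho : R).
Hypothesis rho_gt0 : 0 < rho.
Local Notation rpa := (rho `^ (p * alpha)).
Local Notation KSintegrand := (KSintegrand K mu p f alpha rho).

Let rpa_gt0 : 0 < rpa. Proof. exact: powR_gt0. Qed.

(** Cells with a common point touch each other. *)
Lemma sum_cell_indic_le n (x : plane R) :
  \sum_(w <- words n) (x \in (cell w : set (plane R)))%:R <= 9 :> R.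
Proof.
have [|H] := pselect (exists2 w, w \in words n & cell w x); last first.
  rewrite big_seq big1 ?ler0n// => w wn; rewrite memNset// => wx.
  by apply: H; exists w.
move=> [w wn wx]; have sw : size w = n by apply/eqP; rewrite -mem_words.
apply: (@le_trans _ _ (\sum_(w' <- words n) (touching w w')%:R)).
  rewrite big_seq [leRHS]big_seq; apply: ler_sum => w' w'n.
  case: (boolP (x \in _)) => [/set_mem w'x|_]; last by rewrite ler0n.
  suff -> : touching w w' by [].
  apply: (close_near hq hK _ wx w'x).
    by rewrite sw; apply/esym/eqP; rewrite -mem_words.
  have -> : Defs.edist x x = 0.
    by apply/eqP; rewrite sqrtr_eq0 !subrr expr0n /= addr0.
  by rewrite mulr0 exprn_gt0// invr_gt0.
have := near_count hq sw; rewrite -sum1_count -(ler_nat R) natr_sum.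
apply: le_trans; rewrite [leRHS]big_mkcond /=; apply: ler_sum => w' _.
by case: (touching w w').
Qed.

(** On each cell a point is chosen where the integrand is almost minimal: the sum
   of the minimal values is a lower integral sum, and the value of the integrand
   at one point controls the oscillation of [f] on all touching cells. *)
Lemma oscillation_le_KSenergy n (M E e : R) : 0 < M -> 0 < e ->
  (forall x, K x -> (mu (geoball K x rho) <= M%:E)%E) ->
  (forall w w' x y, w \in words n -> w' \in words n -> touching w w' ->
     cell w x -> cell w' y -> geoball K x rho y) ->
  (KSenergy K mu p alpha f rho <= E%:E)%E ->
  exists2 g, (forall w, w \in words n -> exists2 x, cell w x & g w = f x) &
    oscillation f n g <= (1 + 18 * kap) * (M * 3 ^+ n) * rpa * (9 * E + e).
Proof.
move=> M0 e0 BM cov HE.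
have szw w : w \in words n -> size w = n by rewrite mem_words => /eqP.
have int_ge0 x : K x -> (0 <= KSintegrand x)%E.
  by move=> _; exact: KSintegrand_ge0.
have below w w' x : w \in words n -> w' \in words n -> touching w w' ->
    cell w x -> ((M^-1 * (rpa^-1 * Iosc f w' (f x)))%:E <= KSintegrand x)%E.
  move=> wn w'n ww' wx; have Kx := cell_sub hK wx.
  have mB := measurable_geoball hq hK x rho.
  have muB : (0 < mu (geoball K x rho))%E.
    apply: (@lt_le_trans _ _ (mu (cell w'))).
      by rewrite (mu_cell hmu) lte_fin invr_gt0 exprn_gt0.
    apply: le_measure; rewrite ?inE//; first exact: (measurable_cell hK).
    by move=> y w'y; exact: (cov w w').
  have inner : ((rpa^-1 * Iosc f w' (f x))%:E <=
      \int[mu]_(y in geoball K x rho) (pw (f y - f x) / rpa)%:E)%E.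
    rewrite -[X in X%:E]addr0 -[X in _ + X](mul0r (3 ^- size w')).
    rewrite -(integral_affine_pw hK hmu hp hf) ?invr_ge0 ?(ltW rpa_gt0)//.
    apply: le_lower_integral => [y _|y _|y].
    - by rewrite addr0 lee_fin mulr_ge0 ?pw_ge0// invr_ge0 ltW.
    - by rewrite lee_fin divr_ge0 ?pw_ge0// ltW.
    rewrite !patchE; case: ifPn => [/set_mem w'y|_].
      by rewrite mem_set; [rewrite addr0 mulrC|exact: (cov w w')].
    by case: ifPn => // _; rewrite lee_fin divr_ge0 ?pw_ge0// ltW.
  rewrite EFinM; apply: lee_pmul => //.
  - by rewrite lee_fin invr_ge0 ltW.
  - by rewrite lee_fin mulr_ge0 ?(Iosc_ge0 hK hmu hp hf)// invr_ge0 ltW.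
  - have -> : (M^-1)%:E = (M%:E)^-1%E by rewrite inver gt_eqF.
    by rewrite lee_pV2 ?BM// inE ?lee_fin ltW.
have lowersum (a : seq 'I_3 -> R) : (forall w, 0 <= a w) ->
    (forall w x, w \in words n -> cell w x -> ((a w)%:E <= KSintegrand x)%E) ->
    \sum_(w <- words n) a w <= 9 * 3 ^+ n * E.
  move=> a0 aint.
  have n9 : 0 < 9 :> R by [].
  have := @ge_lower_integral_cover _ _ _ mu _ (words n) K KSintegrand cell a 9
    n9 int_ge0 (measurable_cell hK) (cell_sub hK) a0 aint (sum_cell_indic_le n).
  rewrite -/(KSenergy K mu p alpha f rho) => H.
  have {}H := le_trans H (lee_wpmul2l (lee_tofin (ltW n9)) HE).
  move: H; rewrite big_seq (eq_bigr (fun w => (a w * 3 ^- n)%:E)); last first.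
    by move=> w wn; rewrite (mu_cell hmu) (szw w wn).
  rewrite -big_seq sumEFin -EFinM lee_fin -mulr_suml ler_pdivrMr ?exprn_gt0//.
  by rewrite mulrAC.
pose h w : \bar R := ereal_inf (KSintegrand @` cell w).
have h_ge0 w : (0 <= h w)%E.
  by apply: le_ereal_inf_tmp => _ [x _ <-]; exact: KSintegrand_ge0.
have h_le w x : cell w x -> (h w <= KSintegrand x)%E.
  by move=> wx; apply: ereal_inf_lbound; exists x.
have h_fin w : w \in words n -> h w \is a fin_num.
  move=> wn; rewrite ge0_fin_numE// ltey; apply/eqP => hoo.
  (* An infinite infimum on a cell would allow an arbitrarily large lower sum. *)
  pose b : R := Num.max 0 (9 * 3 ^+ n * E) + 1.
  have b0 : 0 <= b by rewrite addr_ge0// le_max lexx.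
  pose a w' : R := if w' == w then b else 0.
  have : \sum_(w' <- words n) a w' <= 9 * 3 ^+ n * E.
    apply: lowersum => [w'|w' x w'n w'x]; rewrite /a; case: eqP => // w'w.
      by apply: le_trans (h_le w' x w'x); rewrite w'w hoo leey.
    exact: KSintegrand_ge0.
  rewrite (big_rem w)//= /a eqxx leNgt => /negP; apply.
  apply: (@lt_le_trans _ _ b); last first.
    by rewrite lerDl; apply: sumr_ge0 => w' _; case: eqP.
  by rewrite /b ltr_pwDr// le_max lexx orbT.
pose hr w := fine (h w).
have hr0 w : 0 <= hr w by exact: fine_ge0.
have hrE w : w \in words n -> h w = (hr w)%:E by move=> /h_fin/fineK <-.
have [g Hg] : exists g, forall w, w \in words n -> exists x,
    [/\ cell w x, g w = f x & (KSintegrand x <= (hr w + e)%:E)%E].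
  suff /choice[g Hg] : forall w, exists c, w \in words n -> exists x,
    [/\ cell w x, c = f x & (KSintegrand x <= (hr w + e)%:E)%E] by exists g.
  move=> w; have [wn|] := boolP (w \in words n); last by exists 0.
  have : (h w < (hr w + e)%:E)%E by rewrite hrE// lte_fin ltrDl.
  by move=> /ereal_inf_lt[_ [x wx <-] /ltW Hx]; exists (f x) => _; exists x.
exists g; first by move=> w /Hg[x [wx gx _]]; exists x.
pose D w := M * rpa * (hr w + e).
have D0 w : 0 <= D w by rewrite !mulr_ge0 ?addr_ge0// ltW.
have IoscD w w' : w \in words n -> w' \in words n -> touching w w' ->
    Iosc f w' (g w) <= D w.
  move=> wn w'n ww'; have [x [wx -> Hx]] := Hg w wn.
  have := le_trans (below w w' x wn w'n ww' wx) Hx; rewrite lee_fin.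
  by rewrite ler_pdivrMl// ler_pdivrMl// /D mulrCA mulrA.
have D_sum : \sum_(w <- words n) D w <= M * rpa * (3 ^+ n * (9 * E + e)).
  rewrite -mulr_sumr ler_pM2l ?mulr_gt0// big_split /= sum_words_const.
  rewrite mulrDr lerD2r (_ : 3 ^+ n * (9 * E) = 9 * 3 ^+ n * E); last by ring.
  by apply: lowersum => // w x wn wx; rewrite -hrE// h_le.
apply: (@le_trans _ _ ((1 + 18 * kap) * \sum_(w <- words n) D w)); last first.
  rewrite (_ : _ * rpa * _ = (1 + 18 * kap) * (M * rpa * (3 ^+ n * (9 * E + e))));
    last by ring.
  by rewrite ler_pM2l// addr_gt0 ?mulr_gt0.
have S1 : \sum_(w <- words n) Iosc f w (g w) <= \sum_(w <- words n) D w.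
  rewrite big_seq [leRHS]big_seq; apply: ler_sum => w wn.
  by apply: IoscD => //; exact: touching_refl.
have S2 : 3 ^- n * gradient n g <= kap * (9 * \sum_(w <- words n) D w +
    9 * \sum_(w <- words n) D w).
  have := lerD (sum_near_le hq n D0) (sum_near_const_le hq n D0).
  rewrite -(ler_pM2l k0); apply: le_trans.
  rewrite /gradient mulr_sumr -big_split mulr_sumr /=.
  rewrite big_seq [leRHS]big_seq; apply: ler_sum => w wn.
  rewrite mulr_sumr -big_split mulr_sumr /=.
  rewrite big_seq_cond [leRHS]big_seq_cond; apply: ler_sum => w' /andP[w'n ww'].
  have := pw_le_Iosc hK hmu hp hf w' (g w) (g w').
  rewrite (szw w' w'n) => /le_trans; apply; rewrite ler_pM2l// lerD//.
    by apply: IoscD => //; exact: touching_refl.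
  exact: IoscD.
rewrite /oscillation; move: S1 S2.
set X1 := \sum_(w <- words n) Iosc f w (g w); set X2 := \sum_(w <- words n) D w.
set X3 := 3 ^- n * gradient n g; lra.
Qed.

End ball_averages_below.

(** * Choice of levels *)

(** A ball of such a radius is covered by touching cells of level [N - 2] and
   contains touching cells of level [N + 4]. Large radii have level 0; then the
   truncated difference [N - 2] stands for the whole gasket. *)
Definition radius_level (rho : R) (N : nat) :=
  2^-1 ^+ N.+1 < rho /\ (N = 0%N \/ rho <= 2^-1 ^+ N).

Lemma exists_radius_level (rho : R) : 0 < rho -> exists N, radius_level rho N.
Proof.
move=> rho0.
have [n Hn] : exists n, 2^-1 ^+ n < rho.
  apply: contrapT => /forallNP Hn.
  suff : rho <= 0 by lra.
  apply: (@geometric_le0 _ _ 1 2^-1); first by apply/andP; split; lra.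
  by move=> n; rewrite mul1r leNgt; apply/negP/Hn.
elim: n Hn => [|n IH] Hn.
  exists 0%N; split; last by left.
  by apply: le_lt_trans Hn; rewrite expr1 expr0; lra.
have [/IH//|Hn'] := ltP (2^-1 ^+ n) rho.
by exists n; split=> //; right.
Qed.

Lemma geoball_cover_level rho N w x y : radius_level rho N ->
  w \in words (N - 2) -> cell w x -> geoball K x rho y ->
  exists w', [/\ w' \in words (N - 2), touching w w' & cell w' y].
Proof.
move=> [_ HN] wn wx Bxy; have wn' : size w = (N - 2)%N.
  by apply/eqP; rewrite -mem_words.
have [N2|N2] := leqP N 2.
  have N20 : (N - 2 = 0)%N by lia.
  exists [::]; rewrite N20 in wn' *; split=> //.
    by case: w wn' {wn wx} => // _; exact: touching_refl.
  by rewrite cell_nil; case: Bxy.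
apply: (geoball_near_cover hq hK wn' wx _ Bxy).
case: HN => [N0|]; first by rewrite N0 in N2.
have : 2^-1 ^+ N = 2^-1 ^+ (N - 2) * 2^-1 ^+ 2 :> R.
  by rewrite -exprD subnK// ltnW.
rewrite expr2; set X := 2^-1 ^+ (N - 2); lra.
Qed.

Lemma cover_geoball_level rho N w w' x y : radius_level rho N ->
  w \in words (N + 4) -> w' \in words (N + 4) -> touching w w' ->
  cell w x -> cell w' y -> geoball K x rho y.
Proof.
move=> [HN _]; rewrite !mem_words => /eqP wn /eqP w'n ww' wx w'y.
apply: (near_sub_geoball hq hK _ ww' wx w'y); first by rewrite wn w'n.
apply: le_lt_trans HN; rewrite wn exprD exprS.
have : 0 < 2^-1 ^+ N :> R by rewrite exprn_gt0.
rewrite !exprS expr0; move: (2^-1 ^+ N) => X; lra.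
Qed.

Lemma measure_geoball_level rho N x : radius_level rho N -> K x ->
  ((3 ^- (N + 4))%:E <= mu (geoball K x rho) <= (9 * 3 ^- (N - 2))%:E)%E.
Proof.
move=> hN Kx; have mB := measurable_geoball hq hK x rho.
apply/andP; split.
  have [w wn wx] := gasket_cover hK (N + 4) Kx.
  have sw : size w = (N + 4)%N by apply/eqP; rewrite -mem_words.
  rewrite -sw -(mu_cell hmu); apply: le_measure; rewrite ?inE//.
    exact: (measurable_cell hK).
  by move=> y wy; apply: (cover_geoball_level hN wn wn _ wx wy); exact: touching_refl.
have [w wn wx] := gasket_cover hK (N - 2) Kx.
have sw : size w = (N - 2)%N by apply/eqP; rewrite -mem_words.
have B1 : mu (geoball K x rho) = (\int[mu]_(y in geoball K x rho) (cst 1 y))%E.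
  by rewrite integral_cst// mul1e.
rewrite B1.
have := @le_lower_integral_cover _ _ _ mu _
  [seq w' <- words (N - 2) | touching w w'] (geoball K x rho) (cst 1%E) cell
  (fun=> cst 1%E).
move=> /(_ (fun _ _ => lee01) (measurable_cell hK)) H.
apply: (@le_trans _ _ (\sum_(w' <- [seq w' <- words (N - 2) | touching w w'])
   \int[mu]_(y in cell w') (cst 1 y))%E).
  apply: H => // y By; have [w' [w'n ww' w'y]] := geoball_cover_level hN wn wx By.
  by exists w'; split=> //; rewrite mem_filter ww'.
rewrite big_filter big_seq_cond (eq_bigr (fun=> (3 ^- (N - 2))%:E)); last first.
  move=> w' /andP[]; rewrite mem_words => /eqP w'n _.
  by rewrite integral_cst ?mul1e ?(mu_cell hmu) ?w'n//; exact: (measurable_cell hK).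
rewrite -big_seq_cond sumEFin lee_fin big_const_seq iter_addr_0 -[leLHS]mulr_natl.
apply: ler_wpM2r; first by rewrite invr_ge0 exprn_ge0.
by rewrite ler_nat; exact: (near_count hq).
Qed.

(** The constants of this comparison and of the next one depend on [p] only,
   since balls and cells of nearby levels have comparable measures. *)
Lemma KSenergy_le : exists2 C, 0 < C & forall f, Lp K mu p f ->
  forall alpha rho N g, 0 < rho -> radius_level rho N ->
  (KSenergy K mu p alpha f rho <=
    (C / rho `^ (p * alpha) * oscillation f (N - 2) g)%:E)%E.
Proof.
exists (18 * kap ^+ 2 * 3 ^+ 6); first by rewrite !mulr_gt0 ?exprn_gt0.
move=> f hf alpha rho N g rho0 hN.
have m0 : 0 < 3 ^- (N + 4) :> R by rewrite invr_gt0 exprn_gt0.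
have H := KSenergy_le_oscillation hq hK hmu hp hf alpha rho0 (n := (N - 2)%N) g m0.
apply: (le_trans (H _ _)).
- by move=> x Kx; case/andP: (measure_geoball_level hN Kx).
- by move=> w x y wn wx; exact: geoball_cover_level hN wn wx.
rewrite lee_fin ler_wpM2r ?(oscillation_ge0 hK hmu hp hf)//.
rewrite ler_pM2r ?invr_gt0 ?powR_gt0// ler_pM2l ?mulr_gt0 ?exprn_gt0// invrK.
rewrite ler_pdivrMr ?exprn_gt0// -exprD.
by rewrite ler_weXn2l ?ler1n//; lia.
Qed.

Lemma oscillation_le : exists2 C, 0 < C & forall f, Lp K mu p f ->
  forall alpha rho N (E e : R), 0 < rho -> radius_level rho N -> 0 < e ->
  (KSenergy K mu p alpha f rho <= E%:E)%E ->
  exists2 g, (forall w, w \in words (N + 4) -> exists2 x, cell w x & g w = f x) &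
    oscillation f (N + 4) g <= C * rho `^ (p * alpha) * (E + e).
Proof.
exists ((1 + 18 * kap) * (9 * 3 ^+ 6) * 9).
  by rewrite !mulr_gt0 ?exprn_gt0 ?addr_gt0 ?mulr_gt0.
move=> f hf alpha rho N E e rho0 hN e0 HE.
have M0 : 0 < 9 * 3 ^- (N - 2) :> R by rewrite mulr_gt0// invr_gt0 exprn_gt0.
have e90 : 0 < 9 * e by rewrite mulr_gt0.
have [||g Hg1 Hg2] := @oscillation_le_KSenergy f hf alpha rho rho0 (N + 4)
    _ E _ M0 e90 _ _ HE.
- by move=> x Kx; case/andP: (measure_geoball_level hN Kx).
- by move=> w w' x y; exact: cover_geoball_level.
exists g => //; apply: (le_trans Hg2).
have Ee0 : 0 <= E + e.
  rewrite addr_ge0 ?(ltW e0)// -lee_fin (le_trans _ HE)//.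
  by apply: integral_ge0 => x _; exact: KSintegrand_ge0.
have -> : (1 + 18 * kap) * (9 * 3 ^+ 6) * 9 * rho `^ (p * alpha) * (E + e) =
  (1 + 18 * kap) * (9 * 3 ^+ 6) * rho `^ (p * alpha) * (9 * E + 9 * e) by ring.
apply: ler_wpM2r; first by lra.
rewrite ler_pM2r ?powR_gt0// ler_pM2l ?addr_gt0 ?mulr_gt0// -mulrA ler_pM2l//.
rewrite ler_pdivrMl ?exprn_gt0// -exprD.
by rewrite ler_weXn2l ?ler1n//; lia.
Qed.

End energy_comparison_below.

(** * Monotonicity in the radius and the critical exponent *)

(** The energy at a radius of level [N] is bounded by the oscillation at level
   [N - 2], and the energy at a radius of level [N'] bounds the oscillation at
   level [N' + 4]. *)
Lemma level_gap N N' : (N < N')%N -> exists j, (N - 2 + j = N' + 4)%N.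
Proof. by move=> ?; exists (N' + 4 - (N - 2))%N; lia. Qed.

Lemma level_gap_le N N' j : (N - 2 + j = N' + 4)%N -> (N.+1 + j <= N' + 8)%N.
Proof. lia. Qed.

Lemma level_lag N : (N.+1 <= N - 2 + 3)%N.
Proof. lia. Qed.

Lemma limf_einf_ge (R : realType) (f : R -> \bar R) (y : \bar R) (d : R) :
  0 < d -> (forall x, 0 < x < d -> (y <= f x)%E) -> (y <= limf_einf f 0^'+)%E.
Proof.
move=> d0 H; rewrite limf_einfE.
apply: (@le_trans _ _ (ereal_inf (f @` [set x | 0 < x < d]))).
  by apply: le_ereal_inf_tmp => _ [x xd <-]; exact: H.
apply: ereal_sup_ubound; exists [set x | 0 < x < d] => //.
near=> x; rewrite /= ; apply/andP; split; near: x.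
  exact: nbhs_right_gt.
exact: nbhs_right_lt.
Unshelve. all: by end_near. Qed.

Lemma limf_einf_le (R : realType) (f : R -> \bar R) (y : \bar R) :
  (forall x, 0 < x -> (f x <= y)%E) -> (limf_einf f 0^'+ <= y)%E.
Proof.
move=> H; rewrite limf_einfE; apply: ge_ereal_sup => _ [V /= V0 <-].
have [x [Vx x0]] : exists x, V x /\ 0 < x.
  have : (0 : R)^'+ (V `&` [set x | 0 < x]) by apply: filterI => //; exact: nbhs_right_gt.
  by move=> /filter_ex[x [Vx x0]]; exists x.
by apply: le_trans (H x x0); apply: ereal_inf_lbound; exists x.
Qed.

Lemma limf_esup_le_sup (R : realType) (f : R -> \bar R) :
  (limf_esup f 0^'+ <= ereal_sup [set f x | x in [set x : R | (0 < x)%R]])%E.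
Proof.
rewrite limf_esupE; apply: ereal_inf_lbound.
exists [set x | 0 < x] => //=; exact: nbhs_right_gt.
Qed.

Section critical.
Variables (R : realType) (q : 'I_3 -> plane R).
Hypothesis hq : unit_equilateral q.
Variable K : set (plane R).
Hypothesis hK : is_gasket q K.
Variable mu : {measure set (borel_plane R) -> \bar R}.
Hypothesis hmu : is_gasket_measure q K mu.
Variable p : R.
Hypothesis hp : 1 <= p.
Local Notation pw := (pw p).
Local Notation kap := (kap p).
Local Notation Iosc := (Iosc q K mu p).
Local Notation oscillation := (oscillation q K mu p).
Implicit Types (w : seq 'I_3) (g : seq 'I_3 -> R) (f : plane R -> R).
Variable r : R.
Hypothesis hr : scaling p r.

Let r_gt0 : 0 < r. Proof. by case: hr. Qed.
Let p_gt0 : 0 < p. Proof. exact: lt_le_trans hp. Qed.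
Let k0 : 0 < kap. Proof. exact: kap_gt0. Qed.

Let theta : R := r / 3.

Let theta_gt0 : 0 < theta. Proof. by rewrite divr_gt0. Qed.

Let theta_le : theta <= 3^-1.
Proof. by rewrite /theta ler_pdivrMr// mulVf// (scaling_le1 hp hr). Qed.

Let theta_le1 : theta <= 1. Proof. by apply: (le_trans theta_le); lra. Qed.

Let thetaV : 3 / r = theta^-1. Proof. by rewrite /theta invf_div. Qed.

(** The exponent at which [rho `^ (p * alpha)] scales as the oscillation. *)
Definition dim_exponent : R := ln (3 / r) / (p * ln 2).

Lemma dim_exponentE : 2^-1 `^ (p * dim_exponent) = theta.
Proof.
have l2 : 0 < ln 2 :> R by rewrite ln_gt0// ltr1n.
have -> : p * dim_exponent = ln (3 / r) / ln 2.
  by rewrite /dim_exponent; field; rewrite !gt_eqF.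
rewrite /powR ifF; last by apply/negbTE; rewrite invr_neq0.
rewrite lnV ?posrE// mulrN divfK ?gt_eqF// thetaV lnV ?posrE// opprK lnK//.
Qed.

Lemma dim_exponent_gt0 : 0 < dim_exponent.
Proof.
rewrite /dim_exponent divr_gt0 ?mulr_gt0 ?ln_gt0 ?ltr1n//.
by rewrite thetaV -[ltLHS]invr1 ltf_pV2 ?posrE//; apply: le_lt_trans theta_le _; lra.
Qed.

Lemma radius_powR_ge rho N alpha : 0 < rho -> 0 <= alpha -> radius_level rho N ->
  (2^-1 `^ (p * alpha)) ^+ N.+1 <= rho `^ (p * alpha).
Proof.
move=> rho0 al0 [h _]; rewrite -powR_exprn ?invr_ge0//; apply: ge0_ler_powR.
- by rewrite mulr_ge0// ltW.
- by rewrite nnegrE exprn_ge0 ?invr_ge0.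
- by rewrite nnegrE ltW.
- exact: ltW.
Qed.

Lemma radius_powR_le rho N alpha : 0 < rho -> 0 <= alpha -> rho <= 2^-1 ^+ N ->
  rho `^ (p * alpha) <= (2^-1 `^ (p * alpha)) ^+ N.
Proof.
move=> rho0 al0 h; rewrite -powR_exprn ?invr_ge0//; apply: ge0_ler_powR => //.
- by rewrite mulr_ge0// ltW.
- by rewrite nnegrE ltW.
- by rewrite nnegrE exprn_ge0 ?invr_ge0.
Qed.

Lemma radius_level_small (rho : R) (N k : nat) : radius_level rho N -> rho < 2^-1 ^+ k.+1 ->
  (k < N)%N /\ rho <= 2^-1 ^+ N.
Proof.
move=> [h1 h2] rhok.
have kN : (k < N)%N.
  rewrite ltnNge; apply/negP => Nk.
  have := lt_trans h1 rhok; rewrite ltNge => /negP; apply.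
  rewrite ler_wiXn2l// ?invr_ge0//; by rewrite invf_le1//; lra.
by split=> //; case: h2 => [N0|//]; rewrite N0 ltn0 in kN.
Qed.

Lemma KSenergy_ge0 f alpha rho : 0 < rho -> (0 <= KSenergy K mu p alpha f rho)%E.
Proof. by move=> h; apply: integral_ge0 => x _; exact: KSintegrand_ge0. Qed.

(** Oscillations at two levels are compared by weak monotonicity, and the powers
   of the two radii compensate the factor [(3 / r) ^+ j] up to boundedly many
   levels. *)
Lemma KSenergy_weak_mono : exists2 C, 0 < C & forall f, Lp K mu p f ->
  forall rho, 0 < rho -> exists2 d, 0 < d & forall rho', 0 < rho' < d ->
  (KSenergy K mu p dim_exponent f rho <=
     C%:E * KSenergy K mu p dim_exponent f rho')%E.
Proof.
have [C1 C10 H1] := KSenergy_le hq hK hmu hp.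
have [C2 C20 H2] := oscillation_le hq hK hmu hp.
have [C3 C30 H3] := oscillation_weak_mono hq hK hmu hp hr.
pose C := C1 * C3 * C2 / theta ^+ 8.
have C0 : 0 < C by rewrite divr_gt0 ?mulr_gt0 ?exprn_gt0.
exists C => // f hf rho rho0; have [N hN] := exists_radius_level rho0.
exists (2^-1 ^+ N.+1); first by rewrite exprn_gt0 ?invr_gt0.
move=> rho' /andP[rho'0 rho'd].
have [N' hN'] := exists_radius_level rho'0.
have [NN' rho'le] := radius_level_small hN' rho'd.
have al0 := ltW dim_exponent_gt0.
have := KSenergy_ge0 f dim_exponent rho'0.
case E' : (KSenergy _ _ _ _ _ rho') => [E| |]//; last first.
  by move=> _; rewrite gt0_muley ?lte_fin// leey.
rewrite lee_fin => E0.
have key e : 0 < e -> (KSenergy K mu p dim_exponent f rho <= (C * (E + e))%:E)%E.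
  move=> e0; have [g _ Hg] := H2 f hf dim_exponent rho' N' E e rho'0 hN' e0
    (eq_ind_r (fun x => (x <= E%:E)%E) (lexx _) E').
  have [j Hj] : exists j, ((N - 2) + j = N' + 4)%N.
    exact: level_gap.
  have := H3 f hf (N - 2)%N j g; rewrite Hj => -[g' Hg'].
  apply: (le_trans (H1 f hf dim_exponent rho N g' rho0 hN)).
  rewrite lee_fin.
  have P0 : 0 < rho `^ (p * dim_exponent) by rewrite powR_gt0.
  have := radius_powR_ge rho0 al0 hN; have := radius_powR_le rho'0 al0 rho'le.
  rewrite !dim_exponentE => h1 h2.
  have T n : 0 < theta ^+ n by rewrite exprn_gt0.
  apply: (@le_trans _ _ (C1 / theta ^+ N.+1 *
     (C3 * theta ^- j * (C2 * theta ^+ N' * (E + e))))).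
    apply: ler_pM.
    - by rewrite divr_ge0 ?powR_ge0// ltW.
    - exact: (oscillation_ge0 hK hmu hp hf).
    - by rewrite ler_pM2l// lef_pV2 ?posrE.
    apply: (le_trans Hg'); rewrite thetaV exprVn ler_pM2l; last first.
      by rewrite mulr_gt0 ?invr_gt0.
    apply: (le_trans Hg); rewrite ler_pM2r; last by rewrite ltr_wpDl.
    by rewrite ler_pM2l.
  rewrite (_ : C1 / theta ^+ N.+1 * _ = C1 * C3 * C2 *
     (theta ^+ N' / (theta ^+ N.+1 * theta ^+ j)) * (E + e)); last first.
    by field; rewrite !gt_eqF.
  rewrite ler_pM2r ?ltr_wpDl// /C ler_pM2l ?mulr_gt0//.
  rewrite ler_pdivrMr ?mulr_gt0// mulrC ler_pdivlMr// -!exprD.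
  by apply: ler_wiXn2l (level_gap_le Hj) => //; exact: ltW.
rewrite -EFinM; apply/lee_addgt0Pr => e e0.
have eC : 0 < e / C by rewrite divr_gt0.
have := key _ eC; rewrite mulrDr (mulrC C (e / C)) divfK ?gt_eqF//.
Qed.

(** The radius on the left is arbitrary, and the one on the right tends to 0. *)
Lemma KSenergy_sup_le_inf : exists2 C, 1 <= C & forall f, Lp K mu p f ->
  (supKSenergy K mu p dim_exponent f <=
     C%:E * limf_einf (KSenergy K mu p dim_exponent f) 0^'+)%E.
Proof.
have [C C0 HC] := KSenergy_weak_mono.
have M0 : 0 < Num.max 1 C by rewrite lt_max ltr01.
exists (Num.max 1 C); first by rewrite le_max lexx.
move=> f hf; apply: ge_ereal_sup => _ [rho /= rho0 <-].
have [d d0 Hd] := HC f hf rho rho0.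
rewrite -lee_pdivrMl//; apply: (limf_einf_ge d0) => rho' rho'd.
rewrite lee_pdivrMl//; apply: (le_trans (Hd rho' rho'd)).
apply: lee_wpmul2r; first by apply: KSenergy_ge0; case/andP: rho'd.
by rewrite lee_fin le_max lexx orbT.
Qed.

Lemma KSenergy_bounded : exists2 C1, 0 < C1 & forall f C, Lp K mu p f -> 0 <= C ->
  (forall n, exists g, oscillation f n g <= C * theta ^+ n) ->
  forall rho, 0 < rho -> (KSenergy K mu p dim_exponent f rho <= (C1 * C)%:E)%E.
Proof.
have [C1 C10 H1] := KSenergy_le hq hK hmu hp.
exists (C1 / theta ^+ 3); first by rewrite divr_gt0// exprn_gt0.
move=> f C hf C0 H rho rho0.
have [N hN] := exists_radius_level rho0; have [g Hg] := H (N - 2)%N.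
apply: (le_trans (H1 f hf dim_exponent rho N g rho0 hN)); rewrite lee_fin.
have := radius_powR_ge rho0 (ltW dim_exponent_gt0) hN; rewrite dim_exponentE => h2.
have T n : 0 < theta ^+ n by rewrite exprn_gt0.
apply: (@le_trans _ _ (C1 / theta ^+ N.+1 * (C * theta ^+ (N - 2)))).
  apply: ler_pM => //.
  - by rewrite divr_ge0 ?powR_ge0// ltW.
  - exact: (oscillation_ge0 hK hmu hp hf).
  - by rewrite ler_pM2l// lef_pV2 ?posrE ?powR_gt0.
rewrite mulrACA [leRHS]mulrAC; apply: ler_wpM2l; first by rewrite mulr_ge0// ltW.
rewrite mulrC ler_pdivrMr// mulrC ler_pdivlMr// -exprD.
by apply: ler_wiXn2l; rewrite ?(ltW theta_gt0) ?level_lag.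
Qed.

Lemma Besov_of_oscillation f C : Lp K mu p f -> 0 <= C ->
  (forall n, exists g, oscillation f n g <= C * theta ^+ n) ->
  Besov K mu p dim_exponent f.
Proof.
move=> hf C0 H; split=> //; have [C1 C10 H1] := KSenergy_bounded.
apply: (@le_lt_trans _ _ (C1 * C)%:E); last exact: ltry.
by apply: ge_ereal_sup => _ [rho /= rho0 <-]; exact: H1.
Qed.

(** * Supercritical exponents *)

(** The constants that approximate [f] stay bounded, and any of their limits is
   the value of [f]. *)
Lemma ae_constant_of_Iosc f : Lp K mu p f ->
  (forall e, 0 < e -> exists c, Iosc f [::] c <= e) -> ae_constant K mu f.
Proof.
move=> hf H.
have e_gt0 n : 0 < n.+1%:R^-1 :> R by rewrite invr_gt0.
have /choice[c Hc] n := H _ (e_gt0 n).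
have I0 w x : 0 <= Iosc f w x by exact: (Iosc_ge0 hK hmu hp hf).
have diff x y : pw (y - x) <= kap * (Iosc f [::] y + Iosc f [::] x).
  by have := pw_le_Iosc hK hmu hp hf [::] x y; rewrite /= expr0 invr1 mul1r.
pose B : R := (kap * (1 + 1)) `^ p^-1.
have Hc1 n : Iosc f [::] (c n) <= 1.
  by rewrite (le_trans (Hc n))// invf_le1// ler1n.
have cB n (_ : unit) : `[c 0%N - B, c 0%N + B]%classic (c n).
  have k2 : 0 <= kap * (1 + 1) by rewrite mulr_ge0 ?addr_ge0// ltW.
  have : `|c n - c 0%N| <= B.
    apply: (pw_root hp) => //; apply: (le_trans (diff _ _)).
    by rewrite ler_pM2l// lerD.
  by rewrite /= in_itv /= ler_norml => /andP[h1 h2]; apply/andP; split; lra.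
have [U [l [PU ooU _ cvg]]] := pointwise_ultralimit
  (fun _ : unit => @segment_compact R (c 0%N - B) (c 0%N + B)) cB.
pose x := l tt; have cx := cvg tt; rewrite -/x /= in cx.
have Ix : Iosc f [::] x = 0.
  apply/eqP; rewrite eq_le I0 andbT; apply/ler_addgt0Pr => e e0; rewrite add0r.
  pose d : R := (e / (2 * kap)) `^ p^-1.
  have ek : 0 < e / (2 * kap) by rewrite divr_gt0 ?mulr_gt0.
  have d0 : 0 < d by rewrite powR_gt0.
  have [n0 Hn0] : exists n0 : nat, (e / (2 * kap))^-1 < n0%:R.
    by exists (Num.truncn (e / (2 * kap))^-1).+1; exact: truncnS_gt.
  have near1 : \forall n \near U, `|x - c n| < d by exact: cvgr_dist_lt.
  have near2 : \forall n \near U, (n0 <= n)%N by apply: ooU; exists n0.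
  have [n [h1 h2]] := filter_ex (filterI near1 near2).
  apply: (le_trans (Iosc_shift hK hmu hp hf [::] x (c n))).
  rewrite /= expr0 invr1 mul1r.
  have p1 : pw (c n - x) <= e / (2 * kap).
    have -> : e / (2 * kap) = pw d.
      by rewrite /pw ger0_norm ?powR_ge0// -powRrM mulVf ?gt_eqF// powRr1// ltW.
    by apply: (ler_pw hp); rewrite distrC (ger0_norm (ltW d0)) ltW.
  have p2 : Iosc f [::] (c n) <= e / (2 * kap).
    apply: (le_trans (Hc n)); rewrite -[leRHS]invrK lef_pV2 ?posrE ?invr_gt0//.
    by rewrite (le_trans (ltW Hn0))// ler_nat; exact: leq_trans h2 _.
  rewrite (_ : e = kap * (e / (2 * kap) + e / (2 * kap))).
    by rewrite ler_pM2l// lerD.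
  by field; rewrite gt_eqF.
exists x.
have mK := measurable_gasket hK.
have mpw := measurable_pw_diff hK hf x mK (@subset_refl _ K).
have /(ae_eq_integral_abs mu mK mpw) : (\int[mu]_(y in K) `|(pw (f y - x))%:E| = 0)%E.
  transitivity (\int[mu]_(y in K) (pw (f y - x))%:E)%E.
    by apply: eq_integral => y _; rewrite gee0_abs// lee_fin pw_ge0.
  by have := IoscE hK hmu hp hf [::] x; rewrite Ix cell_nil.
apply: filterS => y Hy Ky; have := Hy Ky; rewrite /= => -[] /(pw_eq0 ).
by move=> /eqP; rewrite subr_eq0 => /eqP.
Qed.

(** Coarsening from level [N] to the whole gasket costs a factor [(3 / r) ^+ N],
   which the decay of [rho `^ (p * alpha)] exceeds. *)
Lemma Besov_supercritical f alpha : dim_exponent < alpha ->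
  Besov K mu p alpha f -> ae_constant K mu f.
Proof.
move=> hal [hf]; have al0 : 0 <= alpha.
  by rewrite (le_trans _ (ltW hal))// ltW// dim_exponent_gt0.
case ES : (supKSenergy K mu p alpha f) => [S| |]//; last first.
  move: (@KSenergy_ge0 f alpha 1 ltr01).
  have : (KSenergy K mu p alpha f 1 <= -oo)%E.
    by rewrite -ES; apply: ereal_sup_ubound; exists 1 => //=.
  by rewrite leeNy_eq => /eqP ->.
move=> _.
have SE rho : 0 < rho -> (KSenergy K mu p alpha f rho <= S%:E)%E.
  by move=> h; rewrite -ES; apply: ereal_sup_ubound; exists rho.
have S0 : 0 <= S.
  by rewrite -lee_fin (le_trans _ (SE 1 ltr01))// KSenergy_ge0.
have [C2 C20 H2] := oscillation_le hq hK hmu hp.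
have [C3 C30 H3] := oscillation_weak_mono hq hK hmu hp hr.
pose th := 2^-1 `^ (p * alpha).
have th0 : 0 < th by rewrite powR_gt0.
have thth : th < theta.
  rewrite -dim_exponentE /th /powR !ifF ?invr_eq0 ?pnatr_eq0//.
  rewrite ltr_expR ltr_nM2r ?ltr_pM2l// ln_lt0//.
  by rewrite invr_gt0 ltr0n /= invf_lt1//; lra.
pose M := C3 / theta ^+ 4 * (C2 * (S + 1)).
have M0 : 0 < M by rewrite !mulr_gt0 ?invr_gt0 ?exprn_gt0// ltr_wpDl.
have bound N : exists c, Iosc f [::] c <= M * (th / theta) ^+ N.
  have rho0 : 0 < 2^-1 ^+ N :> R by rewrite exprn_gt0 ?invr_gt0.
  have hN : radius_level (2^-1 ^+ N : R) N.
    by split; [rewrite exprS; lra|right].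
  have [g _ Hg] := H2 f hf alpha _ N S 1 rho0 hN ltr01 (SE _ rho0).
  have [g' Hg'] := H3 f hf 0%N (N + 4)%N g.
  exists (g' [::]).
  have : Iosc f [::] (g' [::]) <= oscillation f 0 g'.
    by rewrite /oscillation sum_words0 lerDl gradient_term_ge0.
  move/le_trans; apply; apply: (le_trans Hg'); rewrite add0n thetaV.
  rewrite powR_exprn ?invr_ge0// -/th in Hg.
  apply: (@le_trans _ _ (C3 * theta^-1 ^+ (N + 4) * (C2 * th ^+ N * (S + 1)))).
    by rewrite ler_pM2l// mulr_gt0// exprn_gt0// invr_gt0.
  rewrite le_eqVlt; apply/orP; left; apply/eqP.
  rewrite /M exprVn exprD (expr_div_n th theta) invfM.
  by move: (theta ^+ N)^-1 (theta ^+ 4)^-1 (th ^+ N) => x y z; ring.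
apply: (ae_constant_of_Iosc hf) => e e0.
have z1 : 0 <= th / theta < 1.
  by rewrite divr_ge0 ?ltW//= ltr_pdivrMr// mul1r.
have [N HN] : exists N, M * (th / theta) ^+ N < e.
  apply: contrapT => /forallNP Hn.
  have : e <= 0.
    by apply: (geometric_le0 z1) => n; rewrite leNgt; apply/negP/Hn.
  by rewrite leNgt e0.
have [c Hc] := bound N; exists c; apply: (le_trans Hc); exact: ltW.
Qed.

Lemma critical_exponentE :
  (exists f, Besov K mu p dim_exponent f /\ ~ ae_constant K mu f) ->
  critical_exponent K mu p = dim_exponent.
Proof.
move=> Hf; rewrite /critical_exponent; set S := [set _ | _].
have Sd : S dim_exponent by split=> //; exact: ltW dim_exponent_gt0.
have Sub : ubound S dim_exponent.
  move=> a [a0 [f [Bf ncf]]]; rewrite leNgt; apply/negP => da.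
  exact: ncf (Besov_supercritical da Bf).
apply/eqP; rewrite eq_le; apply/andP; split.
  by apply: ge_sup => //; exists dim_exponent.
by apply: ub_le_sup => //; exists dim_exponent.
Qed.

Lemma propertyP_of_nonconstant :
  (exists f, Besov K mu p dim_exponent f /\ ~ ae_constant K mu f) ->
  propertyP K mu p dim_exponent.
Proof.
move=> [f [[hf Bf] ncf]]; split.
  exists f; split=> //; split=> //; apply: le_lt_trans Bf.
  exact: limf_esup_le_sup.
have [C C1 HC] := KSenergy_sup_le_inf.
by exists C; split=> // g [hg _]; exact: HC.
Qed.

End critical.

(** * Oscillations of continuous functions *)

Section continuous_functions.
Variables (R : realType) (q : 'I_3 -> plane R).
Hypothesis hq : unit_equilateral q.
Variable K : set (plane R).
Hypothesis hK : is_gasket q K.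
Variable mu : {measure set (borel_plane R) -> \bar R}.
Hypothesis hmu : is_gasket_measure q K mu.
Variable p : R.
Hypothesis hp : 1 <= p.
Local Notation pw := (pw p).
Local Notation kap := (kap p).
Local Notation Psi := (Psi q).
Local Notation cell := (cell q K).
Local Notation Iosc := (Iosc q K mu p).
Local Notation oscillation := (oscillation q K mu p).
Local Notation senergy := (senergy p q).
Implicit Types (w v : seq 'I_3) (u : plane R -> R).
Variable r : R.
Hypothesis hr : scaling p r.

Let r_gt0 : 0 < r. Proof. by case: hr. Qed.
Let p_gt0 : 0 < p. Proof. exact: lt_le_trans hp. Qed.

(** Uniform continuity on a compact set, in terms of cells instead of distances. *)
Lemma uniform_on_cells u : {within K, continuous u} -> forall e, 0 < e ->
  exists k, forall w x y, (k <= size w)%N -> cell w x -> cell w y ->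
    `|u x - u y| <= e.
Proof.
move=> /within_continuousP cu e e0; apply: contrapT => /forallNP H.
have [M M0 HM] := bounded_gasket hK.
have diam k w x y : (k <= size w)%N -> cell w x -> cell w y ->
    `|x - y| <= (2 * M) * 2^-1 ^+ k.
  move=> kw [x' Kx' <-] [y' Ky' <-]; rewrite norm_Psi mulrC.
  apply: ler_pM; rewrite ?exprn_ge0 ?invr_ge0//.
    have := HM _ Kx'; have := HM _ Ky'; have := ler_normB x' y'; lra.
  by apply: ler_wiXn2l => //; rewrite ?invr_ge0 ?invf_le1//; lra.
have /choice[F HF] : forall k, exists xy : plane R * plane R,
    [/\ K xy.1, K xy.2, `|xy.1 - xy.2| <= (2 * M) * 2^-1 ^+ k &
     e < `|u xy.1 - u xy.2|].
  move=> k; have /existsNP[w /existsNP[x /existsNP[y]]] := H k.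
  move=> /not_implyP[kw /not_implyP[wx /not_implyP[wy]]] /negP.
  rewrite -ltNge => exy; exists (x, y); split=> //=.
  - exact: (cell_sub hK) wx.
  - exact: (cell_sub hK) wy.
  - exact: (diam k w).
have KF1 k (_ : unit) : K (F k).1 by case: (HF k).
have cK (_ : unit) : compact K by case: hK.
have [U [l [PU ooU Kl cvg]]] := pointwise_ultralimit cK KF1.
have {}Kl := Kl tt; have {}cvg := cvg tt.
have e20 : 0 < e / 2 by rewrite divr_gt0.
have [d d0 Hd] := cu _ Kl (e / 2) e20.
have d20 : 0 < d / 2 by rewrite divr_gt0.
have [m0 Hm0] : exists k, (2 * M) * 2^-1 ^+ k < d / 2.
  apply: contrapT => /forallNP Hn.
  have : d / 2 <= 0.
    apply: (@geometric_le0 _ _ (2 * M) 2^-1); first by apply/andP; split; lra.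
    by move=> n; rewrite leNgt; apply/negP/Hn.
  by rewrite leNgt d20.
have near1 : \forall n \near U, `|l tt - (F n).1| < d / 2 by exact: cvgr_dist_lt.
have near2 : \forall n \near U, (m0 <= n)%N by apply: ooU; exists m0.
have [n [h1 h2]] := filter_ex (filterI near1 near2).
have [KF K2 F12 Fe] := HF n.
have F12' : `|(F n).1 - (F n).2| < d / 2.
  apply: (le_lt_trans F12); apply: le_lt_trans Hm0; apply: ler_wpM2l.
    by rewrite mulr_ge0.
  by apply: ler_wiXn2l => //; rewrite ?invr_ge0 ?invf_le1//; lra.
have H1 : `|u (l tt) - u (F n).1| < e / 2.
  by apply: Hd => //; apply: (lt_trans h1); lra.
have H2 : `|u (l tt) - u (F n).2| < e / 2.
  apply: Hd => //.
  rewrite (_ : l tt - _ = (l tt - (F n).1) + ((F n).1 - (F n).2)).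
    by apply: (le_lt_trans (ler_normD _ _)); move: h1 F12' => h1 F12'; lra.
  by rewrite addrA subrK.
move: Fe; rewrite ltNge => /negP; apply.
rewrite (_ : u (F n).1 - _ = (u (l tt) - u (F n).2) - (u (l tt) - u (F n).1)).
  by apply: (le_trans (ler_normB _ _)); lra.
by ring.
Qed.

Lemma measurable_continuous u : {within K, continuous u} ->
  measurable_fun (K : set (borel_plane R)) (u : borel_plane R -> R).
Proof.
move=> /continuousP cu; have mK := measurable_gasket hK.
apply: (measurability _ (RGenOpens.measurableE R)) => _ [_ [a [b ->] <-]].
have /open_subspaceP[V oV VE] := cu _ (@interval_open R (BRight a) (BLeft b) isT isT).
rewrite setIC -VE; apply: measurableI => //; exact: sub_sigma_algebra.
Qed.

(** The energies of a continuous function at all levels control its oscillation: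
   the approximation error on fine cells vanishes in the limit. *)
Lemma oscillation_continuous : exists2 C, 0 < C & forall u S, Lp K mu p u ->
  {within K, continuous u} -> (forall k, senergy k u <= S * r ^+ k) ->
  forall n, oscillation u n (fun w => u (Psi w (q 0))) <= C * S * (r / 3) ^+ n.
Proof.
have [C C0 HC] := oscillation_corner hq hK hmu hp hr.
exists C => // u S hu cu HS n.
apply/ler_addgt0Pr => e e0.
pose d : R := (e / C) `^ p^-1.
have eC : 0 < e / C by rewrite divr_gt0.
have d0 : 0 < d by rewrite powR_gt0.
have pd : pw d = e / C.
  by rewrite /pw ger0_norm ?powR_ge0// -powRrM mulVf ?gt_eqF// powRr1// ltW.
have [k Hk] := uniform_on_cells cu d0.
apply: (le_trans (HC u hu n k u)).
have bnd1 : \sum_(v <- words (n + k)) Iosc u v (u (Psi v (q 0))) <= e / C.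
  apply: (@le_trans _ _ (\sum_(v <- words (n + k)) 3 ^- (n + k) * (e / C))).
    rewrite big_seq [leRHS]big_seq; apply: ler_sum => v.
    rewrite mem_words => /eqP sv.
    have := integral_affine_pw hK hmu hp hu v (u (Psi v (q 0))) (lexx 0) (ltW eC).
    move=> E; rewrite -lee_fin -(IoscE hK hmu hp hu).
    have -> : (3 ^- (n + k) * (e / C))%:E =
        (0 * Iosc u v (u (Psi v (q 0))) + e / C * 3 ^- size v)%:E.
      by rewrite sv mul0r add0r mulrC.
    rewrite -E.
    apply: le_lower_integral_same => x vx; rewrite lee_fin ?pw_ge0//.
    rewrite mul0r add0r -pd; apply: (ler_pw hp); rewrite (ger0_norm (ltW d0)).
    apply: (Hk v) => //; first by rewrite sv leq_addl.
    by exists (q 0) => //; exact: vertexK hK 0.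
  rewrite -mulr_sumr sum_words_const mulrA mulVf ?mul1r//.
have bnd2 : (3 / r) ^+ k * (3 ^- (n + k) * senergy (n + k) u) <=
    S * (r / 3) ^+ n.
  have := HS (n + k)%N; move: (senergy _ _) => E HE.
  have X0 : 0 <= (3 / r) ^+ k * 3 ^- (n + k).
    by rewrite mulr_ge0 ?exprn_ge0 ?invr_ge0 ?divr_ge0 ?exprn_ge0// ltW.
  have := ler_wpM2l X0 HE; rewrite -mulrA => /le_trans; apply.
  rewrite le_eqVlt; apply/orP; left; apply/eqP.
  rewrite !expr_div_n !exprD; field.
  by rewrite !expf_neq0 ?gt_eqF.
have -> : C * S * (r / 3) ^+ n + e = C * (e / C + S * (r / 3) ^+ n).
  by field; rewrite gt_eqF.
by rewrite ler_pM2l// lerD.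
Qed.

End continuous_functions.

(** * A non-constant function for the exponent one *)

Section nonconstant_functions.
Variables (R : realType) (q : 'I_3 -> plane R).
Hypothesis hq : unit_equilateral q.
Variable K : set (plane R).
Hypothesis hK : is_gasket q K.
Variable mu : {measure set (borel_plane R) -> \bar R}.
Hypothesis hmu : is_gasket_measure q K mu.
Variable p : R.
Hypothesis hp : 1 <= p.
Local Notation pw := (pw p).
Local Notation kap := (kap p).
Local Notation cell := (cell q K).
Local Notation touching := (touching q).
Local Notation Iosc := (Iosc q K mu p).
Local Notation oscillation := (oscillation q K mu p).
Local Notation gradient := (gradient p q).
Implicit Types (w v : seq 'I_3) (f : plane R -> R).
Variable r : R.
Hypothesis hr : scaling p r.

Lemma ae_positive_point (P : plane R -> Prop) (A : set (plane R)) :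
  {ae mu, forall x, P x} -> measurable (A : set (borel_plane R)) ->
  (0 < mu A)%E -> exists2 x, A x & P x.
Proof.
move=> [N [mN N0 PN]] mA A0; apply: contrapT => H.
have AN : A `<=` N.
  by move=> x Ax; apply: PN => Px; apply: H; exists x.
have : (mu A <= mu N)%E by apply: le_measure; rewrite ?inE.
by rewrite N0 leNgt A0.
Qed.

Lemma wt0_nseq k : (wt 0%R (nseq k 0%R)).+1 = (2 ^ k)%N.
Proof.
elim: k => [//|k IH] /=.
by rewrite ?eqxx size_nseq mul1n expnS mul2n -addnn -addnS IH.
Qed.

Lemma wt0_max m v : size v = m -> (wt 0%R v).+1 = (2 ^ m)%N -> v = nseq m 0%R.
Proof.
move=> sv H; have := wt_sum v; rewrite sv -H => -[] S.
have nz : wt 0%R (nseq m 0%R) = wt 0%R v.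
  by apply/eqP; rewrite -eqSS H wt0_nseq.
have nz' k (i : 'I_3) : i != 0 -> wt i (nseq k 0%R) = 0%N.
  by move=> i0; elim: k => [//|k IH] /=; rewrite (negbTE i0) IH.
apply: wt_inj; first by rewrite size_nseq.
elim/I3_ind; first by rewrite nz.
  by rewrite nz'//; lia.
by rewrite nz'//; lia.
Qed.

Definition in_cell0 w : bool := if w is i :: _ then i == 0 else false.

Definition cell0_boundary n w : bool := ~~ in_cell0 w &&
  has (fun w' => in_cell0 w' && touching w w') (words n).

(** Cells outside the first cell that touch it have the extremal weight, which
   determines all their letters but the first. *)
Lemma cell0_boundaryE m i v : size v = m -> cell0_boundary m.+1 (i :: v) ->
  v = nseq m 0.
Proof.
move=> sv /andP[/= i0 /hasP[w' w'm /andP[w'0 /touchingP[j [k jk]]]]].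
apply: wt0_max => //; apply/eqP; rewrite eqn_leq -{1}sv wt_lt /=.
have sw' : size w' = m.+1 by apply/eqP; rewrite -mem_words.
have := congr1 (bary q 0) jk; rewrite !bary_Psi// !bary_q// sw' /= sv.
have two0 : 2 != 0 :> R by rewrite pnatr_eq0.
move=> /(mulIf (invr_neq0 (expf_neq0 _ two0)))/eqP.
have i0' : (0 == i) = false by rewrite eq_sym (negbTE i0).
rewrite -!natrD eqr_nat i0' mul0n add0n => /eqP.
case: w' w'0 sw' {w'm jk} => //= i' w' /eqP -> [sw']; rewrite eqxx mul1n sw'.
have := wt_lt 0%R v; rewrite sv; move: (2 ^ m)%N (wt 0%R v) (wt 0%R w') => x y z.
by case: (0 == j); case: (0 == k); clear; lia.
Qed.

Lemma cell0_boundary_count m :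
  \sum_(w <- words m.+1) (cell0_boundary m.+1 w)%:R <= 3 :> R.
Proof.
rewrite sum_wordsS; apply: (@le_trans _ _ (\sum_(i < 3) 1)); last first.
  by rewrite sumr_const card_ord.
apply: ler_sum => i _.
apply: (@le_trans _ _ (\sum_(v <- words m) (v == nseq m 0)%:R)).
  rewrite big_seq [leRHS]big_seq; apply: ler_sum => v.
  rewrite mem_words => /eqP sv; case: (boolP (cell0_boundary _ _)) => [/(cell0_boundaryE sv) ->|_].
    by rewrite eqxx.
  by rewrite ler0n.
rewrite -natr_sum (_ : (\sum_(v <- _) _)%N = count_mem (nseq m 0) (words m)).
  by rewrite count_uniq_mem ?words_uniq// -[leRHS]/(1%:R) ler_nat leq_b1.
rewrite -sum1_count [RHS]big_mkcond; apply: eq_bigr => v _ /=.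
by case: eqP.
Qed.

Definition word0 : seq 'I_3 := [:: 0].

Definition cell0_indic : plane R -> R := \1_(cell word0).

Lemma Lp_bounded f (B : R) :
  measurable_fun (K : set (borel_plane R)) (f : borel_plane R -> R) ->
  (forall x, K x -> `|f x| <= B) -> Lp K mu p f.
Proof.
move=> mf fB; split=> //.
have mK := measurable_gasket hK.
apply: (@le_lt_trans _ _ (\int[mu]_(x in K) (cst (pw B)%:E x))%E).
  apply: le_lower_integral_same => x Kx; rewrite lee_fin ?powR_ge0//.
  by apply: (ler_pw hp); rewrite (le_trans (fB x Kx))// ler_norm.
by rewrite integral_cst// (mu_gasket hmu) mule1 ltry.
Qed.

Lemma cell0_indic_Lp : Lp K mu p cell0_indic.
Proof.
apply: (@Lp_bounded _ 1).
  apply: measurable_indic; exact: (measurable_cell hK).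
by move=> x _; rewrite /cell0_indic indicE; case: (_ \in _); rewrite ?normr1 ?normr0.
Qed.

Lemma cell0_indic_nonconstant : ~ ae_constant K mu cell0_indic.
Proof.
move=> [c Hc]; have m0 := measurable_cell hK word0; have mK := measurable_gasket hK.
have m0E : mu (cell word0) = (3^-1)%:E by rewrite (mu_cell hmu).
have [x wx Hx] : exists2 x, cell word0 x & K x -> cell0_indic x = c.
  by apply: (ae_positive_point Hc) => //; rewrite m0E lte_fin invr_gt0.
have c1 : c = 1.
  by rewrite -Hx ?/cell0_indic ?indicE ?mem_set//; exact: (cell_sub hK) wx.
have [y [Ky ny] Hy] : exists2 y, (K `\` cell word0) y & K y -> cell0_indic y = c.
  apply: (ae_positive_point Hc); first exact: measurableD.
  rewrite lt0e measure_ge0 andbT; apply/eqP => D0.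
  have : (mu K <= mu (cell word0) + mu (K `\` cell word0))%E.
    apply: (le_trans _ (measureU2 _ _ _)) => //; last exact: measurableD.
    apply: le_measure; rewrite ?inE//.
      by apply: measurableU => //; exact: measurableD.
    by move=> z Kz; case: (pselect (cell word0 z)) => ?; [left|right].
  rewrite D0 adde0 (mu_gasket hmu) m0E lee_fin; lra.
have : cell0_indic y = 0 by rewrite /cell0_indic indicE memNset.
by rewrite Hy// c1 => /eqP; rewrite oner_eq0.
Qed.

(** The indicator differs from its discrete values only on boundary cells, and
   every jump of these values involves a boundary cell; there are at most
   three. *)
Lemma cell0_indic_oscillation m :
  oscillation cell0_indic m.+1 (fun w => (in_cell0 w)%:R) <= 57 * 3 ^- m.+1.
Proof.
have hf := cell0_indic_Lp; set n := m.+1.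
pose b w : R := (cell0_boundary n w)%:R.
have b0 w : 0 <= b w by rewrite ler0n.
have bsum : \sum_(w <- words n) b w <= 3 by exact: cell0_boundary_count.
have n0 : 0 < 3 ^- n :> R by rewrite invr_gt0 exprn_gt0.
have bndI : \sum_(w <- words n) Iosc cell0_indic w (in_cell0 w)%:R <= 3 ^- n * 3.
  apply: (@le_trans _ _ (\sum_(w <- words n) 3 ^- n * b w)); last first.
    by rewrite -mulr_sumr ler_pM2l.
  rewrite big_seq [leRHS]big_seq; apply: ler_sum => w wn.
  have sw : size w = n by apply/eqP; rewrite -mem_words.
  rewrite -lee_fin -(IoscE hK hmu hp hf).
  have -> : (3 ^- n * b w)%:E = (\int[mu]_(x in cell w) (cst (b w)%:E x))%E.
    rewrite integral_cst ?(mu_cell hmu) ?sw -?EFinM 1?mulrC//.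
    exact: (measurable_cell hK).
  apply: le_lower_integral_same => x wx; rewrite lee_fin ?pw_ge0//=.
  rewrite /cell0_indic indicE; case: (boolP (x \in _)) => [/set_mem x0|x0].
    case: (boolP (in_cell0 w)) => w0; first by rewrite subrr pw0.
    rewrite subr0 pw1 /b /cell0_boundary w0 /=.
    have : cell ([:: 0] ++ [::]) x by [].
    move=> /(cell_cover hK m)[v vm vx].
    suff -> : has (fun w' => in_cell0 w' && touching w w') (words n) by [].
    apply/hasP; exists (0 :: v).
      by rewrite mem_words /= eqSS -mem_words.
    rewrite /= (close_near hq hK _ wx vx)//.
      by rewrite sw /= ; congr S; apply/esym/eqP; rewrite -mem_words.
    have -> : Defs.edist x x = 0.
      by apply/eqP; rewrite sqrtr_eq0 !subrr expr0n /= addr0.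
    by rewrite mulr0 exprn_gt0// invr_gt0.
  rewrite (_ : in_cell0 w = false) ?subrr ?pw0//.
  apply: contraNF x0; case: w wn sw wx => [//|i v] _ _ wx /= /eqP i0.
  by apply: mem_set; apply: (@cell_cat _ q K hK [:: 0] v); rewrite -i0.
have bndG : gradient n (fun w => (in_cell0 w)%:R) <= 54.
  apply: (@le_trans _ _ (9 * 3 + 9 * 3)); last by lra.
  have := lerD (sum_near_le hq n b0) (sum_near_const_le hq n b0).
  move=> H; apply: (@le_trans _ _ (9 * \sum_(w <- words n) b w +
    9 * \sum_(w <- words n) b w)); last by lra.
  apply: le_trans H; rewrite -big_split /gradient /=.
  rewrite big_seq [leRHS]big_seq; apply: ler_sum => w wn.
  rewrite -big_split /= big_seq_cond [leRHS]big_seq_cond.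
  apply: ler_sum => w' /andP[w'n ww'].
  have bd v v' : v \in words n -> v' \in words n -> touching v v' ->
      ~~ in_cell0 v -> in_cell0 v' -> b v = 1.
    move=> vn v'n vv' v0 v'0; rewrite /b /cell0_boundary v0 /=.
    suff -> : has (fun w' => in_cell0 w' && touching v w') (words n) by [].
    by apply/hasP; exists v' => //; rewrite v'0.
  case: (boolP (in_cell0 w)) => w0; case: (boolP (in_cell0 w')) => w'0.
  - by rewrite subrr pw0// addr_ge0.
  - by rewrite sub0r pwN pw1 (bd w' w) ?lerDl// touching_sym.
  - by rewrite subr0 pw1 (bd w w') ?lerDr.
  - by rewrite subrr pw0// addr_ge0.
rewrite /oscillation; have := ler_wpM2l (ltW n0) bndG; lra.
Qed.

Lemma nonconstant_Besov_1 : p = 1 ->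
  exists f, Besov K mu p (dim_exponent p r) f /\ ~ ae_constant K mu f.
Proof.
move=> p1; have hf := cell0_indic_Lp.
have r1 : r = 1.
  by apply/eqP; rewrite eq_le (scaling_le1 hp hr) (scaling_ge1 hp p1 hr).
exists cell0_indic; split; last exact: cell0_indic_nonconstant.
pose o0 := oscillation cell0_indic 0 (fun=> 0).
have o00 : 0 <= o0 by exact: (oscillation_ge0 hK hmu hp hf).
apply: (@Besov_of_oscillation R q hq K hK mu hmu p hp r hr _ (57 + o0)) => //.
  by rewrite addr_ge0.
case=> [|m]; first by exists (fun=> 0); rewrite expr0 mulr1 lerDr.
exists (fun w => (in_cell0 w)%:R); rewrite r1 div1r exprVn.
apply: (le_trans (cell0_indic_oscillation m)).
by rewrite ler_pM2r ?lerDl// invr_gt0 exprn_gt0.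
Qed.

End nonconstant_functions.

(** * A non-constant function for exponents above one *)

Section harmonic_function.
Variables (R : realType) (q : 'I_3 -> plane R).
Hypothesis hq : unit_equilateral q.
Variable K : set (plane R).
Hypothesis hK : is_gasket q K.
Variable mu : {measure set (borel_plane R) -> \bar R}.
Hypothesis hmu : is_gasket_measure q K mu.
Variable p : R.
Hypothesis hp : 1 <= p.
Local Notation pw := (pw p).
Local Notation kap := (kap p).
Local Notation Psi := (Psi q).
Local Notation cell := (cell q K).
Local Notation touching := (touching q).
Local Notation oscillation := (oscillation q K mu p).
Local Notation senergy := (senergy p q).
Implicit Types (w v : seq 'I_3) (f u : plane R -> R).
Variable r : R.
Hypothesis hr : scaling p r.

Let r_gt0 : 0 < r. Proof. by case: hr. Qed.
Let p_gt0 : 0 < p. Proof. exact: lt_le_trans hp. Qed.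
Let k0 : 0 < kap. Proof. exact: kap_gt0. Qed.

(** * Gluing *)

(** Gluing is done on the full triangle, where the images under two of the maps
   meet in one point by an elementary computation. *)
Definition triangle (z : plane R) := forall i, 0 <= bary q i z.

Lemma triangle_q i : triangle (q i).
Proof. by move=> j; rewrite bary_q// ler0n. Qed.

Lemma triangle_psi i z : triangle z -> triangle (psi q i z).
Proof. by move=> tz j; rewrite bary_psi// divr_ge0// addr_ge0 ?tz// ler0n. Qed.

Lemma triangle_Psi w z : triangle z -> triangle (Psi w z).
Proof. by move=> tz; elim: w => [//|i w IH]; exact: triangle_psi. Qed.

Lemma triangle_K z : K z -> triangle z.
Proof. by move=> Kz i; exact: (bary_ge0 hq hK). Qed.

Definition unpsi (i : 'I_3) (z : plane R) : plane R := 2 *: z - q i.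

Lemma psiK_unpsi i z : unpsi i (psi q i z) = z.
Proof.
rewrite /unpsi /psi scalerDr scalerA divff// scale1r scaler_nat mulr2n.
by rewrite addrA addrK subrK.
Qed.

Definition glue (U : 'I_3 -> plane R -> R) (z : plane R) : R :=
  if 2^-1 <= bary q 0 z then U 0 (unpsi 0 z)
  else if 2^-1 <= bary q 1 z then U 1 (unpsi 1 z) else U 2 (unpsi 2 z).

(** The images of the triangle under two of the maps meet in one vertex, where the
   two functions agree. *)
Lemma glue_psi U i z : (forall i j, U i (q j) = U j (q i)) -> triangle z ->
  glue U (psi q i z) = U i z.
Proof.
move=> Uq tz.
have same k : 2^-1 <= bary q k (psi q i z) -> U k (unpsi k (psi q i z)) = U i z.
  have [->|ki] := eqVneq k i; first by rewrite psiK_unpsi.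
  rewrite bary_psi// (negbTE ki) addr0 => h.
  have zk : z = q k.
    apply: (bary_inj hq) => l; rewrite bary_q//.
    have := bary_sum q z; have := tz 0; have := tz 1; have := tz 2.
    move: h; move: (k) l; elim/I3_ind; elim/I3_ind => /=; lra.
  by rewrite zk psi_mid psiK_unpsi Uq.
rewrite /glue; case: ifPn => [|h0]; first exact: same.
case: ifPn => [|h1]; first exact: same.
suff -> : i = 2 by rewrite psiK_unpsi.
move: h0 h1; rewrite !bary_psi//; have := tz 0; have := tz 1.
by elim/I3_ind: (i) => //= t1 t0; rewrite -!ltNge => h0 h1; exfalso; lra.
Qed.

Definition affine_on_cells n u := forall w z, size w = n -> triangle z ->
  u (Psi w z) = \sum_j bary q j z * u (Psi w (q j)).

(** By induction: almost optimal values at the inner vertices are extended in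
   the three images of the triangle, and the extensions are glued. The
   permutation reflects that the image under the map [i] has at its corner [j]
   the inner vertex with the index of the third corner. *)
Lemma near_optimal_extension n (a : 'rV[R]_3) e : 0 < e -> exists u,
  [/\ forall j, u (q j) = a 0 j, senergy n u <= renorm_iter p n a + e &
      affine_on_cells n u].
Proof.
elim: n a e => [|n IH] a e e0.
  pose u z := \sum_j bary q j z * a 0 j.
  have uq j : u (q j) = a 0 j.
    rewrite /u (bigD1 j)//= bary_q// eqxx mul1r big1 ?addr0// => i ij.
    by rewrite bary_q// (negbTE ij) mul0r.
  exists u; split=> //.
    rewrite /senergy sum_words0 (_ : corners q u [::] = a) ?lerDl ?ltW//.
    by apply/rowP => j; rewrite mxE uq.
  move=> w z /size0nil -> tz; rewrite {1}/u; apply: eq_bigr => j _.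
  by rewrite /= uq.
have hA := renorm_iter_regular hp n.
have e20 : 0 < e / 2 by rewrite divr_gt0.
have e60 : 0 < e / 6 by rewrite divr_gt0.
have [b Hb] := renorm_near a (regular_ge0 hA) e20.
pose A i : 'rV[R]_3 := \row_j (if j == i then a 0 j else b 0 (- (i + j))).
have /choice[U HU] i := IH (A i) _ e60.
have UA i j : U i (q j) = A i 0 j by case: (HU i).
have Uq i j : U i (q j) = U j (q i).
  rewrite !UA !mxE eq_sym; case: eqP => [->//|_]; by rewrite addrC.
have Ae i : renorm_iter p n (A i) =
    renorm_iter p n (\row_j (if j == i then a 0 j else b 0 j)).
  rewrite -(regular_perm hA (reflect3 i)); congr renorm_iter.
  apply/rowP => j; rewrite !mxE reflect3E.
  have [->|ji] := eqVneq j i.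
    rewrite (_ : - (i + i) = i) ?eqxx//.
    by elim/I3_ind: (i); exact: val_inj.
  rewrite ifF; last first.
    by apply/negbTE; move: i j ji; elim/I3_ind; elim/I3_ind.
  by congr (b 0 _); rewrite opprD opprK addrA addNr add0r.
exists (glue U); split.
- move=> j; rewrite -(psi_fix q j) glue_psi ?UA//; last exact: triangle_q.
  by rewrite !mxE eqxx.
- rewrite senergyS.
  apply: (@le_trans _ _ (\sum_i (renorm_iter p n (A i) + e / 6))).
    apply: ler_sum => i _; have [_ Hs _] := HU i; apply: le_trans Hs.
    rewrite le_eqVlt; apply/orP; left; apply/eqP; apply: eq_bigr => w _.
    congr Fp; apply/rowP => j; rewrite !mxE /= glue_psi//.
    exact/triangle_Psi/triangle_q.
  rewrite big_split /= (eq_bigr _ (fun i _ => Ae i)) sumr_const card_ord.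
  rewrite -/(renorm_iter p n).
  move: Hb; rewrite /renorm_sum; set X := \sum_(i < 3) _.
  by rewrite -mulr_natl; lra.
- case=> [//|i w] z [sw] tz; rewrite /= glue_psi//; last exact: triangle_Psi.
  have [_ _ Haff] := HU i; rewrite Haff//; apply: eq_bigr => j _.
  by rewrite glue_psi//; exact/triangle_Psi/triangle_q.
Qed.

(** * The limit function *)

Hypothesis p1 : 1 < p.

Let r1 : r < 1. Proof. exact: (scaling_lt1 hp p1 hr). Qed.

Let tau : R := r `^ p^-1.

Let tau_gt0 : 0 < tau. Proof. exact: powR_gt0. Qed.

Let tau_lt1 : tau < 1.
Proof.
have : r `^ p^-1 < 1 `^ p^-1.
  by apply: gt0_ltr_powR; rewrite ?invr_gt0 ?nnegrE// ltW.
by rewrite powR1.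
Qed.

Lemma edge_bound S n u w i j : 0 <= S -> senergy n u <= S * r ^+ n ->
  size w = n -> `|u (Psi w (q i)) - u (Psi w (q j))| <= S `^ p^-1 * tau ^+ n.
Proof.
move=> S0 HS sw.
have -> : S `^ p^-1 * tau ^+ n = (S * r ^+ n) `^ p^-1.
  by rewrite powRM ?exprn_ge0 ?(ltW r_gt0)// powR_exprn// ltW.
apply: (pw_root hp); first by rewrite mulr_ge0// exprn_ge0// ltW.
apply: le_trans HS; apply: edge_le_senergy => //.
by rewrite mem_words sw.
Qed.

(** The oscillation of [u] on a cell is a geometric series over the finer levels. *)
Lemma chain_bound S n u : 0 <= S -> affine_on_cells n u ->
  (forall m, (m <= n)%N -> senergy m u <= S * r ^+ m) ->
  forall w x, (size w <= n)%N -> cell w x ->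
  `|u x - u (Psi w (q 0))| <= S `^ p^-1 / (1 - tau) * tau ^+ size w.
Proof.
move=> S0 aff HS; set c := S `^ p^-1; have c0 : 0 <= c by exact: powR_ge0.
have t1 : 0 < 1 - tau by rewrite subr_gt0.
have base w x : size w = n -> cell w x ->
    `|u x - u (Psi w (q 0))| <= c * tau ^+ n.
  move=> sw [z Kz <-]; rewrite (aff w z sw (triangle_K Kz)).
  have b1 := bary_sum q z.
  have -> : \sum_j bary q j z * u (Psi w (q j)) - u (Psi w (q 0)) =
      \sum_j bary q j z * (u (Psi w (q j)) - u (Psi w (q 0))).
    rewrite !sum_I3 -[X in _ - X]mul1r -b1; ring.
  apply: (le_trans (ler_norm_sum _ _ _)).
  apply: (@le_trans _ _ (\sum_j bary q j z * (c * tau ^+ n))).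
    apply: ler_sum => j _; have bj := triangle_K Kz j.
    rewrite normrM (ger0_norm bj) ler_wpM2l//.
    exact: (edge_bound j 0 S0 (HS n (leqnn n)) sw).
  by rewrite -mulr_suml sum_I3 b1 mul1r.
have step k : forall w x, (size w + k = n)%N -> cell w x ->
    `|u x - u (Psi w (q 0))| <= c / (1 - tau) * tau ^+ size w.
  elim: k => [|k IH] w x; first rewrite addn0 => sw wx.
    apply: (le_trans (base w x sw wx)); rewrite sw ler_wpM2r ?exprn_ge0 ?(ltW tau_gt0)//.
    by rewrite ler_peMr// invf_ge1//; move: tau_gt0; lra.
  rewrite addnS -addSn => sw /(cell_cover hK 1)[v].
  case: v => [|i [|? ?]]; rewrite mem_words//= => _ wix.
  have swi : size (w ++ [:: i]) = (size w).+1 by rewrite size_cat addn1.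
  have := IH (w ++ [:: i]) x; rewrite swi => /(_ sw wix) H1.
  have H2 : `|u (Psi (w ++ [:: i]) (q 0)) - u (Psi w (q 0))| <=
      c * tau ^+ (size w).+1.
    rewrite Psi_cat /= (psi_mid q i) -[in X in _ - X](psi_fix q 0).
    have := @edge_bound S (size w).+1 u (w ++ [:: 0]) i 0 S0.
    rewrite !Psi_cat /=; apply; last by rewrite size_cat addn1.
    by apply: HS; rewrite -sw leq_addr.
  rewrite (_ : u x - _ = (u x - u (Psi (w ++ [:: i]) (q 0))) +
    (u (Psi (w ++ [:: i]) (q 0)) - u (Psi w (q 0)))); last by ring.
  apply: (le_trans (ler_normD _ _)); apply: (le_trans (lerD H1 H2)).
  rewrite exprS; set X := tau ^+ size w.
  have X0 : 0 <= X by rewrite exprn_ge0// ltW.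
  have -> : c / (1 - tau) * X =
    c / (1 - tau) * (tau * X) + c * (tau * X) +
      c * X * (1 - tau) ^+ 2 / (1 - tau).
    by field; rewrite gt_eqF.
  by rewrite lerDl divr_ge0 ?(ltW t1)// mulr_ge0 ?sqr_ge0// mulr_ge0.
move=> w x wn wx; apply: (step (n - size w)%N) => //.
by rewrite subnKC.
Qed.

Lemma senergy_perturb n u u' d : 0 <= d ->
  (forall w i, w \in words n -> `|u (Psi w (q i)) - u' (Psi w (q i))| <= d) ->
  senergy n u <= kap ^+ 2 * (senergy n u' + 6 * 3 ^+ n * pw d).
Proof.
move=> d0 H.
have -> : 6 * 3 ^+ n * pw d = \sum_(w <- words n) (6 * pw d).
  by rewrite sum_words_const; ring.
rewrite /senergy -big_split mulr_sumr big_seq [leRHS]big_seq.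
apply: ler_sum => w wn; rewrite /= !FpE !mxE.
have E i j : pw (u (Psi w (q i)) - u (Psi w (q j))) <= kap ^+ 2 *
    (pw d + pw (u' (Psi w (q i)) - u' (Psi w (q j))) + pw d).
  rewrite (_ : u _ - u _ = (u (Psi w (q i)) - u' (Psi w (q i))) +
    (u' (Psi w (q i)) - u' (Psi w (q j))) + (u' (Psi w (q j)) - u (Psi w (q j))));
    last by ring.
  apply: (le_trans (pwD3 hp _ _ _)); rewrite ler_pM2l ?exprn_gt0//.
  apply: lerD; first apply: lerD => //.
    by apply: (ler_pw hp); rewrite (ger0_norm d0) H.
  by rewrite pwC; apply: (ler_pw hp); rewrite (ger0_norm d0) H.
have := E 0 1; have := E 1 2; have := E 2 0; lra.
Qed.

Lemma filter_all_seq (U : set_system nat) (T : eqType) (s : seq T)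
  (P : T -> nat -> Prop) : Filter U ->
  (forall x, x \in s -> \forall n \near U, P x n) ->
  \forall n \near U, forall x, x \in s -> P x n.
Proof.
move=> FU; elim: s => [|x s IH] H; first exact: nearW.
have h1 := H x (mem_head x s).
have h2 : \forall n \near U, forall y, y \in s -> P y n.
  by apply: IH => y ys; apply: H; rewrite inE ys orbT.
apply: filterS (filterI h1 h2) => n [Hx Hs] y.
by rewrite inE => /orP[/eqP ->|/Hs].
Qed.

(** The almost optimal extensions to level [n] have bounded normalized energies
   at all levels up to [n]; by the geometric decay of the differences along
   edges, the bounds on cells and the energies pass to a limit along an
   ultrafilter. *)
Lemma energy_minimizing_limit : exists u S B,
  [/\ 0 <= B, forall w x, cell w x -> `|u x - u (Psi w (q 0))| <= B * tau ^+ size w,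
      forall m, senergy m u <= S * r ^+ m & u (q 0) = 1 /\ u (q 1) = 0].
Proof.
have [_ [c [C [c0 C0 Hc]]]] := hr.
have [C1 C10 mono] := senergy_mono hp q hr.
have rn0 n : 0 < r ^+ n by rewrite exprn_gt0.
have /choice[F HF] n := near_optimal_extension n (unit_vec R 0) (rn0 n).
pose S := C1 * (2 * C + 1).
have S0 : 0 <= S by rewrite mulr_ge0 ?addr_ge0 ?mulr_ge0// ltW.
have FS n m : (m <= n)%N -> senergy m (F n) <= S * r ^+ m.
  move=> mn; have := mono m (n - m)%N (F n); rewrite subnKC// => /le_trans; apply.
  have [_ Hn _] := HF n.
  have /andP[_ Hu] := Hc n (unit_vec R 0); rewrite Fp_unit_vec// in Hu.
  apply: (@le_trans _ _ (C1 / r ^+ (n - m) * ((2 * C + 1) * r ^+ n))).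
    rewrite ler_pM2l; last by rewrite divr_gt0.
    by apply: (le_trans Hn); move: Hu; lra.
  rewrite le_eqVlt; apply/orP; left; apply/eqP.
  rewrite -[in r ^+ n](subnK mn) exprD /S; field.
  by rewrite gt_eqF.
pose B := S `^ p^-1 / (1 - tau).
have t1 : 0 < 1 - tau by rewrite subr_gt0.
have B0 : 0 <= B by rewrite divr_ge0 ?powR_ge0// ltW.
have FB n w x : (size w <= n)%N -> cell w x ->
    `|F n x - F n (Psi w (q 0))| <= B * tau ^+ size w.
  by case: (HF n) => _ _ aff; apply: (chain_bound S0 aff) => m; exact: FS.
have Fq n j : F n (q j) = (j == 0)%:R by case: (HF n) => -> _ _; rewrite mxE.
(* Cutting off outside [K] gives compact ranges at all points of the plane. *)
have Fbnd n x : `[- (1 + B), 1 + B]%classic ((F n \_ K) x).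
  rewrite /= in_itv /= -ler_norml patchE; case: ifPn => [/set_mem Kx|_].
    have /(FB n [::] x (leq0n n)) : cell [::] x by rewrite cell_nil.
    rewrite /= expr0 mulr1 Fq eqxx => H.
    rewrite -[F n x](subrK 1); apply: (le_trans (ler_normD _ _)).
    by rewrite normr1 addrC lerD2l.
  by rewrite normr0 addr_ge0.
have cI (x : plane R) : compact `[- (1 + B), 1 + B]%classic by exact: segment_compact.
have [U [u [PU ooU _ cvg]]] := pointwise_ultralimit cI Fbnd.
have cvgK x : K x -> F n x @[n --> U] --> u x.
  move=> Kx; rewrite (_ : (fun n => F n x) = (fun n => (F n \_ K) x)).
    exact: cvg.
  by apply/funext => n; rewrite patchE mem_set.
have vK w i : K (Psi w (q i)) by exact/(PsiK hK)/(vertexK hK).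
have uq j : u (q j) = (j == 0)%:R.
  apply: (@cvg_unique _ (@norm_hausdorff _ _) (F n (q j) @[n --> U])).
    exact: cvgK (vertexK hK j).
  rewrite /= (_ : (fun n => F n (q j)) = fun=> (j == 0)%:R).
    exact: cvg_cst.
  by apply/funext => n.
exists u, (kap ^+ 2 * (S + 1)), B; split=> //.
- move=> w x wx.
  have cn : `|F n x - F n (Psi w (q 0))| @[n --> U] --> `|u x - u (Psi w (q 0))|.
    by apply: cvg_norm; apply: cvgB; apply: cvgK => //; exact: (cell_sub hK) wx.
  apply: (@closed_cvg _ _ U _ _ (fun y => y <= B * tau ^+ size w) _ _ _ cn).
    exact: closed_le.
  have : \forall n \near U, (size w <= n)%N by apply: ooU; exists (size w).
  by apply: filterS => n wn; exact: FB.
- move=> m.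
  pose d := (r ^+ m / (6 * 3 ^+ m)) `^ p^-1.
  have dd : 0 < r ^+ m / (6 * 3 ^+ m) by rewrite divr_gt0// mulr_gt0// exprn_gt0.
  have d0 : 0 < d by rewrite powR_gt0.
  have pd : pw d = r ^+ m / (6 * 3 ^+ m).
    by rewrite /pw ger0_norm ?powR_ge0// -powRrM mulVf ?gt_eqF// powRr1// ltW.
  have near1 : \forall n \near U, (m <= n)%N by apply: ooU; exists m.
  have near2 : \forall n \near U, forall wi, wi \in
      [seq (w, i) | w <- words m, i <- enum 'I_3] ->
      `|u (Psi wi.1 (q wi.2)) - F n (Psi wi.1 (q wi.2))| <= d.
    apply: filter_all_seq => -[w i] _ /=.
    by have /cvgrPdist_le/(_ d d0) := cvgK _ (vK w i).
  have [n [mn Hn]] := filter_ex (filterI near1 near2).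
  have := @senergy_perturb m u (F n) d (ltW d0).
  move=> /(_ _)/le_trans; apply.
    move=> w i wm; apply: (Hn (w, i)).
    by apply/allpairsP; exists (w, i); rewrite /= mem_enum.
  rewrite -[leRHS]mulrA ler_pM2l ?exprn_gt0// [leRHS]mulrDl mul1r lerD ?FS//.
  by rewrite pd mulrC divfK// gt_eqF// mulr_gt0// exprn_gt0.
Qed.

(** The limit function is continuous with the values 1 and 0 at two vertices,
   and the cells at these vertices have positive measure. *)
Lemma nonconstant_Besov_gt1 :
  exists f, Besov K mu p (dim_exponent p r) f /\ ~ ae_constant K mu f.
Proof.
have [u [S [B [B0 HB HS [u0 u1]]]]] := energy_minimizing_limit.
have osc w x y : cell w x -> cell w y -> `|u x - u y| <= 2 * B * tau ^+ size w.
  move=> wx wy; rewrite -[u x - u y](subrKA (u (Psi w (q 0)))).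
  have := HB w x wx; have := HB w y wy; rewrite (distrC (u y)).
  have := ler_normD (u x - u (Psi w (q 0))) (u (Psi w (q 0)) - u y).
  lra.
have small e : 0 < e -> exists n, 4 * B * tau ^+ n < e.
  move=> e0; apply: contrapT => /forallNP Hn.
  have : e <= 0.
    apply: (@geometric_le0 _ _ (4 * B) tau); first by rewrite (ltW tau_gt0).
    by move=> n; rewrite leNgt; apply/negP/Hn.
  by rewrite leNgt e0.
have cu : {within K, continuous u}.
  apply/within_continuousP => x Kx e e0; have [n Hn] := small e e0.
  exists (2^-1 ^+ n / 8); first by rewrite divr_gt0// exprn_gt0.
  move=> y Ky xy.
  have [w wn wx] := gasket_cover hK n Kx; have [w' w'n w'y] := gasket_cover hK n Ky.
  move: wn w'n; rewrite !mem_words => /eqP wn /eqP w'n.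
  have ww' : touching w w'.
    apply: (close_near hq hK _ wx w'y); first by rewrite wn w'n.
    by have := edist_le_norm x y; rewrite wn; lra.
  have /touchingP[i [j ij]] := ww'.
  have h1 : `|u x - u (Psi w (q i))| <= 2 * B * tau ^+ n.
    by rewrite -wn; apply: osc => //; exists (q i) => //; exact: vertexK hK i.
  have h2 : `|u (Psi w (q i)) - u y| <= 2 * B * tau ^+ n.
    by rewrite -w'n ij; apply: osc => //; exists (q j) => //; exact: vertexK hK j.
  have := ler_normD (u x - u (Psi w (q i))) (u (Psi w (q i)) - u y).
  rewrite addrA subrK => h3; lra.
have hf : Lp K mu p u.
  apply: (@Lp_bounded R q K hK mu hmu p hp u (1 + B)).
    exact: (measurable_continuous hK).
  move=> x Kx; have := HB [::] x; rewrite cell_nil /= expr0 mulr1 u0 => /(_ Kx) H.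
  rewrite -[u x](subrK 1); apply: (le_trans (ler_normD _ _)).
  by rewrite normr1 addrC lerD2l.
exists u; split.
  have [C C0 HC] := oscillation_continuous hq hK hmu hp hr.
  have S0 : 0 <= S.
    have := HS 0%N; rewrite expr0 mulr1; apply: le_trans; exact: senergy_ge0.
  apply: (@Besov_of_oscillation R q hq K hK mu hmu p hp r hr _ (C * S)) => //.
    by rewrite mulr_ge0// ltW.
  by move=> n; exists (fun w => u (Psi w (q 0))); exact: HC.
move=> [c Hc]; have half_gt0 : 0 < 2^-1 :> R by rewrite invr_gt0.
have [n Hn] := small 2^-1 half_gt0.
have vertex_close i : `|c - u (q i)| < 2^-1.
  have sw : size (nseq n i) = n by rewrite size_nseq.
  have [|x wx Hx] := ae_positive_point Hc (measurable_cell hK (nseq n i)).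
    by rewrite (mu_cell hmu) lte_fin invr_gt0 exprn_gt0.
  rewrite -(Hx (cell_sub hK wx)).
  have qi : cell (nseq n i) (q i).
    exists (q i); first exact: vertexK hK i.
    by elim: (n) => [//|k IH] /=; rewrite IH psi_fix.
  have := osc _ _ _ wx qi; rewrite sw => h.
  have := mulr_ge0 B0 (exprn_ge0 n (ltW tau_gt0)); lra.
have := vertex_close 0; have := vertex_close 1; rewrite u0 u1 subr0.
rewrite !ltr_norml; lra.
Qed.

End harmonic_function.

(** * The energy on the vertices and the variation *)

Section vertex_energy.
Variables (R : realType) (q : 'I_3 -> plane R).
Hypothesis hq : unit_equilateral q.
Variable K : set (plane R).
Hypothesis hK : is_gasket q K.
Variable mu : {measure set (borel_plane R) -> \bar R}.
Hypothesis hmu : is_gasket_measure q K mu.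
Variable p : R.
Hypothesis hp : 1 <= p.
Local Notation pw := (pw p).
Local Notation kap := (kap p).
Local Notation Psi := (Psi q).
Local Notation oscillation := (oscillation q K mu p).
Local Notation senergy := (senergy p q).
Local Notation gradient := (gradient p q).
Implicit Types (w v : seq 'I_3) (g : seq 'I_3 -> R) (f u : plane R -> R).
Variable r : R.
Hypothesis hr : scaling p r.

Let r_gt0 : 0 < r. Proof. by case: hr. Qed.
Let p_gt0 : 0 < p. Proof. exact: lt_le_trans hp. Qed.
Let k0 : 0 < kap. Proof. exact: kap_gt0. Qed.

(** * The energy as a sum over cells *)

Definition ordered_edges : seq ('I_3 * 'I_3) :=
  [:: (0, 1); (1, 0); (1, 2); (2, 1); (2, 0); (0, 2)].

Lemma mem_ordered_edges i j : ((i, j) \in ordered_edges) = (i != j).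
Proof. by move: i j; elim/I3_ind; elim/I3_ind. Qed.

Definition edge_of (wij : seq 'I_3 * ('I_3 * 'I_3)) : plane R * plane R :=
  (Psi wij.1 (q wij.2.1), Psi wij.1 (q wij.2.2)).

(** The weights of the common corners determine the indices of the corners and
   the cell. *)
Lemma edge_of_inj w w' ij ij' : size w = size w' ->
  ij.1 != ij.2 -> ij'.1 != ij'.2 -> edge_of (w, ij) = edge_of (w', ij') ->
  (w, ij) = (w', ij').
Proof.
case: ij ij' => [i j] [i' j'] /= sw ij ij' [H1 H2].
have wtE k l l' : Psi w (q l) = Psi w' (q l') ->
    ((k == l) + wt k w = (k == l') + wt k w')%N.
  move=> /(congr1 (bary q k)); rewrite !bary_Psi// !bary_q// sw.
  have two0 : 2 != 0 :> R by rewrite pnatr_eq0.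
  move=> /(mulIf (invr_neq0 (expf_neq0 _ two0)))/eqP.
  by rewrite -!natrD eqr_nat => /eqP.
have ii' : i = i'.
  apply/eqP; have := wtE i _ _ H1; have := wtE i _ _ H2.
  rewrite eqxx (negbTE ij).
  by case: (i == i') => //; case: (i == j') => /=; clear; lia.
have jj' : j = j'.
  apply/eqP; have := wtE j _ _ H1; have := wtE j _ _ H2.
  rewrite eqxx [j == i]eq_sym (negbTE ij).
  by case: (j == j') => //; case: (j == i') => /=; clear; lia.
rewrite ii' jj' (wt_inj sw)// => k.
by have := wtE k _ _ H1; rewrite ii' => /addnI.
Qed.

Lemma Vert_Psi m w i : size w = m -> Vert q m (Psi w (q i)).
Proof.
elim: m w => [|m IH] w; first by move=> /size0nil ->; exists i.
by case: w => [//|j w] [sw]; exists j => //; exists (Psi w (q i)) => //; exact: IH.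
Qed.

(** Each pair of neighbors is an edge of one cell only, and is counted in both
   orders. *)
Lemma energy_levelE rp m f : energy_level q p rp m f = rp ^- m * senergy m f.
Proof.
pose s := [seq edge_of (w, ij) | w <- words m, ij <- ordered_edges].
rewrite /energy_level.
rewrite (_ : [set _ | _] = [set` s]); last first.
  apply/seteqP; split=> -[x y] /=.
    move=> [_ _ [xy [w [[_ [i _ <-] xE] [_ [j _ <-] yE]]]]].
    apply/allpairsP; exists (tval w, (i, j)); split=> /=.
    - by rewrite mem_words size_tuple.
    - rewrite mem_ordered_edges; apply/eqP => ij.
      by apply: xy; rewrite -xE -yE ij.
    - by rewrite /edge_of /= xE yE.
  move=> /allpairsP[[w [i j]] /= [wm]].
  rewrite mem_ordered_edges => ij [-> ->].
  have sw : size w = m by apply/eqP; rewrite -mem_words.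
  split; [exact: Vert_Psi|exact: Vert_Psi|split].
    move=> e; have := @edge_of_inj w w (i, j) (j, i) erefl ij.
    rewrite eq_sym /= => /(_ ij); rewrite /edge_of /= e => /(_ erefl)[ij' _].
    by rewrite ij' eqxx in ij.
  have sw' : size w == m by apply/eqP.
  exists (Tuple sw') => /=; split.
    by exists (q i) => //; exists i.
  by exists (q j) => //; exists j.
have us : uniq s.
  apply: allpairs_uniq => //; first exact: words_uniq.
  have memE (x : seq 'I_3 * ('I_3 * 'I_3)) :
      x \in [seq (w, ij) | w <- words m, ij <- ordered_edges] ->
      size x.1 = m /\ x.2.1 != x.2.2.
    move=> /allpairsP[[w [i j]]] [wm ijm ->] /=.
    by split; [apply/eqP; rewrite -mem_words|rewrite -mem_ordered_edges].
  move=> [w1 ij1] [w2 ij2] /memE[/= s1 n1] /memE[/= s2 n2] e.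
  by apply: edge_of_inj => //; rewrite s1 s2.
rewrite -fsbig_seq// /s big_allpairs_dep /=.
have -> : \sum_(w <- words m) \sum_(ij <- ordered_edges)
   `|f (edge_of (w, ij)).1 - f (edge_of (w, ij)).2| `^ p = 2 * senergy m f.
  rewrite /senergy mulr_sumr; apply: eq_bigr => w _.
  rewrite /ordered_edges !big_cons big_nil /= FpE !mxE.
  rewrite -!/(pw _) (pwC p (f (Psi w (q 1)))) (pwC p (f (Psi w (q 2))) (f (Psi w (q 1)))).
  rewrite (pwC p (f (Psi w (q 0))) (f (Psi w (q 2)))); ring.
by rewrite mulrACA mulVf// mul1r.
Qed.

(** The energy at level [m] is seen by the averages at small scales: choose values of
   [f] in fine cells, pass to a function on the fine vertices and coarsen. By
   continuity this function is close to [f] at level [m]. *)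
Lemma senergy_le_KSenergy : exists2 C, 0 < C & forall f, Lp K mu p f ->
  {within K, continuous f} -> forall m e, 0 < e -> exists2 d, 0 < d &
  forall rho E, 0 < rho < d ->
    (KSenergy K mu p (dim_exponent p r) f rho <= E%:E)%E ->
    r ^- m * senergy m f <= C * (E + e).
Proof.
have [C2 C20 H2] := oscillation_le hq hK hmu hp.
have [C1 C10 mono] := senergy_mono hp q hr.
pose A := 6 * kap * C1 * C2 * (3 / r) ^+ 4.
have A0 : 0 < A.
  apply: mulr_gt0; last by apply: exprn_gt0; apply: divr_gt0.
  by do 3 apply: mulr_gt0 => //.
exists (kap ^+ 2 * A); first by rewrite mulr_gt0 ?exprn_gt0.
move=> f hf cf m e e0.
have rm0 : 0 < r ^+ m by rewrite exprn_gt0.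
have e20 : 0 < e / 2 by rewrite divr_gt0.
have m60 : 0 < 6 * 3 ^+ m :> R by rewrite mulr_gt0 ?exprn_gt0.
pose dd := A * r ^+ m * (e / 2) / (6 * 3 ^+ m).
have dd0 : 0 < dd by apply: divr_gt0 => //; do 2 apply: mulr_gt0 => //.
pose d := dd `^ p^-1; have d0 : 0 < d by rewrite powR_gt0.
have pd : pw d = dd.
  by rewrite /pw ger0_norm ?powR_ge0// -powRrM mulVf ?gt_eqF// powRr1// ltW.
have [k Hk] := uniform_on_cells hK cf d0.
exists (2^-1 ^+ (maxn m k).+1); first by rewrite exprn_gt0 ?invr_gt0.
move=> rho E /andP[rho0 rhod] HE.
have [N hN] := exists_radius_level rho0.
have [mkN rhoN] := radius_level_small hN rhod.
have [g gf Hg] := H2 f hf (dim_exponent p r) rho N E (e / 2) rho0 hN e20 HE.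
have [j Hj] : exists j, (m + j = N + 4)%N.
  exists (N + 4 - m)%N; rewrite subnKC// (leq_trans (leq_maxl m k))//.
  by rewrite (leq_trans (ltnW mkN))// leq_addr.
have kN : (k <= N + 4)%N.
  by rewrite (leq_trans (leq_maxr m k))// (leq_trans (ltnW mkN))// leq_addr.
set n := (N + 4)%N in Hg Hj kN gf.
pose u := vertex_fun q n g.
have Ee0 : 0 <= E.
  by rewrite -lee_fin (le_trans _ HE)// (KSenergy_ge0 K mu p f _ rho0).
have close w i : w \in words m -> `|f (Psi w (q i)) - u (Psi w (q i))| <= d.
  rewrite mem_words => /eqP wm.
  have finer : Psi w (q i) = Psi (w ++ nseq j i) (q i).
    by rewrite Psi_cat; congr Psi; elim: (j) => [//|l IH] /=; rewrite -IH psi_fix.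
  have wn : w ++ nseq j i \in words n.
    by rewrite mem_words size_cat wm size_nseq Hj.
  have [v [vn _ [l vl] uE]] := vertex_funE q g i wn.
  rewrite -finer in vl uE; have [x vx gx] := gf v vn.
  rewrite /u uE gx; apply: (Hk v) => //.
    by move: vn; rewrite mem_words => /eqP ->.
  by rewrite -vl; exists (q l) => //; exact: vertexK hK l.
have pert := senergy_perturb hp (ltW d0) close.
have grad : gradient n g <= 3 ^+ n * oscillation f n g.
  rewrite /oscillation mulrDr [X in _ + X]mulrA divff ?expf_neq0// mul1r lerDr.
  by rewrite mulr_ge0 ?exprn_ge0// (sum_Iosc_ge0 hK hmu hp hf).
have al0 := ltW (dim_exponent_gt0 hp hr).
have := radius_powR_le hp rho0 al0 rhoN; rewrite (dim_exponentE hp hr) => rhopow.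
have osc : oscillation f n g <= C2 * (r / 3) ^+ N * (E + e / 2).
  apply: (le_trans Hg); rewrite ler_pM2r ?ltr_wpDl// ler_pM2l//.
have um : senergy m u <= A * r ^+ m * (E + e / 2).
  have := mono m j u; rewrite Hj => /le_trans; apply.
  apply: (@le_trans _ _ (C1 / r ^+ j * (6 * kap * (3 ^+ n *
    (C2 * (r / 3) ^+ N * (E + e / 2)))))).
    rewrite ler_pM2l; last by rewrite divr_gt0// exprn_gt0.
    apply: (le_trans (senergy_vertex_fun hp q n g)).
    rewrite ler_pM2l ?mulr_gt0//; apply: (le_trans grad).
    by rewrite ler_pM2l ?exprn_gt0.
  rewrite le_eqVlt; apply/orP; left; apply/eqP.
  have rN : r ^+ N * r ^+ 4 = r ^+ m * r ^+ j by rewrite -!exprD Hj.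
  have -> : r ^+ m = r ^+ N * r ^+ 4 / r ^+ j.
    by rewrite rN mulfK// expf_neq0// gt_eqF.
  rewrite /A /n !expr_div_n exprD; field.
  by rewrite !expf_neq0 ?gt_eqF.
rewrite ler_pdivrMl//; apply: (le_trans pert).
rewrite [leRHS](_ : _ = kap ^+ 2 * (A * r ^+ m * (E + e / 2) + A * r ^+ m * (e / 2)));
  last by field.
rewrite ler_pM2l ?exprn_gt0//; apply: lerD => //.
by rewrite pd /dd mulrC divfK// gt_eqF.
Qed.

(** * Comparison with the variation *)

Lemma energy_ge0 f : (0 <= energy q p r f)%E.
Proof.
apply: (@le_trans _ _ (energy_level q p r 0 f)%:E).
  by rewrite energy_levelE expr0 invr1 mul1r lee_fin senergy_ge0.
by apply: ereal_sup_ubound; exists 0%N.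
Qed.

Local Notation Var1 f := (limf_einf
  (fun rho => KSenergy K mu p (dim_exponent p r) f rho `^ p^-1)%E 0^'+).

Lemma poweR_mono (x y : \bar R) (s : R) : 0 <= s -> (0 <= x)%E -> (x <= y)%E ->
  (x `^ s <= y `^ s)%E.
Proof.
move=> s0 x0 xy; apply: gt0_ler_poweR => //.
  by rewrite in_itv /= x0 leey.
by rewrite in_itv /= (le_trans x0 xy) leey.
Qed.

Lemma poweR_invK (x : R) : 0 <= x -> ((x `^ p^-1)%:E `^ p = x%:E)%E.
Proof. by move=> x0; rewrite poweR_EFin -powRrM mulVf ?gt_eqF// powRr1. Qed.

Lemma Var_ge0 f : (0 <= Var1 f)%E.
Proof. by apply: (limf_einf_ge ltr01) => rho _; exact: poweR_ge0. Qed.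

Lemma Var_le_energy : exists2 C, 0 < C & forall f, Lp K mu p f ->
  {within K, continuous f} -> (C%:E * Var1 f `^ p <= energy q p r f)%E.
Proof.
have [C C0 HC] := oscillation_continuous hq hK hmu hp hr.
have [C1 C10 H1] := KSenergy_bounded hq hK hmu hp hr.
exists (C1 * C)^-1; first by rewrite invr_gt0 mulr_gt0.
move=> f hf cf.
case ES : (energy q p r f) => [S| |]; first last.
- by have := energy_ge0 f; rewrite ES.
- by rewrite leey.
have S0 : 0 <= S by rewrite -lee_fin -ES energy_ge0.
have fS k : senergy k f <= S * r ^+ k.
  have : ((energy_level q p r k f)%:E <= S%:E)%E.
    by rewrite -ES; apply: ereal_sup_ubound; exists k.
  by rewrite energy_levelE lee_fin ler_pdivrMl ?exprn_gt0 // mulrC.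
have bnd rho : 0 < rho ->
    (KSenergy K mu p (dim_exponent p r) f rho <= (C1 * (C * S))%:E)%E.
  apply: H1 => //; first by rewrite mulr_ge0// ltW.
  by move=> n; exists (fun w => f (Psi w (q 0))); exact: HC.
have X0 : 0 <= C1 * (C * S) by rewrite !mulr_ge0// ltW.
have : (Var1 f <= ((C1 * (C * S)) `^ p^-1)%:E)%E.
  apply: limf_einf_le => rho rho0; rewrite -poweR_EFin; apply: poweR_mono.
  - by rewrite invr_ge0 ltW.
  - exact: KSenergy_ge0.
  - exact: bnd.
move=> /(poweR_mono (ltW p_gt0) (Var_ge0 f)); rewrite poweR_invK// => HV.
have CC : 0 <= (C1 * C)^-1 by rewrite invr_ge0 mulr_ge0 ?ltW.
apply: (le_trans (lee_wpmul2l (lee_tofin CC) HV)).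
by rewrite -EFinM lee_fin (mulrA C1) mulrA mulVf ?mul1r// gt_eqF// mulr_gt0.
Qed.

Lemma energy_le_Var : exists2 C, 0 < C & forall f, Lp K mu p f ->
  {within K, continuous f} -> (energy q p r f <= C%:E * Var1 f `^ p)%E.
Proof.
have [C C0 HC] := senergy_le_KSenergy.
exists C => // f hf cf; apply: ge_ereal_sup => _ [m _ <-].
rewrite energy_levelE; set Y := r ^- m * _.
case EV : (Var1 f `^ p)%E => [V| |]; first last.
- by have := poweR_ge0 (Var1 f) p; rewrite EV.
- by rewrite gt0_muley ?lte_fin// leey.
rewrite -EFinM lee_fin; apply/ler_addgt0Pr => e e0.
have eC : 0 < e / C by rewrite divr_gt0.
have [d d0 Hd] := HC f hf cf m (e / C) eC.
have -> : C * V + e = C * (V + e / C) by field; rewrite gt_eqF.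
rewrite -ler_pdivrMl// -lerBlDr.
set X := C^-1 * Y - e / C.
have [X0|X0] := leP 0 X; last first.
  apply: (le_trans (ltW X0)); rewrite -lee_fin -EV; exact: poweR_ge0.
have XE rho : 0 < rho < d ->
    (X%:E <= KSenergy K mu p (dim_exponent p r) f rho)%E.
  move=> rhod; have rho0 : 0 < rho by case/andP: rhod.
  case E' : (KSenergy _ _ _ _ _ rho) => [E| |]; first last.
  - by have := KSenergy_ge0 K mu p f (dim_exponent p r) rho0; rewrite E'.
  - by rewrite leey.
  have HE : (KSenergy K mu p (dim_exponent p r) f rho <= E%:E)%E by rewrite E'.
  rewrite lee_fin /X lerBlDr ler_pdivrMl//; exact: (Hd rho E rhod HE).
have : ((X `^ p^-1)%:E <= Var1 f)%E.
  apply: (limf_einf_ge d0) => rho rhod; rewrite -poweR_EFin; apply: poweR_mono => //.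
    by rewrite invr_ge0 ltW.
  exact: XE.
have Xp0 : (0 <= (X `^ p^-1)%:E)%E by rewrite lee_fin powR_ge0.
move=> /(poweR_mono (ltW p_gt0) Xp0); rewrite poweR_invK// EV lee_fin//.
Qed.

End vertex_energy.

Theorem theorem6p6 (R : realType) (q : 'I_3 -> plane R)
  (hq : unit_equilateral q)
  (K : set (plane R)) (hK : is_gasket q K)
  (mu : {measure set (borel_plane R) -> \bar R})
  (hmu : is_gasket_measure q K mu)
  (p : R) (hp : 1 <= p) :
  propertyP K mu p (critical_exponent K mu p) /\
  (1 < p ->
   forall rp : R, is_renormalization_number p rp ->
   exists C1 C2 : R, [/\ 0 < C1, 0 < C2 &
     forall f : plane R -> R,
       {within K, continuous f} ->
       KS K mu p (critical_exponent K mu p) f ->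
       (C1%:E * Var K mu p f `^ p <= energy q p rp f)%E /\
       (energy q p rp f <= C2%:E * Var K mu p f `^ p)%E]).
Proof.
split.
  have [r hr] := scaling_exists hp.
  have nc : exists f, Besov K mu p (dim_exponent p r) f /\ ~ ae_constant K mu f.
    have [p1|] := eqVneq p 1; first exact: (nonconstant_Besov_1 hq hK hmu hp hr p1).
    rewrite neq_lt ltNge hp /= => p1.
    exact: (nonconstant_Besov_gt1 hq hK hmu hp hr p1).
  rewrite (critical_exponentE hq hK hmu hp hr nc).
  exact: (propertyP_of_nonconstant hq hK hmu hp hr nc).
move=> p1 rp /renormalization_number_scaling hr.
have nc := nonconstant_Besov_gt1 hq hK hmu hp hr p1.
have [C1 C10 H1] := Var_le_energy hq hK hmu hp hr.
have [C2 C20 H2] := energy_le_Var hq hK hmu hp hr.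
exists C1, C2; split=> // f cf [hf _].
rewrite /Var (critical_exponentE hq hK hmu hp hr nc).
by split; [exact: H1|exact: H2].
Qed.
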